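(* Let $(\Omega,T)$ be the symbolic model of a reasonable rank-one construction, and $\mu$ its unique non-atomic $T$-invariant probability measure. Assume $(\Omega,T,\mu)$ is weakly mixing and that for all distinct primes $p,q$ the systems $(\Omega,T^p,\mu)$ and $(\Omega,T^q,\mu)$ are disjoint in the sense of Furstenberg. Then for every continuous $f:\Omega\to\mathbb C$ and every $\omega\in\Omega$, $\frac1N\sum_{n=1}^Nf(T^n\omega)\boldsymbol\mu(n)\to0$, where $\boldsymbol\mu$ is the Möbius function.
   Context: Rank-one parameters: integers $p_n\ge2$, integers $s_{n,i}\ge0$ ($0\le i\le p_n-1$), $h_1=1$, $h_{n+1}=p_nh_n+\sum_is_{n,i}$, $\sum_n\frac1{h_{n+1}}\sum_is_{n,i}<\infty$. The construction is reasonable if $t_n:=\max_{0\le i\le p_n-1}s_{n,i}=o(h_n)$. Symbolic model: $B_1=0$, $B_{n+1}=B_n1^{s_{n,0}}B_n1^{s_{n,1}}\cdots B_n1^{s_{n,p_n-1}}$; $\Omega\subset\{0,1\}^{\mathbb Z}$ is the set of sequences all of whose finite subwords are subwords of some $B_m$; $T$ is the left shift on $\Omega$ (product topology). For each finite word $W$ the frequency of $W$ in $B_n$ converges to a limit $\mu([W])$, defining a shift-invariant probability $\mu$; it is the unique non-atomic invariant probability (the only other possible ergodic one is the Dirac mass at the all-ones sequence). Disjointness: the only joining (invariant probability on the product with the given marginals) is the product measure. $\boldsymbol\mu$: Möbius function. *)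

(* Defs.v *)
From Stdlib Require Import Reals Lra Lia ZArith Arith List Znumtheory Bool.
Import ListNotations.
Open Scope R_scope.

(* p n = p_n, s n i = s_{n,i}; only indices n >= 1 and i < p n are used. *)

Definition spsum (p : nat -> nat) (s : nat -> nat -> nat) (n : nat) : nat :=
  fold_right Nat.add 0%nat (map (s n) (seq 0 (p n))).

Definition tmax (p : nat -> nat) (s : nat -> nat -> nat) (n : nat) : nat :=
  fold_right Nat.max 0%nat (map (s n) (seq 0 (p n))).

(* h_1 = 1, h_{n+1} = p_n h_n + sum_i s_{n,i}  (h 0 is an unused junk value) *)
Fixpoint hgt (p : nat -> nat) (s : nat -> nat -> nat) (n : nat) : nat :=
  match n with
  | O => 1%nat
  | S m => if Nat.eqb m 0 then 1%nat else (p m * hgt p s m + spsum p s m)%nat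
  end.

(* B_1 = 0, B_{n+1} = B_n 1^{s_{n,0}} ... B_n 1^{s_{n,p_n-1}}; 0 = false, 1 = true.
   (B 0 is an unused junk value.) *)
Fixpoint Bw (p : nat -> nat) (s : nat -> nat -> nat) (n : nat) : list bool :=
  match n with
  | O => [false]
  | S m => if Nat.eqb m 0 then [false]
           else concat (map (fun i => Bw p s m ++ repeat true (s m i)) (seq 0 (p m)))
  end.

Definition summable_cond (p : nat -> nat) (s : nat -> nat -> nat) : Prop :=
  exists l : R,
    Un_cv (fun N => sum_f_R0 (fun k => INR (spsum p s (S k)) / INR (hgt p s (S (S k)))) N) l.

Definition reasonable (p : nat -> nat) (s : nat -> nat -> nat) : Prop :=
  Un_cv (fun n => INR (tmax p s (S n)) / INR (hgt p s (S n))) 0.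

Definition seqZ := Z -> bool.

Definition window (x : seqZ) (a : Z) (len : nat) : list bool :=
  map (fun j => x (a + Z.of_nat j)%Z) (seq 0 len).

Definition infix (w l : list bool) : Prop := exists l1 l2, l = l1 ++ w ++ l2.

Definition inOmega (p : nat -> nat) (s : nat -> nat -> nat) (x : seqZ) : Prop :=
  forall (a : Z) (len : nat), exists m : nat, (1 <= m)%nat /\ infix (window x a len) (Bw p s m).

Definition shiftn (n : nat) (x : seqZ) : seqZ := fun k => x (k + Z.of_nat n)%Z.

Definition occ (W l : list bool) : nat :=
  length (filter (fun i => if list_eq_dec Bool.bool_dec (firstn (length W) (skipn i l)) W
                           then true else false)
                 (seq 0 (length l - length W + 1))).

Definition cyl (W : list bool) (x : seqZ) : R :=
  if list_eq_dec Bool.bool_dec (window x 0 (length W)) W then 1 else 0.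

Definition agree (k : nat) (x y : seqZ) : Prop :=
  forall j : Z, (- Z.of_nat k <= j <= Z.of_nat k)%Z -> x j = y j.

Definition contO (p : nat -> nat) (s : nat -> nat -> nat) (f : seqZ -> R) : Prop :=
  forall x, inOmega p s x -> forall eps, 0 < eps ->
    exists k : nat, forall y, inOmega p s y -> agree k x y -> Rabs (f y - f x) < eps.

Definition contO2 (p : nat -> nat) (s : nat -> nat -> nat) (F : seqZ * seqZ -> R) : Prop :=
  forall z, inOmega p s (fst z) -> inOmega p s (snd z) -> forall eps, 0 < eps ->
    exists k : nat, forall z', inOmega p s (fst z') -> inOmega p s (snd z') ->
      agree k (fst z) (fst z') -> agree k (snd z) (snd z') -> Rabs (F z' - F z) < eps.

(* ---------- Borel probability measures as positive normalized functionals
   on continuous functions (Riesz representation) ---------- *)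
Definition prob_functional (p : nat -> nat) (s : nat -> nat -> nat)
    (L : (seqZ -> R) -> R) : Prop :=
  (forall f g, (forall x, inOmega p s x -> f x = g x) -> L f = L g) /\
  (forall f g a b, contO p s f -> contO p s g ->
     L (fun x => a * f x + b * g x) = a * L f + b * L g) /\
  (forall f, contO p s f -> (forall x, inOmega p s x -> 0 <= f x) -> 0 <= L f) /\
  L (fun _ => 1) = 1.

Definition inv_prob (p : nat -> nat) (s : nat -> nat -> nat) (L : (seqZ -> R) -> R) : Prop :=
  prob_functional p s L /\
  (forall f, contO p s f -> L (fun x => f (shiftn 1 x)) = L f).

Definition is_mu (p : nat -> nat) (s : nat -> nat -> nat) (L : (seqZ -> R) -> R) : Prop :=
  inv_prob p s L /\
  forall W : list bool,
    Un_cv (fun n => INR (occ W (Bw p s (S n))) / INR (hgt p s (S n))) (L (cyl W)).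

Definition weakly_mixing (p : nat -> nat) (s : nat -> nat -> nat) (L : (seqZ -> R) -> R) : Prop :=
  forall f g, contO p s f -> contO p s g ->
    Un_cv (fun N => / INR (S N) *
       sum_f_R0 (fun n => Rabs (L (fun x => f (shiftn n x) * g x) - L f * L g)) N) 0.

Definition joining (p : nat -> nat) (s : nat -> nat -> nat) (L : (seqZ -> R) -> R)
    (a b : nat) (J : (seqZ * seqZ -> R) -> R) : Prop :=
  (forall F G, (forall z, inOmega p s (fst z) -> inOmega p s (snd z) -> F z = G z) -> J F = J G) /\
  (forall F G c d, contO2 p s F -> contO2 p s G ->
     J (fun z => c * F z + d * G z) = c * J F + d * J G) /\
  (forall F, contO2 p s F ->
     (forall z, inOmega p s (fst z) -> inOmega p s (snd z) -> 0 <= F z) -> 0 <= J F) /\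
  J (fun _ => 1) = 1 /\
  (forall F, contO2 p s F -> J (fun z => F (shiftn a (fst z), shiftn b (snd z))) = J F) /\
  (forall f, contO p s f -> J (fun z => f (fst z)) = L f) /\
  (forall f, contO p s f -> J (fun z => f (snd z)) = L f).

Definition disjoint_powers (p : nat -> nat) (s : nat -> nat -> nat) (L : (seqZ -> R) -> R)
    (a b : nat) : Prop :=
  forall J, joining p s L a b J ->
    forall f g, contO p s f -> contO p s g ->
      J (fun z => f (fst z) * g (snd z)) = L f * L g.

Definition primeb (d : nat) : bool :=
  if prime_dec (Z.of_nat d) then true else false.

Definition squarefreeb (n : nat) : bool :=
  forallb (fun d => negb (Nat.eqb (n mod (d * d)) 0)) (seq 2 n).

Definition moebius (n : nat) : R :=
  if Nat.eqb n 0 then 0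
  else if squarefreeb n
       then (-1) ^ length (filter (fun d => andb (primeb d) (Nat.eqb (n mod d) 0)) (seq 2 n))
       else 0.

(* (1/N) sum_{n=1}^N f(T^n w) moebius(n), indexed by N-1 *)
Definition moeb_avg (f : seqZ -> R) (w : seqZ) (N : nat) : R :=
  / INR (S N) * sum_f_R0 (fun n => f (shiftn (S n) w) * moebius (S n)) N.

(* Main.v *)
(** When the orbit of [w] stays close to the fixed point 1^oo for long stretches, the mean
    of [f] along it need not converge, and already for constant [f] the statement is equivalent
    to M(N) = sum_{n <= N} mu(n) = o(N).  The latter is proved elementarily: Selberg's formula
    gives |M(x)| log^2 x <= 2 sum_{n <= x} log n |M(x/n)| + O(x log x), and since
    sum M(n)/(n(n+1)) is bounded, |M(y)|/y is small on a positive logarithmic proportion of [y],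
    so each bound |M(y)| <= b y can be improved.

    For general [f], fix N and choose k with h_k << N while the number of copies of B_{k+1}
    meeting [1,N] is small compared to N / max_{n <= N} |M(n)|.  On the gaps between these copies
    the orbit is near 1^oo, and the estimate for M suffices.  On the copies, the B_k-spacers are
    o(h_k) because the construction is reasonable, so the empirical measures restricted to the
    copies are asymptotically dominated by mu.  Any limit of the pair correlations along
    (T^a, T^b) restricted to the copies is therefore a multiple of a joining of T^a and T^b,
    hence of the product measure, and Katai's criterion applies. *)

Require Import Defs.
From mathcomp Require filter.
From Stdlib Require Import Reals Lra Lia ZArith Arith List Znumtheory Bool Classical
  ClassicalEpsilon FunctionalExtensionality.
Import ListNotations.
Set Bullet Behavior "Strict Subproofs".
Open Scope R_scope.

(** The ratio h_{k+1}/h_k is unbounded and N may lie anywhere between two heights, so one scale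
    cannot serve both purposes: frequencies must be read off blocks that are short compared with N,
    while switches between blocks and gaps must be rare. Hence the orbit is cut by copies of B_{k+1}
    but counted through copies of B_k; the level-k spacers inside B_{k+1} are paid for by t_k =
    o(h_k), and all higher spacers, which may be long compared with N, fall into the gaps.

    The counting yields only upper bounds, hence marginals nu of the limit with nu <= mu on
    nonnegative functions. They are T^a-invariant because shifting the summation index costs one
    error per switch. Weak mixing is what makes T^a ergodic for mu, and this turns nu <= mu into nu
    = nu(1) mu.

    Counting in blocks sees only words starting at nonnegative times, so f is replaced by a function
    of finitely many coordinates j >= 0; two-sided dependence is removed by shifting the point. *)

Lemma Rabs_le_inv a b : Rabs a <= b -> - b <= a <= b.
Proof. unfold Rabs. destruct (Rcase_abs a); lra. Qed.

(** * Finite sums *)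

Fixpoint sm (f : nat -> R) (n : nat) : R :=
  match n with
  | O => 0
  | S m => sm f m + f (S m)
  end.

(** Restricted sums are written with real-valued indicators as factors, so that they remain plain
    sums over 1..n which can be exchanged and rescaled. *)
Definition iv (b : bool) : R := if b then 1 else 0.

Lemma sm_S f n : sm f (S n) = sm f n + f (S n).
Proof. reflexivity. Qed.

Lemma iv_bounds b : 0 <= iv b <= 1.
Proof. destruct b; simpl; lra. Qed.

Lemma iv_andb a b : iv (a && b) = iv a * iv b.
Proof. destruct a, b; simpl; ring. Qed.

Lemma iv_negb a : iv (negb a) = 1 - iv a.
Proof. destruct a; simpl; ring. Qed.

Lemma sm_ext f g n : (forall i, (1 <= i <= n)%nat -> f i = g i) -> sm f n = sm g n.
Proof.
  induction n as [|n IH]; intros H; simpl; auto.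
  rewrite IH by (intros; apply H; lia). rewrite H by lia. reflexivity.
Qed.

Lemma sm_le f g n : (forall i, (1 <= i <= n)%nat -> f i <= g i) -> sm f n <= sm g n.
Proof.
  induction n as [|n IH]; intros H; simpl; [lra|].
  apply Rplus_le_compat; [apply IH; intros; apply H; lia | apply H; lia].
Qed.

Lemma sm_plus f g n : sm (fun i => f i + g i) n = sm f n + sm g n.
Proof. induction n as [|n IH]; simpl; [ring|]. rewrite IH; ring. Qed.

Lemma sm_minus f g n : sm (fun i => f i - g i) n = sm f n - sm g n.
Proof. induction n as [|n IH]; simpl; [ring|]. rewrite IH; ring. Qed.

Lemma sm_scal c f n : sm (fun i => c * f i) n = c * sm f n.
Proof. induction n as [|n IH]; simpl; [ring|]. rewrite IH; ring. Qed.

Lemma sm_scal_r c f n : sm (fun i => f i * c) n = sm f n * c.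
Proof. induction n as [|n IH]; simpl; [ring|]. rewrite IH; ring. Qed.

Lemma sm_opp f n : sm (fun i => - f i) n = - sm f n.
Proof. induction n as [|n IH]; simpl; [ring|]. rewrite IH; ring. Qed.

Lemma sm_const c n : sm (fun _ => c) n = INR n * c.
Proof. induction n as [|n IH]; [simpl; ring|]. rewrite S_INR. simpl sm. rewrite IH; ring. Qed.

Lemma sm_0 f n : (forall i, (1 <= i <= n)%nat -> f i = 0) -> sm f n = 0.
Proof.
  intros H. rewrite (sm_ext _ (fun _ => 0)) by auto. rewrite sm_const; ring.
Qed.

Lemma sm_nonneg f n : (forall i, (1 <= i <= n)%nat -> 0 <= f i) -> 0 <= sm f n.
Proof.
  intros H. rewrite <- (sm_0 (fun _ => 0) n) by auto. apply sm_le; auto.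
Qed.

Lemma sm_abs f n : Rabs (sm f n) <= sm (fun i => Rabs (f i)) n.
Proof.
  induction n as [|n IH]; simpl; [rewrite Rabs_R0; lra|].
  eapply Rle_trans; [apply Rabs_triang|]. lra.
Qed.

Lemma sm_abs_le f g n :
  (forall i, (1 <= i <= n)%nat -> Rabs (f i) <= g i) -> Rabs (sm f n) <= sm g n.
Proof.
  intros H. eapply Rle_trans; [apply sm_abs|]. apply sm_le; auto.
Qed.

Lemma sm_swap (f : nat -> nat -> R) n m :
  sm (fun i => sm (fun j => f i j) m) n = sm (fun j => sm (fun i => f i j) n) m.
Proof.
  induction n as [|n IH]; simpl.
  - symmetry; apply sm_0; auto.
  - rewrite IH, <- sm_plus. apply sm_ext; auto.
Qed.

(** Together with [sm_swap] this is the re-indexing device used throughout: insert the indicator of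
    an equation, exchange the sums, collapse the inner one. *)
Lemma sm_pick f k n : (1 <= k <= n)%nat ->
  sm (fun i => iv (Nat.eqb k i) * f i) n = f k.
Proof.
  induction n as [|n IH]; intros Hk; [lia|]; simpl.
  destruct (Nat.eq_dec k (S n)) as [->|Hne].
  - rewrite Nat.eqb_refl, sm_0; [simpl; ring|].
    intros i Hi. rewrite (proj2 (Nat.eqb_neq _ _)) by lia. simpl; ring.
  - rewrite IH by lia. rewrite (proj2 (Nat.eqb_neq _ _)) by lia. simpl; ring.
Qed.

Lemma sm_pick_out f k n : ~ (1 <= k <= n)%nat ->
  sm (fun i => iv (Nat.eqb k i) * f i) n = 0.
Proof.
  intros Hk. apply sm_0. intros i Hi. rewrite (proj2 (Nat.eqb_neq _ _)) by lia. simpl; ring.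
Qed.

Lemma sm_trunc f k n : (k <= n)%nat -> sm (fun i => iv (Nat.leb i k) * f i) n = sm f k.
Proof.
  induction n as [|n IH]; intros Hk.
  - replace k with 0%nat by lia; reflexivity.
  - destruct (Nat.eq_dec k (S n)) as [->|Hne].
    + apply sm_ext. intros i Hi. destruct (Nat.leb_spec i (S n)); [simpl; ring|lia].
    + rewrite sm_S, IH by lia. destruct (Nat.leb_spec (S n) k); [lia|]. unfold iv; ring.
Qed.

Lemma sm_extend f k n : (k <= n)%nat -> (forall i, (k < i <= n)%nat -> f i = 0) ->
  sm f n = sm f k.
Proof.
  intros Hk H. rewrite <- (sm_trunc f k n Hk). apply sm_ext. intros i Hi.
  destruct (Nat.leb_spec i k); simpl; [ring|]. rewrite H by lia. ring.
Qed.

Lemma sm_mono f k n : (k <= n)%nat -> (forall i, (k < i <= n)%nat -> 0 <= f i) ->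
  sm f k <= sm f n.
Proof.
  intros Hk H. rewrite <- (sm_trunc f k n Hk). apply sm_le. intros i Hi.
  destruct (Nat.leb_spec i k); simpl; [lra|]. specialize (H i). rewrite Rmult_0_l. apply H. lia.
Qed.

Definition dvdb (d n : nat) : bool := Nat.eqb (n mod d) 0.

Lemma dvdb_spec d n : d <> 0%nat -> reflect (Nat.divide d n) (dvdb d n).
Proof.
  intros Hd. unfold dvdb. destruct (Nat.eqb_spec (n mod d) 0) as [H|H]; constructor.
  - apply Nat.Lcm0.mod_divide in H. exact H.
  - intros H'. apply H. apply Nat.Lcm0.mod_divide. exact H'.
Qed.

Lemma sm_multiples d f n : (1 <= d)%nat ->
  sm (fun i => iv (dvdb d i) * f i) n =
  sm (fun m => iv (Nat.leb (d * m) n) * f (d * m)%nat) n.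
Proof.
  intros Hd.
  transitivity (sm (fun i => sm (fun m => iv (Nat.eqb (d * m) i) * f i) n) n).
  - apply sm_ext. intros i Hi. destruct (dvdb_spec d i) as [[q Hq]|Hnd]; try lia.
    + rewrite (sm_ext _ (fun m => iv (Nat.eqb q m) * f i)).
      * rewrite (sm_pick (fun _ => f i)); [simpl; ring|]. subst i. nia.
      * intros m Hm. destruct (Nat.eqb_spec (d * m) i), (Nat.eqb_spec q m); auto; nia.
    + rewrite sm_0; [simpl; ring|]. intros m Hm.
      destruct (Nat.eqb_spec (d * m) i) as [E|E]; [|simpl; ring].
      exfalso; apply Hnd. exists m. lia.
  - rewrite sm_swap. apply sm_ext. intros m Hm.
    destruct (Nat.leb_spec (d * m) n) as [H|H].
    + rewrite (sm_pick f) by nia. simpl; ring.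
    + rewrite sm_pick_out by nia. simpl; ring.
Qed.

Lemma sm_multiples_div d f n : (1 <= d)%nat ->
  sm (fun i => iv (dvdb d i) * f i) n = sm (fun m => f (d * m)%nat) (n / d).
Proof.
  intros Hd. rewrite sm_multiples by auto.
  rewrite <- (sm_trunc _ (n / d) n).
  - apply sm_ext. intros m Hm. f_equal. f_equal.
    destruct (Nat.leb_spec (d * m) n), (Nat.leb_spec m (n / d)); auto; exfalso.
    + pose proof (Nat.div_le_lower_bound n d m). lia.
    + pose proof (Nat.Div0.mul_div_le n d). nia.
  - apply Nat.Div0.div_le_upper_bound. nia.
Qed.

Lemma sm_abel f v n :
  sm (fun i => f i * v i) (S n) =
  sm f (S n) * v (S n) + sm (fun i => sm f i * (v i - v (S i))) n.
Proof.
  induction n as [|n IH]; [simpl; ring|].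
  change (sm (fun i => f i * v i) (S (S n))) with (sm (fun i => f i * v i) (S n) + f (S (S n)) * v (S (S n))).
  rewrite IH.
  change (sm (fun i => sm f i * (v i - v (S i))) (S n)) with
   (sm (fun i => sm f i * (v i - v (S i))) n + sm f (S n) * (v (S n) - v (S (S n)))).
  change (sm f (S (S n))) with (sm f (S n) + f (S (S n))). ring.
Qed.

Lemma sm_telescope v n : sm (fun i => v i - v (S i)) n = v 1%nat - v (S n).
Proof. induction n as [|n IH]; simpl; [ring|]. rewrite IH; ring. Qed.

(** * Dirichlet convolution *)

(** The symmetric double sum reduces commutativity and associativity to exchanging sums; [conv_div]
    recovers the form over divisors. *)
Definition conv (f g : nat -> R) (n : nat) : R :=
  sm (fun a => sm (fun b => iv (Nat.eqb (a * b) n) * (f a * g b)) n) n.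

Lemma conv_extend f g n X : (n <= X)%nat ->
  (1 <= n)%nat ->
  conv f g n = sm (fun a => sm (fun b => iv (Nat.eqb (a * b) n) * (f a * g b)) X) X.
Proof.
  intros HX Hn. unfold conv. symmetry.
  rewrite (sm_extend _ n X HX).
  - apply sm_ext. intros a Ha. apply sm_extend; auto.
    intros b Hb. rewrite (proj2 (Nat.eqb_neq _ _)) by nia. simpl; ring.
  - intros a Ha. apply sm_0. intros b Hb.
    rewrite (proj2 (Nat.eqb_neq _ _)) by nia. simpl; ring.
Qed.

Lemma conv_div f g n : (1 <= n)%nat ->
  conv f g n = sm (fun a => iv (dvdb a n) * (f a * g (n / a)%nat)) n.
Proof.
  intros Hn. apply sm_ext. intros a Ha.
  destruct (dvdb_spec a n) as [[q Hq]|Hd]; try lia.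
  - rewrite (sm_ext _ (fun b => iv (Nat.eqb q b) * (f a * g b))).
    + rewrite sm_pick by nia. subst n. rewrite Nat.div_mul by lia. simpl; ring.
    + intros b Hb. f_equal. f_equal.
      destruct (Nat.eqb_spec (a * b) n), (Nat.eqb_spec q b); auto; nia.
  - rewrite sm_0; [simpl; ring|]. intros b Hb.
    destruct (Nat.eqb_spec (a * b) n); [|simpl; ring].
    exfalso; apply Hd; exists b; lia.
Qed.

Lemma sm_conv f g H x :
  sm (fun n => conv f g n * H n) x =
  sm (fun a => sm (fun b => iv (Nat.leb (a * b) x) * (f a * g b * H (a * b)%nat)) x) x.
Proof.
  transitivity (sm (fun n => sm (fun a => sm (fun b =>
     iv (Nat.eqb (a * b) n) * (f a * g b * H n)) x) x) x).
  - apply sm_ext. intros n Hn. rewrite (conv_extend f g n x) by lia.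
    rewrite <- sm_scal_r. apply sm_ext. intros a Ha.
    rewrite <- sm_scal_r. apply sm_ext. intros b Hb. ring.
  - rewrite sm_swap. apply sm_ext. intros a Ha. rewrite sm_swap.
    apply sm_ext. intros b Hb.
    destruct (Nat.leb_spec (a * b) x).
    + rewrite (sm_pick (fun n => f a * g b * H n)) by nia. simpl; ring.
    + rewrite (sm_pick_out (fun n => f a * g b * H n)) by nia. simpl; ring.
Qed.

Lemma sm_conv_div f g H x :
  sm (fun n => conv f g n * H n) x =
  sm (fun a => sm (fun b => f a * g b * H (a * b)%nat) (x / a)) x.
Proof.
  rewrite sm_conv. apply sm_ext. intros a Ha.
  rewrite <- (sm_trunc _ (x / a) x).
  - apply sm_ext. intros m Hm. f_equal. f_equal.
    destruct (Nat.leb_spec (a * m) x), (Nat.leb_spec m (x / a)); auto; exfalso.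
    + pose proof (Nat.div_le_lower_bound x a m). lia.
    + pose proof (Nat.Div0.mul_div_le x a). nia.
  - apply Nat.Div0.div_le_upper_bound. nia.
Qed.

Lemma conv_ext f f' g g' n :
  (forall i, (1 <= i <= n)%nat -> f i = f' i) ->
  (forall i, (1 <= i <= n)%nat -> g i = g' i) -> conv f g n = conv f' g' n.
Proof.
  intros Hf Hg. apply sm_ext. intros a Ha. apply sm_ext. intros b Hb.
  rewrite Hf, Hg by auto. reflexivity.
Qed.

Lemma conv_comm f g n : conv f g n = conv g f n.
Proof.
  unfold conv. rewrite sm_swap. apply sm_ext. intros a Ha. apply sm_ext. intros b Hb.
  rewrite Nat.mul_comm. ring.
Qed.

Lemma conv_triple f g h n : (1 <= n)%nat ->
  conv (conv f g) h n =
  sm (fun a => sm (fun b => sm (fun c =>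
    iv (Nat.eqb (a * b * c) n) * (f a * g b * h c)) n) n) n.
Proof.
  intros Hn. unfold conv at 1.
  rewrite (sm_ext _ (fun u => conv f g u * sm (fun c => iv (Nat.eqb (u * c) n) * h c) n)).
  2:{ intros u Hu. rewrite <- sm_scal. apply sm_ext. intros; ring. }
  rewrite sm_conv. apply sm_ext. intros a Ha. apply sm_ext. intros b Hb.
  rewrite <- !sm_scal. apply sm_ext. intros c Hc.
  destruct (Nat.leb_spec (a * b) n); [simpl; ring|].
  rewrite (proj2 (Nat.eqb_neq _ _)) by nia. simpl; ring.
Qed.

Lemma conv_assoc f g h n : (1 <= n)%nat -> conv (conv f g) h n = conv f (conv g h) n.
Proof.
  intros Hn. rewrite (conv_comm f (conv g h)), !conv_triple by auto.
  rewrite sm_swap.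
  apply sm_ext. intros a Ha. rewrite sm_swap. rewrite sm_swap.
  rewrite sm_swap. apply sm_ext. intros c Hc. apply sm_ext. intros d Hd.
  replace (d * a * c)%nat with (a * c * d)%nat by lia. ring.
Qed.

Lemma conv_plus_r f g h n : conv f (fun i => g i + h i) n = conv f g n + conv f h n.
Proof.
  unfold conv. rewrite <- sm_plus. apply sm_ext. intros a Ha. rewrite <- sm_plus.
  apply sm_ext. intros; ring.
Qed.

Lemma conv_opp_l f g n : conv (fun i => - f i) g n = - conv f g n.
Proof.
  unfold conv. rewrite <- sm_opp. apply sm_ext. intros a Ha. rewrite <- sm_opp.
  apply sm_ext. intros; ring.
Qed.

(** Multiplication by log is a derivation for Dirichlet convolution, because ln (ab) = ln a + ln b
    on every pair with ab = n. *)
Lemma conv_ln f g n : (1 <= n)%nat ->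
  conv f g n * ln (INR n) =
  conv (fun i => f i * ln (INR i)) g n + conv f (fun i => g i * ln (INR i)) n.
Proof.
  intros Hn. unfold conv. rewrite <- sm_scal_r, <- sm_plus. apply sm_ext. intros a Ha.
  rewrite <- sm_scal_r, <- sm_plus. apply sm_ext. intros b Hb.
  destruct (Nat.eqb_spec (a * b) n) as [E|E]; [|simpl; ring].
  rewrite <- E, mult_INR, ln_mult by (apply lt_0_INR; lia). simpl; ring.
Qed.

Definition delta1 (n : nat) : R := iv (Nat.eqb 1 n).

Lemma conv_delta1 f n : (1 <= n)%nat -> conv delta1 f n = f n.
Proof.
  intros Hn. unfold conv, delta1.
  rewrite (sm_ext _ (fun a => iv (Nat.eqb 1 a) * sm (fun b => iv (Nat.eqb (a * b) n) * f b) n)).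
  - rewrite (sm_pick (fun a => sm (fun b => iv (Nat.eqb (a * b) n) * f b) n)) by lia.
    rewrite (sm_ext _ (fun b => iv (Nat.eqb n b) * f b)).
    + rewrite sm_pick by lia. reflexivity.
    + intros b Hb. rewrite Nat.mul_1_l, Nat.eqb_sym. reflexivity.
  - intros a Ha. rewrite <- sm_scal. apply sm_ext. intros; ring.
Qed.

(** * The Moebius function *)

Definition nprime (p : nat) : Prop := prime (Z.of_nat p).

Lemma primebP p : reflect (nprime p) (primeb p).
Proof. unfold primeb, nprime. destruct prime_dec; constructor; auto. Qed.

Lemma nprime_ge2 p : nprime p -> (2 <= p)%nat.
Proof. intros H. apply prime_ge_2 in H. lia. Qed.

Lemma divide_of_nat a b : Nat.divide a b <-> (Z.of_nat a | Z.of_nat b)%Z.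
Proof.
  split.
  - intros [q ->]. exists (Z.of_nat q). lia.
  - intros [q Hq]. destruct (Nat.eq_dec a 0) as [->|Ha].
    + exists 0%nat. lia.
    + exists (Z.to_nat q). destruct (Z_le_gt_dec 0 q); nia.
Qed.

Lemma nprime_mult p a b : nprime p -> Nat.divide p (a * b) -> Nat.divide p a \/ Nat.divide p b.
Proof.
  intros Hp H. rewrite !divide_of_nat in *. rewrite Nat2Z.inj_mul in H.
  apply prime_mult; auto.
Qed.

Lemma nprime_divisor n : (2 <= n)%nat -> exists p, nprime p /\ Nat.divide p n.
Proof.
  induction n as [n IH] using lt_wf_ind. intros Hn.
  destruct (primebP n) as [Hp|Hp].
  - exists n; split; auto. apply Nat.divide_refl.
  - unfold nprime in Hp. apply not_prime_divide in Hp; [|lia]. destruct Hp as (d & Hd & Hdn).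
    destruct (IH (Z.to_nat d)) as (p & Hp & Hpd); try lia.
    exists p; split; auto. eapply Nat.divide_trans; eauto.
    apply divide_of_nat. rewrite Z2Nat.id by lia. exact Hdn.
Qed.

Lemma nprime_dvd_eq p q : nprime p -> nprime q -> Nat.divide p q -> p = q.
Proof.
  intros Hp Hq H. apply divide_of_nat in H.
  apply prime_div_prime in H; auto. lia.
Qed.

Lemma squarefreebP n : (1 <= n)%nat ->
  squarefreeb n = true <-> (forall d, (2 <= d)%nat -> ~ Nat.divide (d * d) n).
Proof.
  intros Hn. unfold squarefreeb. rewrite forallb_forall. split.
  - intros H d Hd Hdn.
    assert (Hle : (d * d <= n)%nat) by (apply Nat.divide_pos_le; auto; lia).
    specialize (H d). rewrite in_seq in H.
    assert (Hm : (n mod (d * d) = 0)%nat) by (apply Nat.Lcm0.mod_divide; auto).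
    rewrite Hm in H. assert (false = true) by (apply H; nia). discriminate.
  - intros H d Hd. apply in_seq in Hd.
    destruct (Nat.eqb_spec (n mod (d * d)) 0) as [E|E]; auto.
    exfalso. apply (H d); [lia|]. apply Nat.Lcm0.mod_divide; auto.
Qed.

Definition primeDivs (n : nat) : list nat :=
  filter (fun d => andb (primeb d) (Nat.eqb (n mod d) 0)) (seq 2 n).

Lemma in_primeDivs n q : (1 <= n)%nat -> In q (primeDivs n) <-> nprime q /\ Nat.divide q n.
Proof.
  intros Hn. unfold primeDivs. rewrite filter_In, in_seq, andb_true_iff.
  change (Nat.eqb (n mod q) 0) with (dvdb q n). split.
  - intros (Hq & Hp & Hd). destruct (primebP q); [|discriminate].
    destruct (dvdb_spec q n); [lia|auto|discriminate].
  - intros (Hp & Hd). pose proof (nprime_ge2 _ Hp).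
    assert (q <= n)%nat by (apply Nat.divide_pos_le; auto; lia).
    destruct (primebP q); [|contradiction].
    destruct (dvdb_spec q n); [|lia|contradiction]. repeat split; auto; lia.
Qed.

Lemma moebius_eq n : (1 <= n)%nat ->
  moebius n = if squarefreeb n then (-1) ^ length (primeDivs n) else 0.
Proof.
  intros Hn. unfold moebius. rewrite (proj2 (Nat.eqb_neq _ _)) by lia. reflexivity.
Qed.

Lemma moebius_1 : moebius 1 = 1.
Proof.
  rewrite moebius_eq by lia. replace (squarefreeb 1) with true by reflexivity.
  replace (length (primeDivs 1)) with 0%nat; [reflexivity|].
  destruct (primeDivs 1) as [|q l] eqn:E; auto.
  assert (H : In q (primeDivs 1)) by (rewrite E; left; auto).
  apply in_primeDivs in H; auto. destruct H as (Hq & Hd). apply nprime_ge2 in Hq.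
  apply Nat.divide_1_r in Hd. lia.
Qed.

Lemma moebius_abs n : Rabs (moebius n) <= 1.
Proof.
  destruct n as [|n]; [unfold moebius; simpl; rewrite Rabs_R0; lra|].
  rewrite moebius_eq by lia. destruct squarefreeb.
  - rewrite pow_1_abs; lra.
  - rewrite Rabs_R0; lra.
Qed.

Lemma moebius_mul_dvd p e : nprime p -> (1 <= e)%nat -> Nat.divide p e -> moebius (p * e) = 0.
Proof.
  intros Hp He [q Hq]. pose proof (nprime_ge2 _ Hp). rewrite moebius_eq by nia.
  destruct (squarefreeb (p * e)) eqn:E; auto. exfalso.
  apply (proj1 (squarefreebP (p * e) ltac:(nia)) E p); [lia|]. exists q. subst e. ring.
Qed.

Lemma squarefreeb_mul p e : nprime p -> (1 <= e)%nat -> ~ Nat.divide p e ->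
  squarefreeb (p * e) = squarefreeb e.
Proof.
  intros Hp He Hpe. pose proof (nprime_ge2 _ Hp).
  apply eq_true_iff_eq. rewrite !squarefreebP by nia. split.
  - intros H' d Hd Hde. apply (H' d Hd). apply Nat.divide_mul_r; auto.
  - intros H' d Hd Hde.
    destruct (dvdb_spec p d) as [[q Hq]|Hpd]; [lia| |].
    + apply Hpe. destruct Hde as [r Hr]. exists (r * q * q)%nat. subst d. nia.
    + apply (H' d Hd). apply (Nat.gauss _ p); auto.
      destruct (Nat.eq_dec (Nat.gcd (d * d) p) 1) as [E|E]; auto. exfalso.
      assert (Hg : (2 <= Nat.gcd (d * d) p)%nat).
      { pose proof (Nat.gcd_divide_r (d * d) p) as Hdv.
        destruct (Nat.gcd (d*d) p) as [|[|g]]; try lia.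
        destruct Hdv as [z Hz]. lia. }
      destruct (nprime_divisor _ Hg) as (r & Hr & Hrg).
      assert (r = p).
      { apply nprime_dvd_eq; auto. eapply Nat.divide_trans; [exact Hrg|]. apply Nat.gcd_divide_r. }
      subst r. destruct (nprime_mult p d d Hp); auto.
      eapply Nat.divide_trans; [exact Hrg|]. apply Nat.gcd_divide_l.
Qed.

Lemma primeDivs_mul p e : nprime p -> (1 <= e)%nat -> ~ Nat.divide p e ->
  length (primeDivs (p * e)) = S (length (primeDivs e)).
Proof.
  intros Hp He Hpe. pose proof (nprime_ge2 _ Hp).
  change (S (length (primeDivs e))) with (length (p :: primeDivs e)).
  assert (N1 : NoDup (primeDivs (p * e))) by (apply NoDup_filter, seq_NoDup).
  assert (N2 : NoDup (p :: primeDivs e)).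
  { constructor; [|apply NoDup_filter, seq_NoDup]. rewrite in_primeDivs by auto. tauto. }
  apply Nat.le_antisymm; apply NoDup_incl_length; auto; intros q.
  - rewrite in_primeDivs by nia. intros (Hq & Hd).
    destruct (nprime_mult q p e Hq Hd) as [H1|H1].
    + left. symmetry; apply nprime_dvd_eq; auto.
    + right. apply in_primeDivs; auto.
  - intros [<-|Hq]; apply in_primeDivs; try nia.
    + split; auto. apply Nat.divide_factor_l.
    + apply in_primeDivs in Hq; auto. split; [tauto|]. apply Nat.divide_mul_r; tauto.
Qed.

Lemma moebius_mul_ndvd p e : nprime p -> (1 <= e)%nat -> ~ Nat.divide p e ->
  moebius (p * e) = - moebius e.
Proof.
  intros Hp He Hpe. pose proof (nprime_ge2 _ Hp). rewrite !moebius_eq by nia.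
  rewrite squarefreeb_mul, primeDivs_mul by auto. destruct squarefreeb; simpl; ring.
Qed.

(* Pair each divisor d prime to p with p d. *)
Lemma moebius_pairing p n (f : nat -> R) : nprime p -> (1 <= n)%nat -> Nat.divide p n ->
  sm (fun d => iv (dvdb d n) * (moebius d * f d)) n =
  sm (fun d => iv (dvdb d n) * (iv (negb (dvdb p d)) * (moebius d * (f d - f (p * d)%nat)))) n.
Proof.
  intros Hp Hn Hpn. pose proof (nprime_ge2 _ Hp).
  rewrite (sm_ext _ (fun d => iv (dvdb d n) * (iv (negb (dvdb p d)) * (moebius d * f d)) +
       iv (dvdb p d) * (iv (dvdb d n) * (moebius d * f d)))).
  2:{ intros d Hd. rewrite iv_negb. ring. }
  rewrite sm_plus, (sm_multiples p) by lia. rewrite <- sm_plus. apply sm_ext. intros d Hd.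
  destruct (dvdb_spec p d) as [D|D]; [lia| |].
  - rewrite (moebius_mul_dvd p d) by (auto; lia). simpl; ring.
  - rewrite (moebius_mul_ndvd p d) by (auto; lia).
    assert (E : Nat.divide (p * d) n <-> Nat.divide d n).
    { split; [intros [q Hq]; exists (q * p)%nat; rewrite Hq; ring|].
      intros [q Hq]. destruct (nprime_mult p q d Hp) as [[r Hr]|]; [|exists r; subst q; rewrite Hq; ring|tauto].
      rewrite <- Hq; auto. }
    destruct (dvdb_spec d n) as [H1|H1]; [lia| |].
    + apply E in H1. assert (p * d <= n)%nat by (apply Nat.divide_pos_le; auto; lia).
      rewrite (proj2 (Nat.leb_le _ _)) by lia.
      destruct (dvdb_spec (p * d) n); [nia| |contradiction]. simpl; ring.
    + destruct (dvdb_spec (p * d) n) as [H2|H2]; [nia|tauto|]. simpl; ring.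
Qed.

Lemma sum_moebius_divisors n : (2 <= n)%nat ->
  sm (fun d => iv (dvdb d n) * moebius d) n = 0.
Proof.
  intros Hn. destruct (nprime_divisor n Hn) as (p & Hp & Hpn).
  rewrite (sm_ext _ (fun d => iv (dvdb d n) * (moebius d * 1))) by (intros; ring).
  rewrite (moebius_pairing p n (fun _ => 1)) by (auto; lia).
  apply sm_0. intros; ring.
Qed.

Lemma conv_moebius_1 n : (1 <= n)%nat -> conv moebius (fun _ => 1) n = delta1 n.
Proof.
  intros Hn. rewrite conv_div by auto. unfold delta1.
  destruct (Nat.eqb_spec 1 n) as [<-|E].
  - simpl. rewrite moebius_1. unfold dvdb; simpl. ring.
  - rewrite (sm_ext _ (fun d => iv (dvdb d n) * moebius d)) by (intros; ring).
    apply sum_moebius_divisors. lia.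
Qed.

(** * The von Mangoldt function *)

(** Defined as mu * log, so the convolution identities are formal; only positivity requires the
    arithmetic of n. *)
Definition Lam (n : nat) : R := conv moebius (fun k => ln (INR k)) n.

(** Pairing divisors along a prime p of n leaves ln p times the sum of mu(d) over the divisors d
    prime to p. A second prime q of n cancels this sum by the same pairing; otherwise n is a power
    of p and only d = 1 survives. *)
Lemma Lam_nonneg n : (1 <= n)%nat -> 0 <= Lam n.
Proof.
  intros Hn. unfold Lam. rewrite conv_div by auto.
  destruct (Nat.eq_dec n 1) as [->|Hn1].
  { simpl. rewrite ln_1. unfold dvdb; simpl; lra. }
  destruct (nprime_divisor n ltac:(lia)) as (p & Hp & Hpn). pose proof (nprime_ge2 _ Hp).
  rewrite (moebius_pairing p n (fun d => ln (INR (n / d)))) by auto.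
  assert (Hlp : 0 < ln (INR p)).
  { rewrite <- ln_1. apply ln_increasing; [lra|]. apply lt_1_INR. lia. }
  (* On the paired divisors the difference of logarithms is constantly [ln p]. *)
  rewrite (sm_ext _ (fun d => ln (INR p) * (iv (dvdb d n) * (moebius d * iv (negb (dvdb p d)))))).
  2:{ intros d Hd. destruct (dvdb_spec p d) as [D|D]; [lia|simpl; ring|].
      destruct (dvdb_spec d n) as [[q Hq]|D']; [lia| |simpl; ring].
      destruct (nprime_mult p q d Hp) as [[r Hr]|]; [rewrite <- Hq; auto| |contradiction].
      replace (n / d)%nat with (p * r)%nat.
      2:{ subst n q. rewrite Nat.div_mul; lia. }
      replace (n / (p * d))%nat with r.
      2:{ subst n q. replace (r * p * d)%nat with (r * (p * d))%nat by lia.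
          rewrite Nat.div_mul; nia. }
      assert (1 <= r)%nat by (destruct r; nia).
      rewrite mult_INR, ln_mult by (apply lt_0_INR; lia). simpl; ring. }
  rewrite sm_scal. apply Rmult_le_pos; [lra|].
  destruct (classic (exists q, nprime q /\ Nat.divide q n /\ q <> p)) as [(q & Hq & Hqn & Hqp)|Hno].
  - rewrite (moebius_pairing q n (fun d => iv (negb (dvdb p d)))) by auto.
    rewrite sm_0; [lra|]. intros d Hd.
    replace (dvdb p (q * d)) with (dvdb p d); [ring|].
    destruct (dvdb_spec p d) as [D|D], (dvdb_spec p (q * d)) as [D'|D']; auto; try lia.
    + exfalso. apply D'. apply Nat.divide_mul_r; auto.
    + exfalso. destruct (nprime_mult p q d Hp D') as [D2|]; auto.
      apply Hqp. symmetry; apply nprime_dvd_eq; auto.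
  - apply sm_nonneg. intros d Hd.
    destruct (dvdb_spec d n) as [D|D]; [lia| |simpl; lra].
    destruct (Nat.eq_dec d 1) as [->|Hd1].
    + rewrite moebius_1. pose proof (iv_bounds (negb (dvdb p 1))). simpl iv at 1. lra.
    + destruct (nprime_divisor d ltac:(lia)) as (q & Hq & Hqd).
      assert (q = p). { apply NNPP. intros E. apply Hno. exists q. split; [auto|split; [|auto]].
        exact (Nat.divide_trans _ _ _ Hqd D). }
      subst q. destruct (dvdb_spec p d); [lia| |contradiction]. simpl; lra.
Qed.

Lemma conv_1_Lam n : (1 <= n)%nat -> conv (fun _ => 1) Lam n = ln (INR n).
Proof.
  intros Hn. unfold Lam. rewrite <- conv_assoc by auto.
  rewrite (conv_ext _ delta1 _ (fun k => ln (INR k))); auto.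
  - apply conv_delta1; auto.
  - intros i Hi. rewrite conv_comm. apply conv_moebius_1. lia.
Qed.

Lemma moebius_inversion (f g : nat -> R) n : (1 <= n)%nat ->
  (forall i, (1 <= i <= n)%nat -> conv (fun _ => 1) f i = g i) -> f n = conv moebius g n.
Proof.
  intros Hn H. rewrite (conv_ext moebius moebius g (conv (fun _ => 1) f)); auto.
  2:{ intros i Hi. symmetry; apply H; lia. }
  rewrite <- conv_assoc by auto.
  rewrite (conv_ext _ delta1 _ f); auto.
  - symmetry; apply conv_delta1; auto.
  - intros; apply conv_moebius_1; lia.
Qed.

(** Apply the derivation log to mu * 1 = delta: the left side vanishes, so (mu log) * 1 = - mu * log
    = - Lam, and Moebius inversion concludes. *)
Lemma moebius_ln n : (1 <= n)%nat ->
  moebius n * ln (INR n) = conv moebius (fun k => - Lam k) n.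
Proof.
  intros Hn. apply (moebius_inversion (fun k => moebius k * ln (INR k))); auto.
  intros i Hi. rewrite conv_comm.
  pose proof (conv_ln moebius (fun _ => 1) i ltac:(lia)) as E.
  rewrite conv_moebius_1 in E by lia. unfold Lam.
  rewrite (conv_ext _ moebius (fun i => 1 * ln (INR i)) (fun i => ln (INR i))) in E
    by (intros; ring).
  assert (delta1 i * ln (INR i) = 0).
  { unfold delta1. destruct (Nat.eqb_spec 1 i) as [<-|]; [change (INR 1) with 1; rewrite ln_1|]; simpl; ring. }
  lra.
Qed.

(** Selberg's weight. *)
Definition Lam2 (n : nat) : R := Lam n * ln (INR n) + conv Lam Lam n.

Lemma conv_nonneg f g n : (forall i, (1 <= i <= n)%nat -> 0 <= f i) ->
  (forall i, (1 <= i <= n)%nat -> 0 <= g i) -> 0 <= conv f g n.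
Proof.
  intros Hf Hg. apply sm_nonneg. intros a Ha. apply sm_nonneg. intros b Hb.
  apply Rmult_le_pos; [apply iv_bounds|]. apply Rmult_le_pos; auto.
Qed.

Lemma ln_nonneg x : 1 <= x -> 0 <= ln x.
Proof.
  intros [H|<-]; [|rewrite ln_1; lra].
  rewrite <- ln_1. left. apply ln_increasing; lra.
Qed.

Lemma INR_ge1 n : (1 <= n)%nat -> 1 <= INR n.
Proof. intros H. apply le_INR in H. exact H. Qed.

Lemma Lam2_bound n : (1 <= n)%nat -> Rabs (conv Lam Lam n - Lam n * ln (INR n)) <= Lam2 n.
Proof.
  intros Hn. unfold Lam2.
  assert (0 <= conv Lam Lam n) by (apply conv_nonneg; intros; apply Lam_nonneg; lia).
  assert (0 <= Lam n * ln (INR n)).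
  { apply Rmult_le_pos; [apply Lam_nonneg; auto|apply ln_nonneg, INR_ge1; auto]. }
  apply Rabs_le; lra.
Qed.

(** The derivation log applied once more to mu log = - mu * Lam. The two terms have opposite signs,
    but [Lam2_bound] dominates them by Selberg's weight, whose mean value is accessible. *)
Lemma moebius_ln2 n : (1 <= n)%nat ->
  moebius n * ln (INR n) ^ 2 = conv moebius (fun k => conv Lam Lam k - Lam k * ln (INR k)) n.
Proof.
  intros Hn. replace (moebius n * ln (INR n) ^ 2) with (moebius n * ln (INR n) * ln (INR n)) by ring.
  rewrite moebius_ln, conv_ln by auto.
  rewrite (conv_ext _ (conv moebius (fun k => - Lam k)) (fun i => - Lam i) (fun i => - Lam i));
    [|intros; apply moebius_ln; lia | auto].
  rewrite conv_assoc, <- conv_plus_r by auto. apply conv_ext; auto.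
  intros i Hi. rewrite conv_opp_l, conv_comm, conv_opp_l. ring.
Qed.

(** Since 1 * Lam = log, the derivation rule gives log^2 = 1 * (Lam log) + log * Lam = 1 * [Lam2];
    then invert. *)
Lemma Lam2_conv n : (1 <= n)%nat -> Lam2 n = conv moebius (fun k => ln (INR k) ^ 2) n.
Proof.
  intros Hn. apply moebius_inversion; auto. intros i Hi. unfold Lam2.
  rewrite conv_plus_r, <- conv_assoc by lia.
  rewrite (conv_ext (conv (fun _ => 1) Lam) (fun k => ln (INR k)) Lam Lam);
    [|intros; apply conv_1_Lam; lia|auto].
  pose proof (conv_ln (fun _ => 1) Lam i ltac:(lia)) as E.
  rewrite conv_1_Lam in E by lia.
  rewrite (conv_ext _ (fun i => ln (INR i)) Lam Lam) in E by (intros; ring).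
  lra.
Qed.

(** * Sums of monotone functions *)

Section SumIntegral.
Variables (phi Phi psi : R -> R).
Hypothesis HPhi : forall t, 1 <= t -> derivable_pt_lim Phi t (phi t).
Hypothesis Hvar : forall s t, 1 <= s -> s <= t -> Rabs (phi t - phi s) <= psi s - psi t.

Let D (n : nat) : R := sm (fun m => phi (INR m)) n - Phi (INR n).

Lemma psi_decr s t : 1 <= s -> s <= t -> psi t <= psi s.
Proof.
  intros Hs Ht. pose proof (Hvar s t Hs Ht). pose proof (Rabs_pos (phi t - phi s)). lra.
Qed.

(** By the mean value theorem each unit step changes D by phi(b+1) - phi(c), which is at most a drop
    of psi; the drops telescope. Bounding the variation of phi by psi, instead of asking phi to be
    monotone, also covers ln t / t, which rises before it falls. *)
Lemma sum_integral a b : (1 <= a <= b)%nat -> Rabs (D b - D a) <= psi (INR a) - psi (INR b).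
Proof.
  intros [Ha Hab]. induction Hab as [|b Hab IH].
  - rewrite Rminus_diag, Rabs_R0. lra.
  - assert (Hb : 1 <= INR b) by (apply INR_ge1; lia).
    destruct (MVT_cor2 Phi phi (INR b) (INR (S b))) as (c & Hc & Hc').
    + rewrite S_INR; lra.
    + intros c Hc. apply HPhi. lra.
    + rewrite S_INR in *.
      assert (H1 : Rabs (phi (INR b + 1) - phi c) <= psi c - psi (INR b + 1)) by (apply Hvar; lra).
      assert (H2 : psi c <= psi (INR b)) by (apply psi_decr; lra).
      replace (D (S b) - D a) with ((D b - D a) + (phi (INR b + 1) - phi c)).
      * eapply Rle_trans; [apply Rabs_triang|]. lra.
      * unfold D. rewrite sm_S, S_INR. lra.
Qed.

Lemma Phi_step Y y : 1 <= Y -> Y <= y <= Y + 1 ->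
  Rabs (Phi y - Phi Y) <= Rabs (phi Y) + (psi Y - psi y).
Proof.
  intros HY [[Hy|<-] Hy1].
  - destruct (MVT_cor2 Phi phi Y y Hy) as (c & Hc & Hc').
    + intros c Hc. apply HPhi. lra.
    + rewrite Hc, Rabs_mult, (Rabs_right (y - Y)) by lra.
      assert (H1 : Rabs (phi c - phi Y) <= psi Y - psi c) by (apply Hvar; lra).
      assert (H2 : psi y <= psi c) by (apply psi_decr; lra).
      pose proof (Rabs_triang (phi c - phi Y) (phi Y)) as H3.
      replace (phi c - phi Y + phi Y) with (phi c) in H3 by ring.
      pose proof (Rabs_pos (phi c)).
      apply Rle_trans with (Rabs (phi c) * 1); [apply Rmult_le_compat_l; lra|lra].
  - rewrite !Rminus_diag, Rabs_R0. pose proof (Rabs_pos (phi Y)). lra.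
Qed.

(** No value D a - psi a exceeds any D b + psi b, so their supremum is a limiting constant within
    psi of every D. The real y in [Y, Y+1] is allowed because the results are applied to y = x/a
    with Y its integer part. *)
Lemma sum_integral_const : (forall t, 1 <= t -> 0 <= psi t) ->
  exists gamma, forall (Y : nat) y, (1 <= Y)%nat -> INR Y <= y <= INR Y + 1 ->
   Rabs (sm (fun m => phi (INR m)) Y - Phi y - gamma) <= 2 * psi (INR Y) + Rabs (phi (INR Y)).
Proof.
  intros Hpos.
  assert (Hmid : forall a b, (1 <= a)%nat -> (1 <= b)%nat ->
     D a - psi (INR a) <= D b + psi (INR b)).
  { intros a b Ha Hb.
    pose proof (sum_integral a (max a b) ltac:(lia)) as H1.
    pose proof (sum_integral b (max a b) ltac:(lia)) as H2.
    pose proof (Hpos (INR (max a b)) ltac:(apply INR_ge1; lia)).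
    apply Rabs_le_inv in H1. apply Rabs_le_inv in H2. lra. }
  destruct (completeness (fun r => exists a, (1 <= a)%nat /\ r = D a - psi (INR a))) as (g & Hg1 & Hg2).
  - exists (D 1 + psi (INR 1)). intros r (a & Ha & ->). apply Hmid; lia.
  - exists (D 1 - psi (INR 1)). exists 1%nat; auto.
  - exists g. intros Y y HY Hy.
    assert (E1 : D Y - psi (INR Y) <= g) by (apply Hg1; eauto).
    assert (E2 : g <= D Y + psi (INR Y)).
    { apply Hg2. intros r (a & Ha & ->). apply Hmid; auto. }
    pose proof (Phi_step (INR Y) y (INR_ge1 _ HY) Hy) as H3.
    pose proof (INR_ge1 _ HY) as HY1.
    pose proof (Hpos y ltac:(lra)) as Hpy.
    unfold D in *.
    apply Rabs_le_inv in H3. apply Rabs_le. lra.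
Qed.
End SumIntegral.

Lemma derivable_pt_lim_eq f x l l' : derivable_pt_lim f x l -> l = l' -> derivable_pt_lim f x l'.
Proof. intros H <-; exact H. Qed.

Lemma Rdiv_le_swap a b c d : 0 < b -> 0 < d -> a * d <= c * b -> a / b <= c / d.
Proof.
  intros Hb Hd H. apply (Rmult_le_reg_r (b * d)); [apply Rmult_lt_0_compat; auto|].
  replace (a / b * (b * d)) with (a * d) by (field; lra).
  replace (c / d * (b * d)) with (c * b) by (field; lra). exact H.
Qed.

Lemma ln_le_sub1 x : 0 < x -> ln x <= x - 1.
Proof.
  intros Hx. pose proof (exp_ineq1_le (ln x)) as H. rewrite exp_ln in H by auto. lra.
Qed.

Lemma ln_le_mono x y : 0 < x -> x <= y -> ln x <= ln y.
Proof. intros Hx [H|<-]; [left; apply ln_increasing; auto|lra]. Qed.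

Lemma ln_div x y : 0 < x -> 0 < y -> ln (x / y) = ln x - ln y.
Proof.
  intros Hx Hy. unfold Rdiv. rewrite ln_mult, ln_Rinv; auto. apply Rinv_0_lt_compat; auto.
Qed.

Lemma harmonic_asymp : exists gamma, forall (Y : nat) y, (1 <= Y)%nat -> INR Y <= y <= INR Y + 1 ->
  Rabs (sm (fun m => / INR m) Y - ln y - gamma) <= 6 / y.
Proof.
  destruct (sum_integral_const (fun t => / t) ln (fun t => / t)) as [g Hg].
  - intros t Ht. apply derivable_pt_lim_ln. lra.
  - intros s t Hs Ht. assert (/ t <= / s) by (apply Rinv_le_contravar; lra).
    rewrite Rabs_left1; lra.
  - intros t Ht. left; apply Rinv_0_lt_compat; lra.
  - exists g. intros Y y HY Hy. eapply Rle_trans; [apply Hg; auto|].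
    pose proof (INR_ge1 _ HY) as H1.
    assert (0 < / INR Y) by (apply Rinv_0_lt_compat; lra).
    rewrite Rabs_right by lra.
    replace (2 * / INR Y + / INR Y) with (3 / INR Y) by (field; lra).
    apply Rdiv_le_swap; lra.
Qed.

Lemma log_harmonic_asymp : exists gamma, forall (Y : nat) y, (1 <= Y)%nat -> INR Y <= y <= INR Y + 1 ->
  Rabs (sm (fun m => ln (INR m) / INR m) Y - ln y ^ 2 / 2 - gamma) <= 6 * (2 + ln y) / y.
Proof.
  (* (2 + ln t)/t has derivative -(1 + ln t)/t^2, which dominates the derivative (1 - ln t)/t^2 of
     ln t / t in absolute value. *)
  destruct (sum_integral_const (fun t => ln t / t) (fun t => ln t ^ 2 / 2) (fun t => (2 + ln t) / t)) as [g Hg].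
  - intros t Ht.
    assert (E : (fun t => ln t ^ 2 / 2) = (mult_real_fct (/2) (ln * ln)%F)).
    { apply functional_extensionality. intros u. unfold mult_real_fct, mult_fct. field. }
    rewrite E. eapply derivable_pt_lim_eq.
    + apply derivable_pt_lim_scal, derivable_pt_lim_mult; apply derivable_pt_lim_ln; lra.
    + field; lra.
  - intros s t Hs Ht.
    assert (E1 : (1 + ln t) / t <= (1 + ln s) / s).
    { apply Rdiv_le_swap; try lra.
      pose proof (ln_le_sub1 (t / s)) as H. rewrite ln_div in H by lra.
      assert (0 < t / s) by (apply Rdiv_lt_0_compat; lra).
      assert (E : ln t - ln s <= t / s - 1) by auto.
      apply Rle_trans with ((ln s + t / s) * s); [apply Rmult_le_compat_r; lra|].
      replace ((ln s + t / s) * s) with (ln s * s + t) by (field; lra).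
      pose proof (ln_nonneg s Hs). nra. }
    assert (E2 : / t <= / s) by (apply Rinv_le_contravar; lra).
    replace ((2 + ln s) / s - (2 + ln t) / t) with
      ((1 + ln s) / s - (1 + ln t) / t + (/ s - / t)) by (field; lra).
    replace (ln t / t - ln s / s) with ((1 + ln t) / t - (1 + ln s) / s + (/ s - / t)) by (field; lra).
    apply Rabs_le. lra.
  - intros t Ht. pose proof (ln_nonneg t Ht).
    apply Rmult_le_pos; [lra|]. left; apply Rinv_0_lt_compat; lra.
  - exists g. intros Y y HY Hy. eapply Rle_trans; [apply Hg; auto|].
    pose proof (INR_ge1 _ HY) as H1.
    assert (0 < / INR Y) by (apply Rinv_0_lt_compat; lra).
    pose proof (ln_nonneg _ H1).
    assert (ln (INR Y) <= ln y) by (apply ln_le_mono; lra).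
    rewrite Rabs_right by (apply Rle_ge, Rmult_le_pos; lra).
    replace (2 * ((2 + ln (INR Y)) / INR Y) + ln (INR Y) / INR Y) with ((4 + 3 * ln (INR Y)) / INR Y) by (field; lra).
    apply Rdiv_le_swap; try lra.
    apply Rle_trans with ((6 + 3 * ln y) * (2 * INR Y)); [apply Rmult_le_compat; lra|lra].
Qed.

(** Here the summand grows and psi = - ln^2 is negative, so no limiting constant exists; the error
    has the size of the last term. The value -2 is D at the starting point 1. *)
Lemma log2_asymp (Y : nat) y : (1 <= Y)%nat -> INR Y <= y <= INR Y + 1 ->
  Rabs (sm (fun m => ln (INR m) ^ 2) Y - (y * ln y ^ 2 - 2 * (y * ln y) + 2 * y)) <= 2 * ln y ^ 2 + 2.
Proof.
  intros HY Hy.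
  set (Phi := fun t => t * ln t ^ 2 - 2 * (t * ln t) + 2 * t).
  assert (HPhi : forall t, 1 <= t -> derivable_pt_lim Phi t (ln t ^ 2)).
  { intros t Ht.
    assert (E : Phi = (id * (ln * ln) - mult_real_fct 2 (id * ln) + mult_real_fct 2 id)%F).
    { apply functional_extensionality. intros u.
      unfold Phi, mult_real_fct, mult_fct, plus_fct, minus_fct, id. ring. }
    rewrite E. eapply derivable_pt_lim_eq.
    + apply derivable_pt_lim_plus; [apply derivable_pt_lim_minus|].
      * apply derivable_pt_lim_mult; [apply derivable_pt_lim_id|].
        apply derivable_pt_lim_mult; apply derivable_pt_lim_ln; lra.
      * apply derivable_pt_lim_scal, derivable_pt_lim_mult; [apply derivable_pt_lim_id|].
        apply derivable_pt_lim_ln; lra.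
      * apply derivable_pt_lim_scal, derivable_pt_lim_id.
    + unfold mult_fct, id. field; lra. }
  assert (Hsq : forall s t, 1 <= s -> s <= t -> ln s ^ 2 <= ln t ^ 2).
  { intros s t Hs Ht. apply pow_incr. split; [apply ln_nonneg; auto|apply ln_le_mono; lra]. }
  assert (Hvar : forall s t, 1 <= s -> s <= t ->
     Rabs (ln t ^ 2 - ln s ^ 2) <= (- ln s ^ 2) - (- ln t ^ 2)).
  { intros s t Hs Ht. pose proof (Hsq s t Hs Ht). rewrite Rabs_right; lra. }
  pose proof (INR_ge1 _ HY) as H1.
  pose proof (sum_integral (fun t => ln t ^ 2) Phi (fun t => - ln t ^ 2) HPhi Hvar 1 Y ltac:(lia)) as S1.
  pose proof (Phi_step (fun t => ln t ^ 2) Phi (fun t => - ln t ^ 2) HPhi Hvar (INR Y) y H1 Hy) as S2.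
  assert (E1 : sm (fun m => ln (INR m) ^ 2) 1 - Phi (INR 1) = -2).
  { change (INR 1) with 1. rewrite sm_S. change (INR 1) with 1. unfold Phi. rewrite ln_1. simpl. ring. }
  cbv beta in S1. rewrite E1 in S1. fold (Phi y).
  cbv beta in S2. rewrite (Rabs_right (ln (INR Y) ^ 2)) in S2 by (apply Rle_ge, pow2_ge_0).
  pose proof (Hsq (INR Y) y H1 ltac:(lra)).
  change (INR 1) with 1 in S1. rewrite ln_1 in S1.
  apply Rabs_le_inv in S1. apply Rabs_le_inv in S2. apply Rabs_le. lra.
Qed.

Lemma ln_le_sqrt u : 1 <= u -> ln u <= 2 * sqrt u.
Proof.
  intros Hu. assert (Hs : 0 < sqrt u) by (apply sqrt_lt_R0; lra).
  rewrite <- (sqrt_sqrt u) at 1 by lra. rewrite ln_mult by auto.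
  pose proof (ln_le_sub1 _ Hs). lra.
Qed.

(** Square roots replace logarithms in error terms because the sum of sqrt (x/a) over a <= x is
    O(x). The 17 is 16 + 1, from ln u <= 4 u^(1/4) and 1 <= sqrt u. *)
Lemma ln2_le_sqrt u : 1 <= u -> 1 + ln u ^ 2 <= 17 * sqrt u.
Proof.
  intros Hu. assert (Hs : 1 <= sqrt u) by (rewrite <- sqrt_1; apply sqrt_le_1; lra).
  rewrite <- (sqrt_sqrt u) at 1 by lra. rewrite ln_mult by lra.
  pose proof (ln_le_sqrt _ Hs) as H. pose proof (ln_nonneg _ Hs).
  assert (E : sqrt (sqrt u) * sqrt (sqrt u) = sqrt u) by (apply sqrt_sqrt; lra).
  pose proof (sqrt_pos (sqrt u)). nra.
Qed.

Lemma sum_inv_sqrt n : sm (fun a => / sqrt (INR a)) n <= 2 * sqrt (INR n).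
Proof.
  induction n as [|n IH]; [simpl; rewrite sqrt_0; lra|].
  rewrite sm_S. pose proof (pos_INR n) as Hn.
  assert (Hs : 0 < sqrt (INR (S n))) by (apply sqrt_lt_R0; rewrite S_INR; lra).
  assert (Hs' : 0 <= sqrt (INR n)) by apply sqrt_pos.
  assert (E : sqrt (INR (S n)) * sqrt (INR (S n)) = INR n + 1) by (rewrite sqrt_sqrt; rewrite S_INR; lra).
  assert (E' : sqrt (INR n) * sqrt (INR n) = INR n) by (apply sqrt_sqrt; lra).
  assert (sqrt (INR n) <= sqrt (INR (S n))) by (apply sqrt_le_1; rewrite ?S_INR; lra).
  cut (/ sqrt (INR (S n)) <= 2 * (sqrt (INR (S n)) - sqrt (INR n))); [lra|].
  apply (Rmult_le_reg_r (sqrt (INR (S n)))); auto. rewrite Rinv_l by lra.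
  pose proof (Rle_0_sqr (sqrt (INR (S n)) - sqrt (INR n))) as Q. unfold Rsqr in Q. nra.
Qed.

Lemma sum_sqrt_div x : (1 <= x)%nat -> sm (fun a => sqrt (INR x / INR a)) x <= 2 * INR x.
Proof.
  intros Hx. pose proof (INR_ge1 _ Hx).
  rewrite (sm_ext _ (fun a => sqrt (INR x) * / sqrt (INR a))).
  - rewrite sm_scal. pose proof (sum_inv_sqrt x). pose proof (sqrt_pos (INR x)).
    pose proof (sqrt_sqrt (INR x) ltac:(lra)). nra.
  - intros a Ha. rewrite sqrt_div_alt; [reflexivity|]. apply lt_0_INR; lia.
Qed.

Lemma INR_div_bounds x a : (1 <= a <= x)%nat ->
  (1 <= x / a)%nat /\ INR (x / a) <= INR x / INR a <= INR (x / a) + 1 /\ 1 <= INR x / INR a.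
Proof.
  intros Ha. assert (H1 : (1 <= x / a)%nat) by (apply Nat.div_le_lower_bound; lia).
  pose proof (Nat.Div0.mul_div_le x a) as H2. pose proof (Nat.mul_succ_div_gt x a ltac:(lia)) as H3.
  apply le_INR in H2. apply lt_INR in H3. rewrite mult_INR in H2, H3. rewrite S_INR in H3.
  assert (0 < INR a) by (apply lt_0_INR; lia).
  assert (E : INR x = INR x / INR a * INR a) by (field; lra).
  pose proof (INR_ge1 _ H1).
  assert (INR (x / a) <= INR x / INR a) by nra.
  assert (INR x / INR a <= INR (x / a) + 1) by nra.
  repeat split; auto; lra.
Qed.

(** * Selberg's formula *)

Lemma selberg_err : exists A B C, forall (Y : nat) y, (1 <= Y)%nat -> INR Y <= y <= INR Y + 1 ->
  Rabs (sm (fun m => ln (INR m) ^ 2) Y -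
        sm (fun m => 2 * (y / INR m * ln (y / INR m)) + A * (y / INR m) + B) Y)
   <= C * (1 + ln y ^ 2).
Proof.
  destruct harmonic_asymp as [g0 H0]. destruct log_harmonic_asymp as [g1 H1].
  (* A and B are solved for by matching the coefficients of y ln y and y in the expansion of the
     right-hand sum with -2 and 2 in that of the sum of ln^2 m; the coefficient of y ln^2 y is
     matched by the factor 2. *)
  set (A := -2 - 2 * g0). set (B := 2 + 2 * g1 - A * g0).
  exists A, B, (40 + 6 * Rabs A + Rabs B). intros Y y HY Hy.
  specialize (H0 Y y HY Hy). specialize (H1 Y y HY Hy).
  pose proof (log2_asymp Y y HY Hy) as H2.
  pose proof (INR_ge1 _ HY) as HY1. pose proof (ln_nonneg y ltac:(lra)) as Hl.
  set (e0 := sm (fun m => / INR m) Y - ln y - g0) in *.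
  set (e1 := sm (fun m => ln (INR m) / INR m) Y - ln y ^ 2 / 2 - g1) in *.
  set (e2 := sm (fun m => ln (INR m) ^ 2) Y - _) in H2.
  set (e3 := INR Y - y).
  assert (He3 : Rabs e3 <= 1) by (unfold e3; apply Rabs_le; lra).
  assert (E : sm (fun m => 2 * (y / INR m * ln (y / INR m)) + A * (y / INR m) + B) Y =
    2 * y * ln y * sm (fun m => / INR m) Y - 2 * y * sm (fun m => ln (INR m) / INR m) Y
    + A * y * sm (fun m => / INR m) Y + B * INR Y).
  { rewrite (Rmult_comm B), <- (sm_const B Y), <- !sm_scal, <- sm_minus, <- !sm_plus. apply sm_ext.
    intros m Hm. assert (0 < INR m) by (apply lt_0_INR; lia).
    rewrite ln_div by lra. field. lra. }
  rewrite E.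
  replace (sm (fun m => / INR m) Y) with (e0 + ln y + g0) by (unfold e0; ring).
  replace (sm (fun m => ln (INR m) / INR m) Y) with (e1 + ln y ^ 2 / 2 + g1) by (unfold e1; ring).
  replace (sm (fun m => ln (INR m) ^ 2) Y) with (e2 + (y * ln y ^ 2 - 2 * (y * ln y) + 2 * y)) by (unfold e2; ring).
  replace (INR Y) with (e3 + y) by (unfold e3; ring).
  clearbody e0 e1 e2 e3. clear E.
  match goal with |- Rabs ?t <= _ =>
    replace t with (e2 - 2 * ln y * (y * e0) + 2 * (y * e1) - A * (y * e0) - B * e3)
     by (unfold B, A; field) end.
  assert (F0 : Rabs (y * e0) <= 6).
  { rewrite Rabs_mult, (Rabs_right y) by lra.
    apply Rle_trans with (y * (6 / y)); [apply Rmult_le_compat_l; lra|]. right; field; lra. }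
  assert (F1 : Rabs (y * e1) <= 6 * (2 + ln y)).
  { rewrite Rabs_mult, (Rabs_right y) by lra.
    apply Rle_trans with (y * (6 * (2 + ln y) / y)); [apply Rmult_le_compat_l; lra|]. right; field; lra. }
  clearbody A B.
  set (u := y * e0) in *. set (v := y * e1) in *. clearbody u v.
  assert (T1 : Rabs (2 * ln y * u) <= 12 * ln y).
  { rewrite Rabs_mult, (Rabs_right (2 * ln y)) by lra. nra. }
  assert (T2 : Rabs (2 * v) <= 12 * (2 + ln y)).
  { rewrite Rabs_mult, (Rabs_right 2) by lra. nra. }
  assert (T3 : Rabs (A * u) <= 6 * Rabs A).
  { rewrite Rabs_mult. pose proof (Rabs_pos A). nra. }
  assert (T4 : Rabs (B * e3) <= Rabs B).
  { rewrite Rabs_mult. pose proof (Rabs_pos B). nra. }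
  assert (T : Rabs (e2 - 2 * ln y * u + 2 * v - A * u - B * e3) <=
     2 * ln y ^ 2 + 2 + 12 * ln y + 12 * (2 + ln y) + 6 * Rabs A + Rabs B).
  { apply Rabs_le_inv in H2; apply Rabs_le_inv in T1; apply Rabs_le_inv in T2; apply Rabs_le_inv in T3; apply Rabs_le_inv in T4. apply Rabs_le. lra. }
  eapply Rle_trans; [apply T|].
  pose proof (Rabs_pos A). pose proof (Rabs_pos B).
  assert (2 * ln y <= 1 + ln y ^ 2) by (pose proof (pow2_ge_0 (ln y - 1)); lra).
  pose proof (pow2_ge_0 (ln y)) as L2.
  pose proof (Rmult_le_pos _ _ (Rabs_pos A) L2). pose proof (Rmult_le_pos _ _ (Rabs_pos B) L2). lra.
Qed.

Lemma moebius_sum_inversion F x : (1 <= x)%nat ->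
  sm (fun a => moebius a * sm (fun m => F (a * m)%nat) (x / a)) x = F 1%nat.
Proof.
  intros Hx.
  transitivity (sm (fun n => conv moebius (fun _ => 1) n * F n) x).
  - rewrite sm_conv_div. apply sm_ext. intros a Ha. rewrite <- sm_scal.
    apply sm_ext. intros; ring.
  - rewrite (sm_ext _ (fun n => iv (Nat.eqb 1 n) * F n)).
    + apply sm_pick. lia.
    + intros i Hi. rewrite conv_moebius_1 by lia. reflexivity.
Qed.

(** Moebius inversion recovers F(1) exactly from its sums over multiples, so once the sum of ln^2 is
    replaced by a sum of values of an explicit F, only the errors need to be added up. The 34 is 17
    times the 2 of [sum_sqrt_div]. *)
Lemma selberg : exists C, 0 <= C /\ forall x, (1 <= x)%nat ->
  Rabs (sm Lam2 x - 2 * INR x * ln (INR x)) <= C * INR x.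
Proof.
  destruct selberg_err as (A & B & C & H).
  exists (Rabs A + Rabs B + Rabs C * 34).
  split. { pose proof (Rabs_pos A). pose proof (Rabs_pos B). pose proof (Rabs_pos C). lra. }
  intros x Hx. pose proof (INR_ge1 _ Hx) as Hx1.
  set (F := fun n : nat => 2 * (INR x / INR n * ln (INR x / INR n)) + A * (INR x / INR n) + B).
  assert (E : sm Lam2 x = sm (fun a => moebius a * sm (fun m => ln (INR m) ^ 2) (x / a)) x).
  { rewrite (sm_ext _ (fun n => conv moebius (fun k => ln (INR k) ^ 2) n * 1)).
    - rewrite sm_conv_div. apply sm_ext. intros a Ha. rewrite <- sm_scal. apply sm_ext. intros; ring.
    - intros i Hi. rewrite Lam2_conv by lia. ring. }
  pose proof (moebius_sum_inversion F x Hx) as E2.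
  assert (E3 : Rabs (sm Lam2 x - F 1%nat) <= Rabs C * 34 * INR x).
  { rewrite <- E2, E, <- sm_minus.
    apply Rle_trans with (sm (fun a => (Rabs C * 17) * sqrt (INR x / INR a)) x).
    - apply sm_abs_le. intros a Ha. rewrite <- Rmult_minus_distr_l, Rabs_mult.
      destruct (INR_div_bounds x a Ha) as (D1 & D2 & D3).
      specialize (H (x / a)%nat (INR x / INR a) D1 D2).
      assert (E4 : sm (fun m => F (a * m)%nat) (x / a) =
        sm (fun m => 2 * (INR x / INR a / INR m * ln (INR x / INR a / INR m)) + A * (INR x / INR a / INR m) + B) (x / a)).
      { apply sm_ext. intros m Hm. unfold F. rewrite mult_INR.
        replace (INR x / (INR a * INR m)) with (INR x / INR a / INR m); auto.
        field. split; apply not_0_INR; lia. }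
      rewrite E4. pose proof (moebius_abs a).
      pose proof (ln2_le_sqrt _ D3) as L.
      pose proof (Rle_abs C). pose proof (Rabs_pos C).
      set (w := sm _ _ - sm _ _) in *. clearbody w.
      pose proof (Rabs_pos w). pose proof (pow2_ge_0 (ln (INR x / INR a))).
      apply Rle_trans with (Rabs w); [nra|].
      eapply Rle_trans; [apply H|].
      apply Rle_trans with (Rabs C * (1 + ln (INR x / INR a) ^ 2)); [apply Rmult_le_compat_r; lra|].
      rewrite Rmult_assoc. apply Rmult_le_compat_l; auto.
    - rewrite sm_scal. pose proof (sum_sqrt_div x Hx). pose proof (Rabs_pos C). nra. }
  assert (E4 : F 1%nat = 2 * INR x * ln (INR x) + A * INR x + B).
  { unfold F. change (INR 1) with 1. rewrite Rdiv_1_r. ring. }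
  rewrite E4 in E3. apply Rabs_le_inv in E3.
  pose proof (Rle_abs A). pose proof (Rle_abs (- A)). rewrite Rabs_Ropp in *.
  pose proof (Rle_abs B). pose proof (Rle_abs (- B)). rewrite Rabs_Ropp in *.
  apply Rabs_le. nra.
Qed.

(** * The mean value of the Moebius function *)

Definition Mert (x : nat) : R := sm moebius x.

Lemma Mert_lipschitz a b : (a <= b)%nat -> Rabs (Mert b - Mert a) <= INR b - INR a.
Proof.
  intros H. induction H as [|b H IH].
  - rewrite !Rminus_diag, Rabs_R0. lra.
  - unfold Mert in *. rewrite sm_S, S_INR.
    replace (sm moebius b + moebius (S b) - sm moebius a) with
      (sm moebius b - sm moebius a + moebius (S b)) by ring.
    eapply Rle_trans; [apply Rabs_triang|]. pose proof (moebius_abs (S b)). lra.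
Qed.

Lemma Mert_abs n : Rabs (Mert n) <= INR n.
Proof.
  pose proof (Mert_lipschitz 0 n ltac:(lia)) as H. unfold Mert in *. simpl in H.
  rewrite !Rminus_0_r in H. exact H.
Qed.

Lemma harmonic_le n : (1 <= n)%nat -> sm (fun m => / INR m) n <= 1 + ln (INR n).
Proof.
  induction n as [|n IH]; intros Hn; [lia|].
  destruct (Nat.eq_dec n 0) as [->|H0].
  - change (INR 1) with 1. rewrite ln_1, sm_S. change (INR 1) with 1. simpl. lra.
  - rewrite sm_S. pose proof (IH ltac:(lia)). pose proof (INR_ge1 n ltac:(lia)).
    rewrite S_INR in *.
    pose proof (ln_le_sub1 (INR n / (INR n + 1)) ltac:(apply Rdiv_lt_0_compat; lra)) as L.
    rewrite ln_div in L by lra.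
    replace (INR n / (INR n + 1) - 1) with (- / (INR n + 1)) in L by (field; lra). lra.
Qed.

Lemma inv_ge_ln n : (1 <= n)%nat -> ln (INR n + 1) - ln (INR n) <= / INR n.
Proof.
  intros Hn. pose proof (INR_ge1 n Hn).
  rewrite <- ln_div by lra.
  pose proof (ln_le_sub1 ((INR n + 1) / INR n) ltac:(apply Rdiv_lt_0_compat; lra)) as L.
  replace ((INR n + 1) / INR n - 1) with (/ INR n) in L by (field; lra). lra.
Qed.

Lemma sum_ln_div x : (1 <= x)%nat ->
  0 <= sm (fun n => ln (INR x) - ln (INR n)) x <= 4 * INR x.
Proof.
  intros Hx. split.
  - apply sm_nonneg. intros n Hn.
    assert (ln (INR n) <= ln (INR x)); [|lra]. apply ln_le_mono; [apply lt_0_INR; lia|apply le_INR; lia].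
  - apply Rle_trans with (sm (fun n => 2 * sqrt (INR x / INR n)) x).
    + apply sm_le. intros n Hn. destruct (INR_div_bounds x n Hn) as (_ & _ & H).
      rewrite <- ln_div by (apply lt_0_INR; lia). apply ln_le_sqrt; auto.
    + rewrite sm_scal. pose proof (sum_sqrt_div x Hx). lra.
Qed.

(** Sum the identity for mu log^2, grouping by the factor that carries the weight; the other factor
    sums to M(x/n). Replacing ln n by ln x costs at most 2 ln x times the sum of ln (x/n), which is
    O(x ln x). *)
Lemma Mert_log2_sum x : (1 <= x)%nat ->
  Rabs (Mert x) * ln (INR x) ^ 2 <= sm (fun n => Lam2 n * Rabs (Mert (x / n))) x + 8 * INR x * ln (INR x).
Proof.
  intros Hx. pose proof (INR_ge1 _ Hx) as H1. pose proof (ln_nonneg _ H1) as Hl.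
  set (S0 := sm (fun n => moebius n * ln (INR n) ^ 2) x).
  assert (HS : Rabs S0 <= sm (fun n => Lam2 n * Rabs (Mert (x / n))) x).
  { unfold S0. rewrite (sm_ext _ (fun n =>
      conv (fun k => conv Lam Lam k - Lam k * ln (INR k)) moebius n * 1)).
    - rewrite sm_conv_div. apply sm_abs_le. intros a Ha.
      rewrite (sm_ext _ (fun b => (conv Lam Lam a - Lam a * ln (INR a)) * moebius b)) by (intros; ring).
      rewrite sm_scal, Rabs_mult. apply Rmult_le_compat_r; [apply Rabs_pos|].
      apply Lam2_bound; lia.
    - intros i Hi. rewrite conv_comm, Rmult_1_r. apply moebius_ln2; lia. }
  assert (HD : Rabs (Mert x * ln (INR x) ^ 2 - S0) <= 8 * INR x * ln (INR x)).
  { unfold S0, Mert. rewrite <- sm_scal_r, <- sm_minus.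
    apply Rle_trans with (sm (fun n => 2 * ln (INR x) * (ln (INR x) - ln (INR n))) x).
    - apply sm_abs_le. intros n Hn. rewrite <- Rmult_minus_distr_l, Rabs_mult.
      pose proof (moebius_abs n). pose proof (ln_nonneg (INR n) (INR_ge1 n ltac:(lia))).
      assert (ln (INR n) <= ln (INR x)) by (apply ln_le_mono; [apply lt_0_INR; lia|apply le_INR; lia]).
      pose proof (Rabs_pos (moebius n)).
      rewrite (Rabs_right (ln (INR x) ^ 2 - ln (INR n) ^ 2)) by nra.
      apply Rle_trans with (1 * (ln (INR x) ^ 2 - ln (INR n) ^ 2)); [apply Rmult_le_compat_r; nra|nra].
    - rewrite sm_scal. pose proof (sum_ln_div x Hx). nra. }
  replace (Rabs (Mert x) * ln (INR x) ^ 2) with (Rabs (Mert x * ln (INR x) ^ 2)).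
  2:{ rewrite Rabs_mult, (Rabs_right (_ ^ 2)); auto. apply Rle_ge, pow2_ge_0. }
  pose proof (Rabs_triang S0 (Mert x * ln (INR x) ^ 2 - S0)) as T.
  replace (S0 + (Mert x * ln (INR x) ^ 2 - S0)) with (Mert x * ln (INR x) ^ 2) in T by ring. lra.
Qed.

(** Partial summation: by Selberg's formula [Lam2] - 2 ln has partial sums O(i), and the increments
    of |M(x/n)| are dominated by those of the integer part of x/n, since M changes by at most 1 per
    step. *)
Lemma Lam2_to_log : exists C, 0 <= C /\ forall x, (1 <= x)%nat ->
  sm (fun n => Lam2 n * Rabs (Mert (x / n))) x <=
  2 * sm (fun n => ln (INR n) * Rabs (Mert (x / n))) x + C * INR x * (1 + ln (INR x)).
Proof.
  destruct selberg as (C & HC & Hsel). exists (C + 8). split; [lra|]. intros x Hx.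
  pose proof (INR_ge1 _ Hx) as Hx1.
  destruct x as [|x']; [lia|]. set (x := S x') in *.
  set (v := fun n => Rabs (Mert (x / n))).
  set (q := fun n => INR (x / n)).
  set (e := fun n => Lam2 n - 2 * ln (INR n)).
  assert (He : forall i, (1 <= i)%nat -> Rabs (sm e i) <= (C + 8) * INR i).
  { intros i Hi. unfold e. rewrite sm_minus, sm_scal.
    pose proof (Hsel i Hi) as S1. pose proof (sum_ln_div i Hi) as S2.
    rewrite sm_minus, sm_const in S2.
    apply Rabs_le_inv in S1. apply Rabs_le. lra. }
  assert (Hv : forall i, (1 <= i)%nat -> Rabs (v i - v (S i)) <= q i - q (S i)).
  { intros i Hi. unfold v, q.
    eapply Rle_trans; [apply Rabs_triang_inv2|]. apply Mert_lipschitz.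
    apply Nat.div_le_compat_l. lia. }
  assert (HE : Rabs (sm (fun n => e n * v n) x) <= (C + 8) * INR x * (1 + ln (INR x))).
  { unfold x at 1. rewrite sm_abel. fold x.
    (* Abel summation read backwards turns the majorant into the sum of the integer parts of x/i, at
       most x (1 + ln x). *)
    pose proof (sm_abel (fun _ => 1) q x') as Q. fold x in Q.
    rewrite (sm_const 1 x), Rmult_1_r in Q.
    assert (HQ : sm (fun i => 1 * q i) x <= INR x * (1 + ln (INR x))).
    { apply Rle_trans with (sm (fun i => INR x * / INR i) x).
      - apply sm_le. intros i Hi. rewrite Rmult_1_l. unfold q.
        destruct (INR_div_bounds x i Hi) as (_ & H & _). unfold Rdiv in H. lra.
      - rewrite sm_scal. apply Rmult_le_compat_l; [lra|]. apply harmonic_le; auto. }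
    eapply Rle_trans; [apply Rabs_triang|].
    apply Rle_trans with ((C + 8) * (INR x * q x + sm (fun i => sm (fun _ => 1) i * (q i - q (S i))) x')).
    - rewrite Rmult_plus_distr_l, <- sm_scal. apply Rplus_le_compat.
      + rewrite Rabs_mult. replace ((C + 8) * (INR x * q x)) with (((C + 8) * INR x) * q x) by ring.
        apply Rmult_le_compat; auto using Rabs_pos.
        unfold v, q. rewrite Rabs_Rabsolu. apply Mert_abs.
      + apply sm_abs_le. intros i Hi. rewrite Rabs_mult, sm_const, Rmult_1_r.
        rewrite <- Rmult_assoc. apply Rmult_le_compat; auto using Rabs_pos.
        * apply He; lia.
        * apply Hv; lia.
    - rewrite <- Q, Rmult_assoc. apply Rmult_le_compat_l; [lra|auto]. }
  assert (E : sm (fun n => Lam2 n * Rabs (Mert (x / n))) x =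
     sm (fun n => e n * v n) x + 2 * sm (fun n => ln (INR n) * Rabs (Mert (x / n))) x).
  { rewrite <- sm_scal, <- sm_plus. apply sm_ext. intros; unfold e, v; ring. }
  rewrite E. apply Rabs_le_inv in HE. lra.
Qed.

(** * Intervals on which the summatory Moebius function is small *)

(** Inversion with F = 1 gives the sum of mu(a) times the integer part of x/a equal to 1; removing
    the integer parts costs at most x. *)
Lemma sum_moebius_div_bounded x : (1 <= x)%nat -> Rabs (sm (fun a => moebius a * / INR a) x) <= 2.
Proof.
  intros Hx. pose proof (INR_ge1 _ Hx) as Hx1.
  pose proof (moebius_sum_inversion (fun _ => 1) x Hx) as E.
  assert (H : Rabs (INR x * sm (fun a => moebius a * / INR a) x - 1) <= INR x).
  { rewrite <- E at 1. rewrite <- sm_scal, <- sm_minus.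
    apply Rle_trans with (sm (fun _ => 1) x); [|rewrite sm_const; lra].
    apply sm_abs_le. intros a Ha. rewrite sm_const, Rmult_1_r.
    destruct (INR_div_bounds x a Ha) as (_ & H & _).
    replace (INR x * (moebius a * / INR a) - moebius a * INR (x / a)) with
      (moebius a * (INR x / INR a - INR (x / a))) by (unfold Rdiv; ring).
    rewrite Rabs_mult, (Rabs_right (_ - _)) by lra.
    pose proof (moebius_abs a). pose proof (Rabs_pos (moebius a)). nra. }
  apply Rabs_le_inv in H. apply Rabs_le. split; apply (Rmult_le_reg_l (INR x)); lra.
Qed.

(** The partial sums of M(i)/(i(i+1)), i.e. what summation by parts leaves of the sum of mu(i)/i
    apart from the boundary term. *)
Definition MertSum (n : nat) : R := sm (fun i => Mert i * (/ INR i - / INR (S i))) n.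

Lemma MertSum_bounded n : Rabs (MertSum n) <= 3.
Proof.
  pose proof (sum_moebius_div_bounded (S n) ltac:(lia)) as H.
  rewrite (sm_abel moebius (fun i => / INR i)) in H.
  change (sm moebius (S n)) with (Mert (S n)) in H.
  change (sm _ n) with (MertSum n) in H.
  assert (H2 : Rabs (Mert (S n) * / INR (S n)) <= 1).
  { rewrite Rabs_mult, Rabs_inv, (Rabs_right (INR (S n))) by (apply Rle_ge, pos_INR).
    pose proof (Mert_abs (S n)). pose proof (lt_0_INR (S n) ltac:(lia)).
    apply (Rmult_le_reg_r (INR (S n))); auto. rewrite Rmult_assoc, Rinv_l; lra. }
  apply Rabs_le_inv in H. apply Rabs_le_inv in H2. apply Rabs_le. lra.
Qed.

(** Where s M(i) > c i, each term of [MertSum] is at least c/(i+1) in the direction s, hence at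
    least c (ln (i+2) - ln (i+1)). These telescope, while [MertSum] moves by at most 3 + 3. *)
Lemma Mert_same_sign_bound s c y k : (s = 1 \/ s = -1) -> 0 < c -> (1 <= y)%nat ->
  (forall n, (y <= n <= y + k)%nat -> c * INR n < s * Mert n) ->
  c * (ln (INR (y + k) + 2) - ln (INR y + 2)) <= 6.
Proof.
  intros Hs Hc Hy H.
  assert (P : forall j, (j <= k)%nat ->
    c * (ln (INR (y + j) + 2) - ln (INR y + 2)) <= s * (MertSum (y + j) - MertSum y)).
  { induction j as [|j IH]; intros Hj.
    - rewrite Nat.add_0_r. rewrite !Rminus_diag, !Rmult_0_r. lra.
    - specialize (IH ltac:(lia)). specialize (H (y + S j)%nat ltac:(lia)).
      unfold MertSum in *. rewrite Nat.add_succ_r in *. rewrite sm_S.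
      pose proof (inv_ge_ln (S (S (y + j))) ltac:(lia)) as L.
      rewrite !S_INR in *. pose proof (INR_ge1 (y + j) ltac:(lia)) as Hp.
      set (N := INR (y + j)) in *.
      assert (Q : / (N + 1) - / (N + 1 + 1) = / (N + 1) * / (N + 1 + 1)) by (field; lra).
      assert (Hi : 0 < / (N + 1) * / (N + 1 + 1)) by (apply Rmult_lt_0_compat; apply Rinv_0_lt_compat; lra).
      rewrite Q.
      assert (E : c * / (N + 1 + 1) <= s * Mert (S (y + j)) * (/ (N + 1) * / (N + 1 + 1))).
      { replace (c * / (N + 1 + 1)) with (c * (N + 1) * (/ (N + 1) * / (N + 1 + 1))) by (field; lra).
        apply Rmult_le_compat_r; lra. }
      replace (N + 1 + 1 + 1) with (N + 1 + 2) in L by ring.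
      replace (N + 1 + 1) with (N + 2) in * by ring.
      assert (c * (ln (N + 1 + 2) - ln (N + 2)) <= c * / (N + 2)) by (apply Rmult_le_compat_l; lra).
      lra. }
  specialize (P k ltac:(lia)).
  pose proof (MertSum_bounded (y + k)) as B1. pose proof (MertSum_bounded y) as B2.
  apply Rabs_le_inv in B1. apply Rabs_le_inv in B2. destruct Hs as [-> | ->]; lra.
Qed.

Lemma nat_above r : exists n : nat, (1 <= n)%nat /\ r <= INR n.
Proof.
  destruct (INR_unbounded r) as [n Hn]. exists (S n). split; [lia|]. rewrite S_INR. lra.
Qed.

Lemma Mert_small_somewhere c : 0 < c -> exists K, (2 <= K)%nat /\ exists Y0, (1 <= Y0)%nat /\
  forall y, (Y0 <= y)%nat -> exists z, (y <= z <= K * y)%nat /\ Rabs (Mert z) <= c * INR z.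
Proof.
  (* 7 beats the 6 of [Mert_same_sign_bound]; the 3 absorbs y + 2 <= 3 y. The later choice of Y0
     makes c n >= 1, so that |M| > 1 on the range. *)
  intros Hc. destruct (nat_above (3 * exp (7 / c))) as (K & HK1 & HK).
  exists (S K). split; [lia|].
  destruct (nat_above (1 / c)) as (Y0 & HY1 & HY0). exists Y0. split; auto.
  intros y Hy. apply NNPP. intros Hno.
  assert (Hbig : forall n, (y <= n <= y + K * y)%nat -> c * INR n < Rabs (Mert n)).
  { intros n Hn. apply Rnot_le_lt. intros Hle. apply Hno. exists n. split; [simpl; lia|auto]. }
  assert (Hc1 : forall n, (y <= n)%nat -> 1 <= c * INR n).
  { intros n Hn. assert (INR Y0 <= INR n) by (apply le_INR; lia).
    apply Rle_trans with (c * (1 / c)); [right; field; lra|]. apply Rmult_le_compat_l; lra. }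
  (* [M] moves by steps of size at most 1, so it keeps its sign while [|M| > 1]. *)
  assert (Hsign : exists s, (s = 1 \/ s = -1) /\ forall j, (j <= K * y)%nat -> c * INR (y + j) < s * Mert (y + j)).
  { pose proof (Hbig y ltac:(lia)) as H0.
    exists (if Rle_dec 0 (Mert y) then 1 else -1).
    split; [destruct Rle_dec; auto|].
    induction j as [|j IH]; intros Hj.
    - rewrite Nat.add_0_r. unfold Rabs in H0. destruct Rle_dec, (Rcase_abs (Mert y)); lra.
    - specialize (IH ltac:(lia)). specialize (Hbig (y + S j)%nat ltac:(lia)).
      pose proof (Mert_lipschitz (y + j) (y + S j) ltac:(lia)) as L.
      pose proof (Hc1 (y + j)%nat ltac:(lia)). pose proof (Hc1 (y + S j)%nat ltac:(lia)).
      rewrite Nat.add_succ_r in *. rewrite S_INR in *. apply Rabs_le_inv in L.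
      unfold Rabs in Hbig. destruct Rle_dec, (Rcase_abs (Mert (S (y + j)))); lra. }
  destruct Hsign as (s & Hs & Hpos).
  pose proof (Mert_same_sign_bound s c y (K * y) Hs Hc ltac:(lia)) as B.
  assert (B' : c * (ln (INR (y + K * y) + 2) - ln (INR y + 2)) <= 6).
  { apply B. intros n Hn. replace n with (y + (n - y))%nat by lia. apply Hpos. lia. }
  pose proof (INR_ge1 y ltac:(lia)) as Hy1.
  assert (Hl : 7 / c <= ln (INR (y + K * y) + 2) - ln (INR y + 2)).
  { pose proof (exp_pos (7 / c)).
    assert (ln (exp (7 / c) * (INR y + 2)) <= ln (INR (y + K * y) + 2)).
    { apply ln_le_mono; [apply Rmult_lt_0_compat; lra|]. rewrite plus_INR, mult_INR.
      nra. }
    rewrite ln_mult, ln_exp in H0 by lra. lra. }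
  assert (c * (7 / c) <= 6).
  { eapply Rle_trans; [apply Rmult_le_compat_l; [lra|apply Hl]|]. auto. }
  replace (c * (7 / c)) with 7 in H by (field; lra). lra.
Qed.

(** One small value of M spreads to an interval of fixed ratio 1 + c, because M moves by at most c z
    over it. An interval, unlike a point, carries logarithmic weight. *)
Lemma Mert_small_interval c : 0 < c -> exists K, (2 <= K)%nat /\ exists Y0, (1 <= Y0)%nat /\
  forall y, (Y0 <= y)%nat -> exists z, (y <= z <= K * y)%nat /\
    forall u, (z <= u)%nat -> INR u <= (1 + c) * INR z -> Rabs (Mert u) <= 2 * c * INR u.
Proof.
  intros Hc. destruct (Mert_small_somewhere c Hc) as (K & HK & Y0 & HY & H).
  exists K; split; auto. exists Y0; split; auto. intros y Hy.
  destruct (H y Hy) as (z & Hz & HM). exists z; split; auto. intros u Hu Huz.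
  pose proof (Mert_lipschitz z u Hu) as L. apply le_INR in Hu.
  apply Rabs_le_inv in L. apply Rabs_le_inv in HM. apply Rabs_le. nra.
Qed.

(** * Logarithmic weight of the n with M(x/n) small *)

Lemma sm_tail m n : (1 <= m <= S n)%nat ->
  sm (fun i => iv (Nat.leb m i)) n = INR (S n) - INR m.
Proof.
  induction n as [|n IH]; intros Hm.
  - replace m with 1%nat by lia. simpl. ring.
  - rewrite sm_S. destruct (Nat.eq_dec m (S (S n))) as [->|Hne].
    + rewrite sm_0.
      * destruct (Nat.leb_spec (S (S n)) (S n)); [lia|]. unfold iv. lra.
      * intros i Hi. destruct (Nat.leb_spec (S (S n)) i); [lia|reflexivity].
    + rewrite IH by lia. destruct (Nat.leb_spec m (S n)); [|lia]. unfold iv.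
      rewrite (S_INR (S n)). ring.
Qed.

Definition good (c : R) (x n : nat) : bool :=
  if Rle_dec (Rabs (Mert (x / n))) (2 * c * INR (x / n)) then true else false.

(** The n with x/n in the good interval [z, (1+c) z] form a c/4 proportion of those up to q = x/z,
    and q >= 3 sqrt x gives them ln n >= (ln x)/2. The two order conditions on n y and x place them
    in a window depending only on y, so that different scales y do not overlap. *)
Lemma good_block c K Y0 x y : 0 < c <= 1 -> (1 <= y)%nat -> (1 <= x)%nat -> (Y0 <= y)%nat -> (1 <= K)%nat ->
  (forall y, (Y0 <= y)%nat -> exists z, (y <= z <= K * y)%nat /\
    forall u, (z <= u)%nat -> INR u <= (1 + c) * INR z -> Rabs (Mert u) <= 2 * c * INR u) ->
  4 * INR (K * y) <= sqrt (INR x) -> 2 / c <= sqrt (INR x) ->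
  c / 8 * ln (INR x) <=
  sm (fun n => iv (good c x n && Nat.leb (n * y) x && Nat.ltb x (n * (2 * K * y))) * (ln (INR n) / INR n)) x.
Proof.
  intros Hc Hy1 Hx HyY HK HZ Hsq Hsc. destruct (HZ y HyY) as (z & Hz & Hgood).
  pose proof (INR_ge1 x Hx) as Hx1. pose proof (INR_ge1 z ltac:(lia)) as Hz1.
  set (r := sqrt (INR x)) in *.
  assert (Hr : r * r = INR x) by (apply sqrt_sqrt; lra).
  assert (Hr1 : 1 <= r) by (unfold r; rewrite <- sqrt_1; apply sqrt_le_1; lra).
  assert (HzK : INR z <= INR (K * y)) by (apply le_INR; lia).
  assert (Hzx : (z <= x)%nat) by (apply INR_le; nra).
  set (q := (x / z)%nat).
  destruct (INR_div_bounds x z ltac:(lia)) as (Hq1 & Hq2 & Hq3). fold q in Hq1, Hq2.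
  assert (Hqx : (q <= x)%nat) by (apply Nat.Div0.div_le_upper_bound; nia).
  assert (Hqr : 3 * r <= INR q).
  { assert (4 * r <= INR x / INR z); [|lra].
    apply (Rmult_le_reg_r (INR z)); [lra|]. replace (INR x / INR z * INR z) with (INR x) by (field; lra). nra. }
  assert (Hcq : 2 <= c * INR q).
  { apply Rle_trans with (c * (2 / c)); [right; field; lra|]. apply Rmult_le_compat_l; lra. }
  (* Beyond w = (q+1)/(1+c) one has x/n < (q+1) z / w = (1+c) z, while n <= q keeps x/n >= z. *)
  destruct (archimed ((INR q + 1) / (1 + c))) as [A1 A2].
  set (w := (INR q + 1) / (1 + c)) in *.
  assert (Hw : w * (1 + c) = INR q + 1) by (unfold w; field; lra).
  assert (Hw2 : (INR q + 1) / 2 <= w).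
  { unfold w. apply Rdiv_le_swap; try lra. apply Rmult_le_compat_l; lra. }
  set (m0 := Z.to_nat (up w)).
  assert (Hm0 : INR m0 = IZR (up w)).
  { unfold m0. rewrite INR_IZR_INZ, Z2Nat.id; auto. apply le_IZR. lra. }
  rewrite <- Hm0 in A1, A2.
  assert (Hm0q : (1 <= m0 <= S q)%nat).
  { split; apply INR_le; rewrite ?S_INR; simpl; nra. }
  assert (Hln : forall n, (m0 <= n)%nat -> ln (INR x) / 2 <= ln (INR n)).
  { intros n Hn. apply le_INR in Hn.
    rewrite <- Hr, ln_mult by lra. replace ((ln r + ln r) / 2) with (ln r) by field.
    apply ln_le_mono; lra. }
  apply Rle_trans with (sm (fun n => iv (good c x n && Nat.leb (n * y) x && Nat.ltb x (n * (2 * K * y))) * (ln (INR n) / INR n)) q).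
  2:{ apply sm_mono; auto. intros i Hi. apply Rmult_le_pos; [apply iv_bounds|].
      pose proof (INR_ge1 i ltac:(lia)).
      apply Rmult_le_pos; [apply ln_nonneg; auto|]. left; apply Rinv_0_lt_compat; lra. }
  apply Rle_trans with (sm (fun n => iv (Nat.leb m0 n) * (ln (INR x) / 2 / INR q)) q).
  - rewrite sm_scal_r, sm_tail by auto. rewrite S_INR.
    pose proof (ln_nonneg _ Hx1).
    assert (Hcnt : c / 4 * INR q <= INR q + 1 - INR m0) by nra.
    apply Rle_trans with (c / 4 * INR q * (ln (INR x) / 2 / INR q)).
    + right. field. lra.
    + apply Rmult_le_compat_r; auto.
      apply Rmult_le_pos; [lra|]. left; apply Rinv_0_lt_compat; lra.
  - apply sm_le. intros n Hn.
    assert (Hn1 : 1 <= INR n) by (apply INR_ge1; lia).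
    assert (Hnq : INR n <= INR q) by (apply le_INR; lia).
    pose proof (ln_nonneg _ Hn1). assert (Hi : 0 < / INR n) by (apply Rinv_0_lt_compat; lra).
    destruct (Nat.leb_spec m0 n) as [Hmn|Hmn].
    2:{ unfold iv at 1. rewrite Rmult_0_l. apply Rmult_le_pos; [apply iv_bounds|].
        apply Rmult_le_pos; lra. }
    assert (Hmn' : INR m0 <= INR n) by (apply le_INR; lia).
    assert (Hqz : INR q * INR z <= INR x).
    { rewrite <- mult_INR. apply le_INR. unfold q. pose proof (Nat.Div0.mul_div_le x z). lia. }
    assert (Hqz2 : INR x < (INR q + 1) * INR z).
    { rewrite <- S_INR, <- mult_INR. apply lt_INR. unfold q. pose proof (Nat.mul_succ_div_gt x z ltac:(lia)). lia. }
    assert (Hg : good c x n = true).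
    { unfold good. destruct Rle_dec as [|Hn2]; auto. exfalso. apply Hn2. apply Hgood.
      - apply Nat.div_le_lower_bound; [lia|]. apply INR_le. rewrite mult_INR.
        apply Rle_trans with (INR q * INR z); auto. apply Rmult_le_compat_r; lra.
      - destruct (INR_div_bounds x n ltac:(lia)) as (_ & Hd & _).
        apply Rle_trans with (INR x / INR n); [lra|].
        apply (Rmult_le_reg_r (INR n)); [lra|].
        replace (INR x / INR n * INR n) with (INR x) by (field; lra).
        apply Rle_trans with ((INR q + 1) * INR z); [lra|]. rewrite <- Hw.
        assert (w * INR z <= INR n * INR z) by (apply Rmult_le_compat_r; lra). nra. }
    assert (Hl1 : Nat.leb (n * y) x = true).
    { apply Nat.leb_le. apply INR_le. rewrite mult_INR.
      apply Rle_trans with (INR q * INR z); auto.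
      apply Rmult_le_compat; try lra; try apply pos_INR. apply le_INR; lia. }
    assert (Hl2 : Nat.ltb x (n * (2 * K * y)) = true).
    { apply Nat.ltb_lt. apply INR_lt. rewrite <- Nat.mul_assoc, !mult_INR. change (INR 2) with 2.
      rewrite mult_INR in HzK.
      assert ((INR q + 1) * INR z <= 2 * INR n * INR z) by (apply Rmult_le_compat_r; lra).
      assert (INR n * INR z <= INR n * (INR K * INR y)) by (apply Rmult_le_compat_l; lra). lra. }
    rewrite Hg, Hl1, Hl2. unfold iv, andb. rewrite !Rmult_1_l.
    unfold Rdiv at 1. apply Rmult_le_compat.
    + pose proof (ln_nonneg _ Hx1). lra.
    + left; apply Rinv_0_lt_compat; lra.
    + apply Hln; auto.
    + apply Rinv_le_contravar; lra.
Qed.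

(** The scales (2K)^j Y0 occupy disjoint windows of n, so the contributions of [good_block] add
    up. *)
Lemma good_blocks c K Y0 x J : 0 < c <= 1 -> (1 <= x)%nat -> (1 <= Y0)%nat -> (1 <= K)%nat ->
  (forall y, (Y0 <= y)%nat -> exists z, (y <= z <= K * y)%nat /\
    forall u, (z <= u)%nat -> INR u <= (1 + c) * INR z -> Rabs (Mert u) <= 2 * c * INR u) ->
  4 * INR (K * ((2 * K) ^ J * Y0)) <= sqrt (INR x) -> 2 / c <= sqrt (INR x) ->
  INR J * (c / 8 * ln (INR x)) <=
  sm (fun n => iv (good c x n && Nat.ltb x (n * ((2 * K) ^ J * Y0))) * (ln (INR n) / INR n)) x.
Proof.
  intros Hc Hx HY HK HZ Hsq Hsc. induction J as [|J IH].
  - simpl INR. rewrite Rmult_0_l. apply sm_nonneg. intros n Hn.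
    pose proof (INR_ge1 n ltac:(lia)).
    apply Rmult_le_pos; [apply iv_bounds|]. apply Rmult_le_pos; [apply ln_nonneg; auto|].
    left; apply Rinv_0_lt_compat; lra.
  - set (y := ((2 * K) ^ J * Y0)%nat) in *.
    assert (Hpow : (1 <= (2 * K) ^ J)%nat) by (apply Nat.neq_0_lt_0, Nat.pow_nonzero; lia).
    assert (Ey : ((2 * K) ^ S J * Y0 = 2 * K * y)%nat) by (unfold y; simpl; ring).
    rewrite Ey in *.
    assert (Hsq' : 4 * INR (K * y) <= sqrt (INR x)).
    { eapply Rle_trans; [|exact Hsq]. apply Rmult_le_compat_l; [lra|]. apply le_INR. nia. }
    specialize (IH Hsq').
    assert (HyY : (Y0 <= y)%nat) by (unfold y; nia).
    pose proof (good_block c K Y0 x y Hc ltac:(lia) Hx HyY HK HZ Hsq' Hsc) as B.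
    rewrite S_INR, Rmult_plus_distr_r, Rmult_1_l.
    eapply Rle_trans; [apply Rplus_le_compat; [exact IH|exact B]|].
    rewrite <- sm_plus. apply sm_le. intros n Hn. rewrite <- Rmult_plus_distr_r.
    pose proof (INR_ge1 n ltac:(lia)).
    apply Rmult_le_compat_r.
    { apply Rmult_le_pos; [apply ln_nonneg; auto|]. left; apply Rinv_0_lt_compat; lra. }
    destruct (good c x n); cbn [andb]; [|unfold iv; lra].
    destruct (Nat.ltb_spec x (n * y)), (Nat.leb_spec (n * y) x), (Nat.ltb_spec x (n * (2 * K * y)));
      cbn [andb iv]; try lra; nia.
Qed.

(** * Lowering the bound for |M(y)|/y *)

Definition eventually_le (b : R) : Prop :=
  exists Y, forall y, (Y <= y)%nat -> Rabs (Mert y) <= b * INR y.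

Lemma nat_floor r : 0 <= r -> exists J : nat, INR J <= r < INR J + 1.
Proof.
  intros Hr. destruct (archimed r) as [A1 A2].
  exists (Z.to_nat (up r - 1)).
  assert (0 <= up r - 1)%Z.
  { assert (0 < up r)%Z by (apply lt_IZR; lra). lia. }
  rewrite INR_IZR_INZ, Z2Nat.id, minus_IZR by auto. lra.
Qed.

Lemma ln_le_inv a b : 0 < a -> 0 < b -> ln a <= ln b -> a <= b.
Proof.
  intros Ha Hb [H|H]; [left; apply ln_lt_inv; auto|right; apply ln_inv; auto].
Qed.

Lemma sum_ln_over_n : exists C, 0 <= C /\ forall x, (1 <= x)%nat ->
  sm (fun n => ln (INR n) / INR n) x <= ln (INR x) ^ 2 / 2 + C.
Proof.
  destruct log_harmonic_asymp as [g H]. exists (Rabs g + 24).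
  split; [pose proof (Rabs_pos g); lra|]. intros x Hx.
  pose proof (INR_ge1 _ Hx) as H1. specialize (H x (INR x) Hx ltac:(lra)).
  apply Rabs_le_inv in H. pose proof (Rle_abs g).
  assert (6 * (2 + ln (INR x)) / INR x <= 24 / 1); [|lra].
  apply Rdiv_le_swap; try lra. pose proof (ln_le_sub1 (INR x) ltac:(lra)). lra.
Qed.

Lemma good_sum_lower c : 0 < c <= 1 -> exists g T, 0 < g /\ forall x, (1 <= x)%nat -> T <= ln (INR x) ->
  g * ln (INR x) ^ 2 <= sm (fun n => iv (good c x n) * (ln (INR n) / INR n)) x.
Proof.
  intros Hc. destruct (Mert_small_interval c (proj1 Hc)) as (K & HK & Y0 & HY & HZ).
  set (L := ln (INR (2 * K))).
  assert (HL : 0 < L).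
  { rewrite <- ln_1. apply ln_increasing; [lra|]. apply lt_1_INR; lia. }
  assert (HKY : 0 <= ln (INR (4 * K * Y0))) by (apply ln_nonneg, INR_ge1; nia).
  assert (H4c : 0 < 4 / c) by (apply Rdiv_lt_0_compat; lra).
  (* About ln x / (4L) scales fit below sqrt x, each giving (c/8) ln x. The threshold has one term
     per requirement: 8 L so that rounding down to J loses at most half, 4 ln (4 K Y0) so that the
     largest scale stays below sqrt x, and 4/c so that 2/c <= sqrt x. *)
  exists (c / (64 * L)), (8 * L + 4 * ln (INR (4 * K * Y0)) + 4 / c).
  split; [apply Rdiv_lt_0_compat; lra|]. intros x Hx HT.
  pose proof (INR_ge1 _ Hx) as Hx1.
  set (l := ln (INR x)) in *.
  destruct (nat_floor (l / (4 * L))) as (J & HJ1 & HJ2).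
  { apply Rmult_le_pos; [lra|]. left; apply Rinv_0_lt_compat; lra. }
  assert (HJ1' : INR J * L <= l / 4).
  { apply (Rmult_le_compat_r L) in HJ1; [|lra].
    replace (l / (4 * L) * L) with (l / 4) in HJ1 by (field; lra). auto. }
  assert (HJ2' : l / (8 * L) <= INR J).
  { assert (1 <= l / (8 * L)).
    { apply (Rmult_le_reg_r (8 * L)); [lra|]. replace (l / (8 * L) * (8 * L)) with l by (field; lra). lra. }
    replace (l / (4 * L)) with (l / (8 * L) + l / (8 * L)) in HJ2 by (field; lra). lra. }
  assert (Hs0 : 0 < sqrt (INR x)) by (apply sqrt_lt_R0; lra).
  assert (Hs : ln (sqrt (INR x)) = l / 2).
  { unfold l. rewrite <- (sqrt_sqrt (INR x)) at 2 by lra. rewrite ln_mult by auto. field. }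
  assert (Hpow : (1 <= (2 * K) ^ J)%nat) by (apply Nat.neq_0_lt_0, Nat.pow_nonzero; lia).
  assert (Hsq : 4 * INR (K * ((2 * K) ^ J * Y0)) <= sqrt (INR x)).
  { replace (4 * INR (K * ((2 * K) ^ J * Y0))) with (INR (2 * K) ^ J * INR (4 * K * Y0)).
    2:{ rewrite <- pow_INR, <- mult_INR. change 4 with (INR 2 * INR 2). rewrite <- !mult_INR.
        f_equal. ring. }
    assert (0 < INR (4 * K * Y0)) by (apply lt_0_INR; nia).
    assert (0 < INR (2 * K)) by (apply lt_0_INR; lia).
    assert (0 < INR (2 * K) ^ J) by (apply pow_lt; auto).
    apply ln_le_inv; auto; [apply Rmult_lt_0_compat; auto|].
    rewrite ln_mult, ln_pow, Hs by auto. fold L. lra. }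
  assert (Hsc : 2 / c <= sqrt (INR x)).
  { pose proof (ln_le_sqrt _ Hx1). fold l in H.
    replace (2 / c) with (4 / c / 2) by (field; lra). lra. }
  pose proof (good_blocks c K Y0 x J Hc Hx HY ltac:(lia) HZ Hsq Hsc) as B. fold l in B.
  apply Rle_trans with (INR J * (c / 8 * l)).
  - replace (c / (64 * L) * l ^ 2) with (l / (8 * L) * (c / 8 * l)) by (field; lra).
    apply Rmult_le_compat_r; [|auto]. pose proof (ln_nonneg _ Hx1). fold l in H. nra.
  - eapply Rle_trans; [apply B|]. apply sm_le. intros n Hn.
    pose proof (INR_ge1 n ltac:(lia)).
    apply Rmult_le_compat_r.
    + apply Rmult_le_pos; [apply ln_nonneg; auto|]. left; apply Rinv_0_lt_compat; lra.
    + rewrite iv_andb. pose proof (iv_bounds (good c x n)).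
      pose proof (iv_bounds (Nat.ltb x (n * ((2 * K) ^ J * Y0)))). nra.
Qed.

(** The amount g depends on a alone and not on b, so that finitely many improvements reach a. With c
    = a/4, a good n has |M(x/n)| at most (a/2) x/n, which is a/2 below the trivial b x/n as b >=
    a. *)
Lemma eventually_le_improve a : 0 < a <= 1 -> exists g, 0 < g /\
  forall b, a <= b <= 1 -> eventually_le b -> eventually_le (b - g).
Proof.
  intros Ha. set (c := a / 4).
  destruct (good_sum_lower c ltac:(unfold c; lra)) as (g & T & Hg & HG).
  destruct sum_ln_over_n as (C1 & HC1 & HS).
  destruct Lam2_to_log as (C & HC & HLL).
  (* The good n save a g ln^2 x (the factor 2 in front of ln cancels the half in a/2). Half of it is
     kept, the other half absorbs the terms of order ln x, collected in [D]. *)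
  exists (a * g / 2). split; [nra|]. intros b Hb [Yb HYb].
  pose proof (pos_INR Yb) as HYb0.
  set (D := 2 * C1 + 2 * INR Yb + 2 * C + 8).
  assert (Hag : 0 < a * g / 2) by nra.
  set (T2 := Rabs T + 1 + D / (a * g / 2)).
  destruct (nat_above (exp T2)) as (X & HX1 & HX2).
  exists X. intros x Hx.
  assert (Hx1 : (1 <= x)%nat) by lia. pose proof (INR_ge1 _ Hx1) as Hx2.
  set (l := ln (INR x)).
  assert (HDp : 0 <= D / (a * g / 2)).
  { apply Rmult_le_pos; [unfold D; lra|]. left; apply Rinv_0_lt_compat; lra. }
  assert (HlT : T2 <= l).
  { rewrite <- (ln_exp T2). apply ln_le_mono; [apply exp_pos|].
    eapply Rle_trans; [exact HX2|]. apply le_INR; auto. }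
  assert (Hl1 : 1 <= l) by (unfold T2 in HlT; pose proof (Rabs_pos T); lra).
  assert (HlTT : T <= l) by (unfold T2 in HlT; pose proof (Rle_abs T); lra).
  assert (HlD : D * l <= a * g / 2 * l ^ 2).
  { assert (E : D / (a * g / 2) <= l) by (unfold T2 in HlT; pose proof (Rabs_pos T); lra).
    apply (Rmult_le_compat_l (a * g / 2)) in E; [|lra].
    replace (a * g / 2 * (D / (a * g / 2))) with D in E by (field; lra). nra. }
  pose proof (Mert_log2_sum x Hx1) as E1. pose proof (HLL x Hx1) as E2.
  specialize (HG x Hx1 HlTT). specialize (HS x Hx1). fold l in E1, E2, HG, HS.
  set (G := sm (fun n => iv (good c x n) * (ln (INR n) / INR n)) x) in *.
  assert (E3 : sm (fun n => ln (INR n) * Rabs (Mert (x / n))) x <=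
     b * INR x * sm (fun n => ln (INR n) / INR n) x + INR Yb * (INR x * l) - a / 2 * INR x * G).
  { unfold G. rewrite <- (sm_const l x), <- !sm_scal, <- sm_plus, <- sm_minus.
    apply sm_le. intros n Hn. pose proof (INR_ge1 n ltac:(lia)) as Hn1.
    pose proof (ln_nonneg _ Hn1) as Hln.
    assert (Hlnl : ln (INR n) <= l) by (apply ln_le_mono; [lra|apply le_INR; lia]).
    destruct (INR_div_bounds x n Hn) as (_ & Hd & Hd1).
    (* The constant Yb covers those n for which x/n is too small for the bound b to apply yet. *)
    assert (HM : Rabs (Mert (x / n)) <= b * (INR x / INR n) + INR Yb - iv (good c x n) * (a / 2 * (INR x / INR n))).
    { unfold good. destruct Rle_dec as [Hgd|]; unfold iv.
      - apply Rle_trans with (2 * c * INR (x / n)); auto. unfold c. 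
        pose proof (pos_INR (x / n)). nra.
      - destruct (le_lt_dec Yb (x / n)) as [Hle|Hlt].
        + specialize (HYb _ Hle). nra.
        + pose proof (Mert_abs (x / n)). apply lt_INR in Hlt. nra. }
    apply (Rmult_le_compat_l (ln (INR n))) in HM; auto.
    eapply Rle_trans; [apply HM|].
    assert (ln (INR n) * INR Yb <= INR Yb * l) by nra.
    unfold Rdiv in *. lra. }
  assert (E4 : Rabs (Mert x) * l ^ 2 <= (b - a * g / 2) * INR x * l ^ 2).
  { assert (b * INR x * sm (fun n => ln (INR n) / INR n) x <= b * INR x * (l ^ 2 / 2 + C1)) by
      (apply Rmult_le_compat_l; [nra|auto]).
    assert (a / 2 * INR x * (g * l ^ 2) <= a / 2 * INR x * G) by
      (apply Rmult_le_compat_l; [nra|auto]).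
    assert (INR x * (D * l) <= INR x * (a * g / 2 * l ^ 2)) by (apply Rmult_le_compat_l; [lra|auto]).
    assert (Hxl : INR x * 1 <= INR x * l) by (apply Rmult_le_compat_l; lra).
    assert (b * (INR x * C1) <= 1 * (INR x * C1)) by (apply Rmult_le_compat_r; [nra|lra]).
    assert (INR x * C1 <= INR x * l * C1) by (apply Rmult_le_compat_r; lra).
    assert (C * INR x <= C * (INR x * l)) by (apply Rmult_le_compat_l; lra).
    unfold D in *. lra. }
  apply (Rmult_le_reg_r (l ^ 2)); [apply pow_lt; lra|auto].
Qed.

(* Each improvement step lowers the bound by the same amount as long as the bound exceeds [a]. *)
Lemma Mert_eventually_le a0 : 0 < a0 -> eventually_le a0.
Proof.
  intros Ha0. apply NNPP. intros Hno.
  set (a := Rmin a0 1).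
  assert (Ha : 0 < a <= 1) by (unfold a, Rmin; destruct Rle_dec; lra).
  assert (Hmono : forall b, eventually_le b -> a < b).
  { intros b [Y Hb]. apply Rnot_le_lt. intros Hle. apply Hno. exists Y. intros y Hy.
    eapply Rle_trans; [apply Hb; auto|]. apply Rmult_le_compat_r; [apply pos_INR|].
    eapply Rle_trans; [exact Hle|]. apply Rmin_l. }
  destruct (eventually_le_improve a Ha) as (g & Hg & Himp).
  assert (Hk : forall k : nat, eventually_le (1 - INR k * g)).
  { induction k as [|k IH].
    - exists 0%nat. intros y _. simpl. rewrite Rmult_0_l, Rminus_0_r, Rmult_1_l. apply Mert_abs.
    - rewrite S_INR. replace (1 - (INR k + 1) * g) with (1 - INR k * g - g) by ring.
      apply Himp; auto. pose proof (Hmono _ IH). pose proof (pos_INR k). split; [lra|nra]. }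
  destruct (nat_above (1 / g)) as (k & _ & Hkg).
  pose proof (Hmono _ (Hk k)).
  assert (1 / g * g <= INR k * g) by (apply Rmult_le_compat_r; lra).
  replace (1 / g * g) with 1 in * by (field; lra). lra.
Qed.

Fixpoint MertMax (n : nat) : R :=
  match n with
  | O => 0
  | S m => Rmax (MertMax m) (Rabs (Mert (S m)))
  end.

Lemma MertMax_ge n N : (n <= N)%nat -> Rabs (Mert n) <= MertMax N.
Proof.
  induction N as [|N IH]; intros H.
  - replace n with 0%nat by lia. unfold Mert. simpl. rewrite Rabs_R0. lra.
  - simpl MertMax. destruct (Nat.eq_dec n (S N)) as [->|]; [apply Rmax_r|].
    eapply Rle_trans; [apply IH; lia|apply Rmax_l].
Qed.

Lemma MertMax_nonneg N : 0 <= MertMax N.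
Proof. eapply Rle_trans; [apply Rabs_pos|apply (MertMax_ge 0); lia]. Qed.

Lemma MertMax_le N B : (forall n, (n <= N)%nat -> Rabs (Mert n) <= B) -> MertMax N <= B.
Proof.
  induction N as [|N IH]; intros H.
  - simpl. eapply Rle_trans; [apply Rabs_pos|apply (H 0%nat); lia].
  - simpl. apply Rmax_lub; [apply IH; intros; apply H; lia|apply H; lia].
Qed.

Lemma MertMax_little_o eps : 0 < eps -> exists N0, forall N, (N0 <= N)%nat -> MertMax N <= eps * INR N.
Proof.
  intros Heps. destruct (Mert_eventually_le eps Heps) as [Y HY].
  destruct (nat_above (INR Y / eps)) as (N0 & _ & HN0). exists N0. intros N HN.
  apply le_INR in HN.
  assert (HYN : INR Y <= eps * INR N).
  { replace (INR Y) with (eps * (INR Y / eps)) by (field; lra). apply Rmult_le_compat_l; lra. }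
  apply MertMax_le. intros n Hn. destruct (le_lt_dec Y n) as [H|H].
  - eapply Rle_trans; [apply HY; auto|]. apply Rmult_le_compat_l; [lra|apply le_INR; auto].
  - eapply Rle_trans; [apply Mert_abs|]. apply lt_INR in H. lra.
Qed.

(** * Divergence of the sum of the reciprocals of the primes *)

Definition smooth (Y n : nat) : Prop := forall q, nprime q -> Nat.divide q n -> (q <= Y)%nat.

Definition smb (Y n : nat) : bool := if excluded_middle_informative (smooth Y n) then true else false.

Definition smoothSum (Y N : nat) : R := sm (fun n => iv (smb Y n) * / INR n) N.

Definition primeRecip (Y : nat) : R := sm (fun q => iv (primeb q) * / INR q) Y.

Lemma smb_impl Y Y' n n' : (smooth Y n -> smooth Y' n') -> iv (smb Y n) <= iv (smb Y' n').
Proof.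
  intros H. unfold smb. destruct excluded_middle_informative, excluded_middle_informative; simpl; lra || tauto.
Qed.

Lemma inv_INR_nonneg n : 0 <= / INR n.
Proof.
  destruct n as [|n]; [simpl; rewrite Rinv_0; lra|].
  left. apply Rinv_0_lt_compat, lt_0_INR; lia.
Qed.

Lemma smoothSum_nonneg Y N : 0 <= smoothSum Y N.
Proof.
  apply sm_nonneg. intros. apply Rmult_le_pos; [apply iv_bounds|apply inv_INR_nonneg].
Qed.

(** One step of Euler's product: a smooth n is either free of the prime p, hence smooth for the
    smaller bound, or p times a smooth number. *)
Lemma smoothSum_prime_step Y N : nprime (S Y) ->
  smoothSum (S Y) N <= smoothSum Y N + / INR (S Y) * smoothSum (S Y) N.
Proof.
  intros Hp. set (p := S Y) in *.
  assert (H : smoothSum p N <= smoothSum Y N + sm (fun n => iv (dvdb p n) * (iv (smb p n) * / INR n)) N).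
  { unfold smoothSum. rewrite <- sm_plus. apply sm_le. intros n Hn.
    pose proof (inv_INR_nonneg n).
    destruct (dvdb_spec p n) as [D|D]; [unfold p; lia| |].
    - pose proof (iv_bounds (smb Y n)). unfold iv at 3. nra.
    - assert (iv (smb p n) <= iv (smb Y n)); [|unfold iv at 3; nra].
      apply smb_impl. intros Hs q Hq Hqn. specialize (Hs q Hq Hqn).
      destruct (Nat.eq_dec q p) as [->|]; [contradiction|]. unfold p in *; lia. }
  eapply Rle_trans; [exact H|]. apply Rplus_le_compat_l.
  rewrite sm_multiples_div by (unfold p; lia). unfold smoothSum. rewrite <- sm_scal.
  eapply Rle_trans; [|apply (sm_mono _ (N / p) N)].
  - apply sm_le. intros m Hm. rewrite mult_INR, Rinv_mult.
    assert (iv (smb p (p * m)) <= iv (smb p m)).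
    { apply smb_impl. intros Hs q Hq Hqm. apply Hs; auto. apply Nat.divide_mul_r; auto. }
    pose proof (inv_INR_nonneg p). pose proof (inv_INR_nonneg m).
    replace (/ INR p * (iv (smb p m) * / INR m)) with (iv (smb p m) * (/ INR p * / INR m)) by ring.
    apply Rmult_le_compat_r; auto. apply Rmult_le_pos; auto.
  - apply Nat.Div0.div_le_upper_bound. unfold p. nia.
  - intros i Hi. apply Rmult_le_pos; [apply inv_INR_nonneg|].
    apply Rmult_le_pos; [apply iv_bounds|apply inv_INR_nonneg].
Qed.

(** Each prime multiplies the bound by 1/(1 - x) with x = 1/p <= 1/2, and 1/(1 - x) <= 1 + 2x <= exp
    (2x). *)
Lemma smoothSum_le_exp Y N : smoothSum Y N <= exp (2 * primeRecip Y).
Proof.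
  induction Y as [|Y IH].
  - unfold primeRecip, smoothSum. simpl sm at 2. rewrite Rmult_0_r, exp_0.
    destruct N as [|N]; [simpl; lra|].
    rewrite (sm_extend _ 1 (S N)); [|lia|].
    + rewrite sm_S. change (INR 1) with 1. pose proof (iv_bounds (smb 0 1)). simpl sm. lra.
    + intros i Hi. unfold smb. destruct excluded_middle_informative as [Hs|]; [|simpl; ring].
      destruct (nprime_divisor i ltac:(lia)) as (q & Hq & Hqi).
      specialize (Hs q Hq Hqi). apply nprime_ge2 in Hq. lia.
  - unfold primeRecip in *. rewrite sm_S. destruct (primebP (S Y)) as [Hp|Hp].
    + pose proof (smoothSum_prime_step Y N Hp) as H. pose proof (nprime_ge2 _ Hp) as H2.
      apply le_INR in H2. change (INR 2) with 2 in H2.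
      set (x := / INR (S Y)) in *.
      assert (Hx : 0 < x <= / 2).
      { split; [apply Rinv_0_lt_compat; lra|apply Rinv_le_contravar; lra]. }
      pose proof (smoothSum_nonneg (S Y) N) as H3. pose proof (smoothSum_nonneg Y N) as H4.
      rewrite Rmult_plus_distr_l, exp_plus. unfold iv at 2. rewrite Rmult_1_l.
      pose proof (exp_ineq1_le (2 * x)) as H5.
      pose proof (exp_pos (2 * sm (fun q => iv (primeb q) * / INR q) Y)).
      set (E := exp (2 * sm _ _)) in *.
      apply Rle_trans with (smoothSum Y N * (1 + 2 * x)).
      { assert (Q1 : smoothSum (S Y) N * (1 - x) * (1 + 2 * x) <= smoothSum Y N * (1 + 2 * x))
          by (apply Rmult_le_compat_r; lra).
        assert (Q2 : 0 <= smoothSum (S Y) N * (x * (1 - 2 * x))).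
        { apply Rmult_le_pos; auto. apply Rmult_le_pos; lra. }
        lra. }
      apply Rmult_le_compat; lra.
    + rewrite Rmult_0_l, Rplus_0_r. eapply Rle_trans; [|exact IH]. unfold smoothSum.
      apply sm_le. intros n Hn. apply Rmult_le_compat_r; [apply inv_INR_nonneg|].
      apply smb_impl. intros Hs q Hq Hqn. specialize (Hs q Hq Hqn).
      destruct (Nat.eq_dec q (S Y)) as [->|]; [contradiction|lia].
Qed.

Lemma harmonic_ge n : ln (INR n + 1) <= sm (fun m => / INR m) n.
Proof.
  induction n as [|n IH]; [simpl; rewrite Rplus_0_l, ln_1; lra|].
  rewrite sm_S. pose proof (inv_ge_ln (S n) ltac:(lia)) as H. rewrite S_INR in *. lra.
Qed.

(** Every n <= N is N-smooth, so the harmonic sum, which exceeds ln N, is at most exp of twice the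
    prime sum. Katai's criterion takes its saving from this divergence. *)
Lemma primeRecip_unbounded A : exists Y, A <= primeRecip Y.
Proof.
  destruct (nat_above (exp (exp (2 * A)))) as (N & HN1 & HN). exists N.
  apply Rnot_lt_le. intros Hlt.
  pose proof (smoothSum_le_exp N N) as H1. pose proof (harmonic_ge N) as H2.
  assert (E : smoothSum N N = sm (fun m => / INR m) N).
  { apply sm_ext. intros n Hn. unfold smb. destruct excluded_middle_informative as [|Hs].
    - unfold iv; ring.
    - exfalso. apply Hs. intros q Hq Hqn. apply Nat.divide_pos_le in Hqn; lia. }
  rewrite <- E in H2.
  assert (H3 : exp (2 * primeRecip N) < exp (2 * A)) by (apply exp_increasing; lra).
  assert (H4 : exp (2 * A) <= ln (INR N + 1)).
  { rewrite <- (ln_exp (exp (2 * A))). apply ln_le_mono; [apply exp_pos|lra]. }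
  lra.
Qed.

(** * Katai's criterion *)

Definition corr (a : nat -> R) (p q N : nat) : R :=
  sm (fun m => iv (Nat.leb (p * m) N) * iv (Nat.leb (q * m) N) * (a (p * m)%nat * a (q * m)%nat)) N.

Section Katai.
Variables (Y N : nat) (a : nat -> R).
Hypothesis (Ha : forall n, Rabs (a n) <= 1).
(** [om] counts the prime divisors up to Y and has mean close to [A]; [Sg] collects the values of
    the sequence at the prime multiples of m; [Rest] is the off-diagonal part of its square. *)
Let A := primeRecip Y.
Let pr (p : nat) : R := iv (primeb p).
Let om (n : nat) : R := sm (fun p => pr p * iv (dvdb p n)) Y.
Let Sg (m : nat) : R := sm (fun p => pr p * (iv (Nat.leb (p * m) N) * a (p * m)%nat)) Y.
Let Rest : R := sm (fun p => sm (fun q => pr p * pr q * (iv (negb (Nat.eqb p q)) * Rabs (corr a p q N))) Y) Y.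

Lemma count_multiples p : (1 <= p)%nat -> 
  INR N / INR p - 1 <= sm (fun n => iv (dvdb p n)) N <= INR N / INR p.
Proof.
  intros Hp. rewrite (sm_ext _ (fun n => iv (dvdb p n) * 1)) by (intros; ring).
  rewrite sm_multiples_div, sm_const, Rmult_1_r by auto.
  assert (H0 : 0 < INR p) by (apply lt_0_INR; lia).
  pose proof (Nat.Div0.mul_div_le N p) as H1. pose proof (Nat.mul_succ_div_gt N p ltac:(lia)) as H2.
  apply le_INR in H1. apply lt_INR in H2. rewrite mult_INR in *. rewrite S_INR in H2.
  split; apply (Rmult_le_reg_r (INR p)); auto; unfold Rdiv.
  - rewrite Rmult_minus_distr_r, Rmult_assoc, Rinv_l by lra. lra.
  - rewrite Rmult_assoc, Rinv_l by lra. lra.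
Qed.

Lemma pr_nonneg p : 0 <= pr p.
Proof. apply iv_bounds. Qed.

Lemma pr_idem p : pr p * pr p = pr p.
Proof. unfold pr. destruct primeb; simpl; ring. Qed.

Lemma sum_om : A * INR N - INR Y <= sm om N.
Proof.
  unfold om. rewrite sm_swap. unfold A, primeRecip.
  rewrite <- sm_scal_r. replace (INR Y) with (sm (fun _ => 1) Y) by (rewrite sm_const; ring).
  rewrite <- sm_minus. apply sm_le. intros p Hp. rewrite sm_scal.
  pose proof (count_multiples p ltac:(lia)) as [H _]. fold (pr p).
  pose proof (iv_bounds (primeb p)) as Hb. fold (pr p) in Hb. unfold Rdiv in H.
  apply (Rmult_le_compat_l (pr p)) in H; [lra|apply Hb].
Qed.

Lemma sum_om2 : sm (fun n => om n ^ 2) N <= A ^ 2 * INR N + A * INR N.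
Proof.
  rewrite (sm_ext _ (fun n => sm (fun p => sm (fun q => pr p * pr q * (iv (dvdb p n) * iv (dvdb q n))) Y) Y)).
  2:{ intros n Hn. simpl. rewrite Rmult_1_r. unfold om at 1. rewrite <- sm_scal_r.
      apply sm_ext. intros p Hp. unfold om. rewrite <- sm_scal. apply sm_ext. intros; ring. }
  rewrite sm_swap.
  apply Rle_trans with (sm (fun p => pr p * / INR p * (A * INR N) + pr p * / INR p * INR N) Y).
  2:{ rewrite sm_plus, !sm_scal_r. change (sm (fun q => pr q * / INR q) Y) with A. lra. }
  apply sm_le. intros p Hp. rewrite sm_swap.
  apply Rle_trans with (sm (fun q => pr p * / INR p * INR N * (pr q * / INR q) + iv (Nat.eqb p q) * (pr p * / INR p * INR N)) Y).
  2:{ rewrite sm_plus, sm_scal, (sm_pick (fun _ => pr p * / INR p * INR N)) by auto.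
      change (sm (fun q => pr q * / INR q) Y) with A. lra. }
  apply sm_le. intros q Hq. rewrite sm_scal.
  unfold pr. destruct (primebP p) as [Pp|]; [|unfold iv at 1 4 6; simpl; rewrite ?Rmult_0_l, ?Rmult_0_r; lra].
  destruct (primebP q) as [Pq|].
  2:{ unfold iv at 2 5. rewrite !Rmult_0_l, !Rmult_0_r, Rmult_0_l, Rplus_0_l.
      pose proof (inv_INR_nonneg p). pose proof (pos_INR N).
      apply Rmult_le_pos; [apply iv_bounds|]. unfold iv. rewrite Rmult_1_l. apply Rmult_le_pos; auto. }
  pose proof (inv_INR_nonneg p) as Ip. pose proof (inv_INR_nonneg q) as Iq. pose proof (pos_INR N) as IN.
  assert (IP : 0 <= / INR p * INR N * / INR q) by (repeat apply Rmult_le_pos; auto).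
  unfold iv at 1 2 5 6 8. rewrite !Rmult_1_l.
  destruct (Nat.eqb_spec p q) as [<-|Hpq]; unfold iv at 3.
  - rewrite (sm_ext _ (fun n => iv (dvdb p n))) by (intros; destruct dvdb; simpl; ring).
    pose proof (count_multiples p ltac:(lia)). unfold Rdiv in *. lra.
  - apply Rle_trans with (INR N / INR (p * q)).
    2:{ rewrite mult_INR. unfold Rdiv. rewrite Rinv_mult. lra. }
    rewrite (sm_ext _ (fun n => iv (dvdb (p * q) n))).
    + apply count_multiples. nia.
    + intros n Hn. destruct (dvdb_spec p n) as [D|D]; [lia| |].
      * destruct (dvdb_spec q n) as [D'|D']; [lia| |].
        -- destruct (dvdb_spec (p * q) n) as [|D2]; [nia|simpl; ring|]. exfalso. apply D2.
           destruct D as [u ->]. destruct (nprime_mult q u p Pq D') as [[w ->]|D3].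
           ++ exists w. ring.
           ++ exfalso. apply Hpq. symmetry. apply nprime_dvd_eq; auto.
        -- destruct (dvdb_spec (p * q) n) as [[w ->]|]; [nia| |simpl; ring].
           exfalso; apply D'. exists (w * p)%nat. ring.
      * destruct (dvdb_spec (p * q) n) as [[w ->]|]; [nia| |simpl; ring].
        exfalso; apply D. exists (w * q)%nat. ring.
Qed.

(** Expand the square: the second moment exceeds A^2 N only by the diagonal term A N, since pq
    divides n with density 1/(pq) for p <> q. The term with Y comes from rounding N/p down in the
    first moment. *)
Lemma turan_kubilius : sm (fun n => (A - om n) ^ 2) N <= A * INR N + 2 * A * INR Y.
Proof.
  rewrite (sm_ext _ (fun n => A ^ 2 + (om n ^ 2 - 2 * A * om n))) by (intros; ring).
  rewrite sm_plus, sm_const, sm_minus, sm_scal.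
  pose proof sum_om. pose proof sum_om2.
  assert (0 <= A). { apply sm_nonneg. intros. apply Rmult_le_pos; [apply iv_bounds|apply inv_INR_nonneg]. }
  nra.
Qed.

(** Compare 1/n^2 with 1/(n-1) - 1/n; the induction can start at 1 because 1 is not prime. *)
Lemma prime_inv_sq : sm (fun p => pr p * (/ INR p * / INR p)) Y <= 1.
Proof.
  destruct Y as [|Y']; [simpl; lra|].
  apply Rle_trans with (1 - / INR (S Y')); [|pose proof (inv_INR_nonneg (S Y')); lra].
  induction Y' as [|y IH].
  - simpl sm. unfold pr. replace (primeb 1) with false; [change (INR 1) with 1; simpl; lra|].
    symmetry. destruct (primebP 1) as [Hp|]; auto. apply nprime_ge2 in Hp; lia.
  - rewrite sm_S. eapply Rle_trans; [apply Rplus_le_compat_r, IH|].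
    pose proof (INR_ge1 (S y) ltac:(lia)) as H. rewrite (S_INR (S y)).
    set (x := INR (S y)) in *.
    assert (H1 : 0 < / (x + 1)) by (apply Rinv_0_lt_compat; lra).
    assert (H2 : / (x + 1) * / (x + 1) <= / x - / (x + 1)).
    { replace (/ x - / (x + 1)) with (/ x * / (x + 1)) by (field; lra).
      apply Rmult_le_compat_r; [lra|]. apply Rinv_le_contravar; lra. }
    pose proof (iv_bounds (primeb (S (S y)))). fold (pr (S (S y))) in *. nra.
Qed.

Lemma count_double_multiples p : (1 <= p)%nat ->
  sm (fun m => iv (Nat.leb (p * m) N) * iv (dvdb p m)) N <= INR N * (/ INR p * / INR p).
Proof.
  intros Hp.
  rewrite (sm_ext _ (fun m => iv (dvdb p m) * iv (Nat.leb (p * m) N))) by (intros; ring).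
  rewrite sm_multiples by auto.
  apply Rle_trans with (sm (fun m => iv (dvdb (p * p) m)) N).
  - rewrite (sm_ext (fun n => iv (dvdb (p * p) n)) (fun n => iv (dvdb (p * p) n) * 1)) by (intros; ring).
    rewrite sm_multiples by nia. apply sm_le. intros m Hm.
    rewrite Nat.mul_assoc.
    pose proof (iv_bounds (Nat.leb (p * m) N)). pose proof (iv_bounds (Nat.leb (p * p * m) N)). nra.
  - eapply Rle_trans; [apply count_multiples; nia|].
    rewrite mult_INR. unfold Rdiv. rewrite Rinv_mult. lra.
Qed.

(** The diagonal p = q costs A N because |a| <= 1; everything else is a correlation, small by
    assumption in the application. *)
Lemma sum_Sg2 : sm (fun m => Sg m ^ 2) N <= A * INR N + Rest.
Proof.
  rewrite (sm_ext _ (fun m => sm (fun p => sm (fun q => pr p * pr q *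
     (iv (Nat.leb (p * m) N) * iv (Nat.leb (q * m) N) * (a (p * m)%nat * a (q * m)%nat))) Y) Y)).
  2:{ intros n Hn. simpl. rewrite Rmult_1_r. unfold Sg at 1. rewrite <- sm_scal_r.
      apply sm_ext. intros p Hp. unfold Sg. rewrite <- sm_scal. apply sm_ext. intros; ring. }
  rewrite sm_swap.
  apply Rle_trans with (sm (fun p => pr p * / INR p * INR N + sm (fun q => pr p * pr q * (iv (negb (Nat.eqb p q)) * Rabs (corr a p q N))) Y) Y).
  2:{ rewrite sm_plus, !sm_scal_r. change (sm (fun q => pr q * / INR q) Y) with A. fold Rest. lra. }
  apply sm_le. intros p Hp. rewrite sm_swap.
  apply Rle_trans with (sm (fun q => iv (Nat.eqb p q) * (pr p * / INR p * INR N) +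
     pr p * pr q * (iv (negb (Nat.eqb p q)) * Rabs (corr a p q N))) Y).
  2:{ rewrite sm_plus, (sm_pick (fun _ => pr p * / INR p * INR N)) by auto. lra. }
  apply sm_le. intros q Hq. rewrite sm_scal. fold (corr a p q N).
  pose proof (pr_nonneg p) as P1. pose proof (pr_nonneg q) as P2.
  destruct (Nat.eqb_spec p q) as [<-|Hpq]; unfold negb, iv.
  - rewrite pr_idem, !Rmult_0_l, Rmult_0_r, Rmult_1_l, Rplus_0_r, Rmult_assoc.
    apply Rmult_le_compat_l; auto. unfold corr.
    apply Rle_trans with (sm (fun n => iv (dvdb p n)) N).
    + rewrite (sm_ext (fun n => iv (dvdb p n)) (fun n => iv (dvdb p n) * 1)) by (intros; ring).
      rewrite sm_multiples by lia. apply sm_le. intros m Hm.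
      pose proof (Ha (p * m)) as H. apply Rabs_le_inv in H.
      pose proof (iv_bounds (Nat.leb (p * m) N)). 
      destruct (Nat.leb (p * m) N); unfold iv; nra.
    + pose proof (proj2 (count_multiples p ltac:(lia))) as Q. unfold Rdiv in Q. lra.
  - rewrite Rmult_0_l, Rplus_0_l, Rmult_1_l. apply Rmult_le_compat_l; [apply Rmult_le_pos; auto|apply Rle_abs].
Qed.

(** Write n = p m and use mu(pm) = - mu(m), which explains the plus sign. It fails only for p
    dividing m, and such pairs number at most N times the sum of 1/p^2. *)
Lemma sum_a_moebius_om :
  Rabs (sm (fun n => a n * moebius n * om n) N + sm (fun m => moebius m * Sg m) N) <= INR N.
Proof.
  rewrite (sm_ext _ (fun n => sm (fun p => pr p * (iv (dvdb p n) * (a n * moebius n))) Y)).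
  2:{ intros n Hn. unfold om. rewrite <- sm_scal. apply sm_ext. intros; ring. }
  rewrite (sm_ext (fun m => moebius m * Sg m) (fun m => sm (fun p => moebius m * (pr p * (iv (Nat.leb (p * m) N) * a (p * m)%nat))) Y)).
  2:{ intros n Hn. unfold Sg. rewrite <- sm_scal. reflexivity. }
  rewrite sm_swap, (sm_swap (fun m p => moebius m * _)), <- sm_plus.
  apply Rle_trans with (sm (fun p => INR N * (pr p * (/ INR p * / INR p))) Y).
  2:{ rewrite sm_scal. pose proof prime_inv_sq. pose proof (pos_INR N). nra. }
  apply sm_abs_le. intros p Hp. rewrite sm_scal, sm_multiples by lia.
  unfold pr. destruct (primebP p) as [Pp|].
  2:{ unfold iv at 1. rewrite Rmult_0_l, Rplus_0_l, sm_0 by (intros; unfold iv at 1; ring).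
      rewrite Rabs_R0. unfold iv; lra. }
  change (iv true) with 1. rewrite !Rmult_1_l, <- sm_plus.
  eapply Rle_trans; [|apply count_double_multiples; lia].
  apply sm_abs_le. intros m Hm.
  pose proof (Ha (p * m)) as H. pose proof (moebius_abs m) as H'. 
  destruct (Nat.leb (p * m) N).
  2:{ unfold iv. match goal with |- Rabs ?t <= _ => replace t with 0 by ring end. rewrite Rabs_R0; lra. }
  destruct (dvdb_spec p m) as [D|D]; [lia| |].
  - rewrite (moebius_mul_dvd p m) by (auto; lia). unfold iv.
    match goal with |- Rabs ?t <= _ => replace t with (moebius m * a (p * m)%nat) by ring end.
    rewrite Rabs_mult.
    pose proof (Rabs_pos (moebius m)). pose proof (Rabs_pos (a (p * m)%nat)). nra.
  - rewrite (moebius_mul_ndvd p m) by (auto; lia). unfold iv.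
    match goal with |- Rabs ?t <= _ => replace t with 0 by ring end. rewrite Rabs_R0; lra.
Qed.

Lemma sum_abs_le_square f c : 0 < c ->
  sm (fun n => Rabs (f n)) N <= (sm (fun n => f n ^ 2) N / c + c * INR N) / 2.
Proof.
  intros Hc. replace ((sm (fun n => f n ^ 2) N / c + c * INR N) / 2) with
    (sm (fun n => (f n ^ 2 * / c + c) * / 2) N).
  2:{ rewrite sm_scal_r, sm_plus, sm_scal_r, sm_const. unfold Rdiv. ring. }
  apply sm_le. intros n Hn. rewrite <- pow2_abs. set (u := Rabs (f n)).
  apply (Rmult_le_reg_r c); auto.
  replace ((u ^ 2 * / c + c) * / 2 * c) with ((u ^ 2 + c ^ 2) / 2) by (field; lra).
  pose proof (pow2_ge_0 (u - c)). lra.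
Qed.

(** The sum times A splits into the deviation of [om] from its mean, the error of
    [sum_a_moebius_om], and the sum of mu against [Sg]. Cauchy-Schwarz enters as |u| <= (u^2/c +
    c)/2, with c left free. *)
Lemma katai_bound c : 0 < c ->
  A * Rabs (sm (fun n => a n * moebius n) N) <=
  INR N * (A / c + c + 1) + (A * INR Y + Rest) / c.
Proof.
  intros Hc.
  assert (HA : 0 <= A). { apply sm_nonneg. intros. apply Rmult_le_pos; [apply iv_bounds|apply inv_INR_nonneg]. }
  assert (E : A * sm (fun n => a n * moebius n) N =
    sm (fun n => a n * moebius n * (A - om n)) N
    + (sm (fun n => a n * moebius n * om n) N + sm (fun m => moebius m * Sg m) N)
    - sm (fun m => moebius m * Sg m) N).
  { rewrite <- sm_scal.
    match goal with |- ?x = ?u + (?v + ?w) - ?w => transitivity (u + v); [|ring] end.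
    rewrite <- sm_plus. apply sm_ext. intros; ring. }
  assert (B1 : Rabs (sm (fun n => a n * moebius n * (A - om n)) N) <= ((A * INR N + 2 * A * INR Y) / c + c * INR N) / 2).
  { eapply Rle_trans with (sm (fun n => Rabs (A - om n)) N).
    - apply sm_abs_le. intros n Hn. rewrite !Rabs_mult.
      pose proof (Ha n). pose proof (moebius_abs n). pose proof (Rabs_pos (a n)).
      pose proof (Rabs_pos (moebius n)). pose proof (Rabs_pos (A - om n)).
      assert (Rabs (a n) * Rabs (moebius n) <= 1) by nra. nra.
    - eapply Rle_trans; [apply (sum_abs_le_square (fun n => A - om n) c Hc)|].
      pose proof turan_kubilius. assert (0 < / c) by (apply Rinv_0_lt_compat; auto).
      unfold Rdiv. nra. }
  assert (B2 : Rabs (sm (fun m => moebius m * Sg m) N) <= ((A * INR N + Rest) / c + c * INR N) / 2).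
  { eapply Rle_trans with (sm (fun n => Rabs (Sg n)) N).
    - apply sm_abs_le. intros n Hn. rewrite !Rabs_mult.
      pose proof (moebius_abs n). pose proof (Rabs_pos (Sg n)). nra.
    - eapply Rle_trans; [apply (sum_abs_le_square Sg c Hc)|].
      pose proof sum_Sg2. assert (0 < / c) by (apply Rinv_0_lt_compat; auto).
      unfold Rdiv. nra. }
  pose proof sum_a_moebius_om as B3.
  rewrite <- (Rabs_right A) at 1 by lra. rewrite <- Rabs_mult, E.
  assert (HR : 0 <= Rest / c).
  { apply Rmult_le_pos; [|left; apply Rinv_0_lt_compat; auto].
    apply sm_nonneg. intros. apply sm_nonneg. intros.
    apply Rmult_le_pos; [apply Rmult_le_pos; apply pr_nonneg|].
    apply Rmult_le_pos; [apply iv_bounds|apply Rabs_pos]. }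
  apply Rabs_le_inv in B1. apply Rabs_le_inv in B2. apply Rabs_le_inv in B3.
  unfold Rdiv in *. apply Rabs_le. split; lra.
Qed.

End Katai.

Lemma katai eps : 0 < eps -> exists Y delta N0, 0 < delta /\
  forall N a, (N0 <= N)%nat -> (forall n, Rabs (a n) <= 1) ->
  (forall p q, (p <= Y)%nat -> (q <= Y)%nat -> nprime p -> nprime q -> p <> q ->
     Rabs (corr a p q N) <= delta * INR N) ->
  Rabs (sm (fun n => a n * moebius n) N) <= eps * INR N.
Proof.
  intros Heps. set (c := 8 / eps).
  assert (Hc : 0 < c) by (apply Rdiv_lt_0_compat; lra).
  assert (Hce : c * eps = 8) by (unfold c; field; lra).
  (* With A at least c^2 + c + 1 every term of [katai_bound] is dominated by a multiple of A N / c,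
     and c = 8/eps leaves room. The later delta = 1/(Y^2 + 1) makes the at most Y^2 correlations sum
     to at most N. *)
  destruct (primeRecip_unbounded (c ^ 2 + c + 1)) as [Y HY].
  set (A := primeRecip Y) in *.
  assert (HA : 0 < A) by nra.
  destruct (nat_above (INR Y)) as (N1 & _ & HN1).
  set (W := INR Y * INR Y).
  assert (HW : 0 <= W) by (unfold W; pose proof (pos_INR Y); nra).
  exists Y, (/ (W + 1)), Y. split; [apply Rinv_0_lt_compat; lra|].
  intros N a HN Ha Hcorr.
  pose proof (katai_bound Y N a Ha c Hc) as K. fold A in K.
  set (Rest := sm (fun p => sm _ Y) Y) in K.
  assert (HR : Rest <= INR N).
  { unfold Rest.
    apply Rle_trans with (sm (fun p => sm (fun q => / (W + 1) * INR N) Y) Y).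
    - apply sm_le. intros p Hp. apply sm_le. intros q Hq.
      assert (0 <= / (W + 1) * INR N) by (apply Rmult_le_pos; [left; apply Rinv_0_lt_compat; lra|apply pos_INR]).
      destruct (primebP p), (primebP q); unfold iv at 1 2; rewrite ?Rmult_0_l, ?Rmult_0_r, ?Rmult_0_l; auto.
      destruct (Nat.eqb_spec p q); unfold negb, iv; rewrite ?Rmult_0_l, ?Rmult_0_r, ?Rmult_1_l; auto.
      apply Hcorr; auto; lia.
    - rewrite !sm_const. pose proof (pos_INR N).
      replace (INR Y * (INR Y * (/ (W + 1) * INR N))) with (W / (W + 1) * INR N) by (unfold W; field; nra).
      rewrite <- (Rmult_1_l (INR N)) at 2. apply Rmult_le_compat_r; auto.
      apply (Rmult_le_reg_r (W + 1)); [lra|]. unfold Rdiv. rewrite Rmult_assoc, Rinv_l; lra. }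
  assert (HYN : INR Y <= INR N) by (apply le_INR; auto).
  pose proof (pos_INR N) as HN'.
  assert (K2 : A * Rabs (sm (fun n => a n * moebius n) N) <= A * (eps * INR N)).
  { eapply Rle_trans; [exact K|].
    assert (Hic : 0 < / c) by (apply Rinv_0_lt_compat; auto).
    assert (Hcc : c * / c = 1) by (field; lra).
    assert (Q1 : (A * INR Y + Rest) / c <= (A * INR N + INR N) * / c).
    { unfold Rdiv. apply Rmult_le_compat_r; [lra|]. nra. }
    assert (Q2 : eps = 8 * / c) by (unfold c; field; lra).
    rewrite Q2. 
    apply (Rmult_le_reg_r c); auto.
    replace (A * (8 * / c * INR N) * c) with (8 * A * INR N * (c * / c)) by ring.
    apply Rle_trans with ((INR N * (A / c + c + 1) + (A * INR N + INR N) * / c) * c);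
      [apply Rmult_le_compat_r; lra|].
    replace ((INR N * (A / c + c + 1) + (A * INR N + INR N) * / c) * c) with
     (INR N * (A * (c * / c) + c ^ 2 + c + (A + 1) * (c * / c))) by (unfold Rdiv; ring).
    rewrite Hcc. 
    assert (2 * A + c ^ 2 + c + 1 <= 8 * A) by nra.
    apply Rle_trans with (INR N * (8 * A)); [apply Rmult_le_compat_l; lra|lra]. }
  apply Rmult_le_reg_l in K2; auto.
Qed.

(** * Block structure of rank-one words *)

(** [Blk t] is the letter at position t of a block, [Sp v] the one at position v of a run of level-k
    spacers inside B_{k+1}, [Gap] a spacer of higher level. Keeping positions makes the block
    structure a condition on neighbouring labels. *)
Inductive lab := Blk (t : nat) | Sp (v : nat) | Gap.

(** A finished block may be followed directly by another block or by [Gap], as spacer runs can be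
    empty. Level-k spacers precede those of higher level, so [Gap] is never followed by [Sp]. *)
Definition step (h : nat) (x y : lab) : Prop :=
  match x, y with
  | Blk t, Blk t' => (t' = S t /\ t' < h)%nat \/ (S t = h /\ t' = 0)%nat
  | Blk t, Sp v => S t = h /\ v = 0%nat
  | Blk t, Gap => S t = h
  | Sp v, Sp v' => v' = S v
  | Sp v, Blk t' => t' = 0%nat
  | Sp v, Gap => True
  | Gap, Gap => True
  | Gap, Blk t' => t' = 0%nat
  | Gap, Sp _ => False
  end.

Definition lstart (x : lab) : Prop := x = Blk 0.
Definition lend (h : nat) (x : lab) : Prop := match x with Blk t => S t = h | _ => True end.

Lemma lend_start h x y : (1 <= h)%nat -> lend h x -> lstart y -> step h x y.
Proof. intros Hh Hx ->. destruct x; simpl in *; auto. Qed.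

Lemma lend_gap h x : lend h x -> step h x Gap.
Proof. destruct x; simpl; auto. Qed.

Definition isend (hh : nat) (x : lab) : bool := match x with Blk t => Nat.eqb (S t) hh | _ => false end.
Definition isblk (x : lab) : bool := match x with Gap => false | _ => true end.

Definition lpos (x : lab) : R := match x with Blk t => INR t | _ => 0 end.

Lemma step_lpos hh x y : step hh x y ->
  (isend hh x = true -> lpos x + 1 = INR hh /\ lpos y = 0) /\ (isend hh x = false -> lpos y <= lpos x + 1).
Proof.
  intros H. destruct x as [t|v|], y as [t'|v'|]; simpl in H; unfold isend, lpos; split; intros E;
    try discriminate; try (destruct (Nat.eqb_spec (S t) hh) as [e|e]; try discriminate); subst;
    rewrite ?S_INR; try (simpl INR; lra); try lia.
  - destruct H as [[-> H]|[_ ->]]; [lia|]. simpl. lra.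
  - destruct H as [[-> H]|[H ->]]; [rewrite S_INR; lra|lia].
Qed.

(** [lpos] serves as a potential: it rises by at most 1 per step and each end of a block resets it
    from h - 1 to 0. The extra h pays for a block already under way at the start. *)
Lemma count_ends hh (l : nat -> lab) N :
  (forall j, (j <= S N)%nat -> match l j with Blk t => (t < hh)%nat | _ => True end) ->
  (forall j, (j <= N)%nat -> step hh (l j) (l (S j))) ->
  INR hh * sm (fun j => iv (isend hh (l j))) N <= INR N + INR hh.
Proof.
  intros Hb Hs.
  assert (P : forall n, (n <= N)%nat -> INR hh * sm (fun j => iv (isend hh (l j))) n <=
    INR n + INR hh - lpos (l (S n))).
  { induction n as [|n IH]; intros Hn.
    - specialize (Hb 1%nat ltac:(lia)). simpl sm. change (INR 0) with 0. pose proof (pos_INR hh).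
      destruct (l 1%nat); unfold lpos; try lra. apply lt_INR in Hb. lra.
    - specialize (IH ltac:(lia)). destruct (step_lpos _ _ _ (Hs (S n) ltac:(lia))) as [S1 S2].
      rewrite sm_S, Rmult_plus_distr_l, S_INR.
      destruct (isend hh (l (S n))); unfold iv at 2.
      + destruct (S1 eq_refl). lra.
      + specialize (S2 eq_refl). lra. }
  specialize (P N ltac:(lia)).
  assert (0 <= lpos (l (S N))) by (destruct (l (S N)); simpl; try lra; apply pos_INR). lra.
Qed.

(** Leaving the blocks happens only at the end of one, and between two entries there is an exit;
    hence two per end, plus a first entry. *)
Lemma variation_bound hh (l : nat -> lab) N :
  (forall j, (j <= N)%nat -> step hh (l j) (l (S j))) ->
  (forall j, (j <= S N)%nat -> match l j with Sp _ => False | _ => True end) ->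
  sm (fun j => Rabs (iv (isblk (l j)) - iv (isblk (l (S j))))) N <=
  2 * sm (fun j => iv (isend hh (l j))) N + 1.
Proof.
  intros Hs Hb.
  assert (P : forall n, (n <= N)%nat -> sm (fun j => Rabs (iv (isblk (l j)) - iv (isblk (l (S j))))) n <=
    2 * sm (fun j => iv (isend hh (l j))) n + iv (isblk (l (S n)))).
  { induction n as [|n IH]; intros Hn.
    - simpl sm. pose proof (iv_bounds (isblk (l 1%nat))). lra.
    - specialize (IH ltac:(lia)). specialize (Hs (S n) ltac:(lia)). rewrite !sm_S.
      assert (E : isblk (l (S n)) = true -> isblk (l (S (S n))) = false -> isend hh (l (S n)) = true).
      { specialize (Hb (S n) ltac:(lia)).
        destruct (l (S n)), (l (S (S n))); try discriminate; try contradiction.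
        intros _ _. apply Nat.eqb_eq. exact Hs. }
      pose proof (iv_bounds (isend hh (l (S n)))).
      destruct (isblk (l (S n))), (isblk (l (S (S n)))); change (iv true) with 1 in *; change (iv false) with 0 in *.
      all: try (rewrite Rminus_diag, Rabs_R0; lra).
      + rewrite E in * by auto. change (iv true) with 1 in *. rewrite Rminus_0_r, Rabs_R1. lra.
      + rewrite Rminus_0_l, Rabs_Ropp, Rabs_R1. lra. }
  specialize (P N ltac:(lia)). pose proof (iv_bounds (isblk (l (S N)))). lra.
Qed.
Section Words.
Variables (p : nat -> nat) (s : nat -> nat -> nat).
Hypothesis Hp : forall n, (1 <= n)%nat -> (2 <= p n)%nat.

(* [lift base gap k d] is the word B_{k+d} with every copy of B_k replaced by [base]
   and every spacer of level at least k by [gap]. *)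
Fixpoint lift {A : Type} (base : list A) (gap : A) (k d : nat) : list A :=
  match d with
  | O => base
  | S d' => concat (map (fun i => lift base gap k d' ++ repeat gap (s (k + d') i)) (seq 0 (p (k + d'))))
  end.

Lemma Bw_succ n : (1 <= n)%nat ->
  Bw p s (S n) = concat (map (fun i => Bw p s n ++ repeat true (s n i)) (seq 0 (p n))).
Proof. intros Hn. simpl. rewrite (proj2 (Nat.eqb_neq _ _)) by lia. reflexivity. Qed.

Lemma hgt_succ n : (1 <= n)%nat -> hgt p s (S n) = (p n * hgt p s n + spsum p s n)%nat.
Proof. intros Hn. simpl. rewrite (proj2 (Nat.eqb_neq _ _)) by lia. reflexivity. Qed.

Lemma length_Bw n : (1 <= n)%nat -> length (Bw p s n) = hgt p s n.
Proof.
  intros Hn. induction Hn as [|n Hn IH]; [reflexivity|].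
  rewrite Bw_succ, hgt_succ, length_concat, map_map by auto. unfold spsum.
  rewrite (map_ext _ (fun i => (hgt p s n + s n i)%nat)).
  2:{ intros i. rewrite length_app, repeat_length, IH. reflexivity. }
  replace (p n) with (length (seq 0 (p n))) at 2 by apply length_seq.
  induction (seq 0 (p n)) as [|i l IHl]; [reflexivity|]. simpl in *. rewrite IHl. lia.
Qed.

Lemma hgt_ge n : (1 <= n)%nat -> (1 <= hgt p s n)%nat.
Proof.
  intros Hn. induction Hn as [|n Hn IH]; [simpl; lia|].
  rewrite hgt_succ by auto. specialize (Hp n Hn). nia.
Qed.

Lemma hgt_double n : (1 <= n)%nat -> (2 * hgt p s n <= hgt p s (S n))%nat.
Proof. intros Hn. rewrite hgt_succ by auto. specialize (Hp n Hn). nia. Qed.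

Lemma hgt_ge_id n : (1 <= n)%nat -> (n <= hgt p s n)%nat.
Proof.
  intros Hn. induction Hn as [|n Hn IH]; [simpl; lia|].
  pose proof (hgt_double n Hn). lia.
Qed.

Lemma Bw_lift k d : (1 <= k)%nat -> Bw p s (k + d) = lift (Bw p s k) true k d.
Proof.
  intros Hk. induction d as [|d IH]; [rewrite Nat.add_0_r; reflexivity|].
  rewrite Nat.add_succ_r, Bw_succ by lia. simpl. rewrite IH. reflexivity.
Qed.

Lemma infix_trans (u v w : list bool) : infix u v -> infix v w -> infix u w.
Proof.
  intros (a & b & ->) (c & d & ->). exists (c ++ a), (b ++ d). rewrite !app_assoc. reflexivity.
Qed.

Lemma Bw_infix_succ n : (1 <= n)%nat -> infix (Bw p s n) (Bw p s (S n)).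
Proof.
  intros Hn. rewrite Bw_succ by auto. specialize (Hp n Hn).
  destruct (p n) as [|m]; [lia|]. simpl. exists [], (repeat true (s n 0) ++ concat (map (fun i => Bw p s n ++ repeat true (s n i)) (seq 1 m))).
  simpl. rewrite <- app_assoc. reflexivity.
Qed.

Lemma Bw_infix m n : (1 <= m <= n)%nat -> infix (Bw p s m) (Bw p s n).
Proof.
  intros [Hm Hmn]. induction Hmn as [|n Hmn IH].
  - exists [], []. rewrite app_nil_r. reflexivity.
  - eapply infix_trans; [exact IH|]. apply Bw_infix_succ. lia.
Qed.

Section Forall2Lift.
Context {A B : Type} (R : A -> B -> Prop).

Lemma Forall2_concat_map (f : nat -> list A) (g : nat -> list B) l :
  (forall i, Forall2 R (f i) (g i)) -> Forall2 R (concat (map f l)) (concat (map g l)).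
Proof. intros H. induction l; simpl; auto using Forall2_app. Qed.

Lemma Forall2_repeat x y n : R x y -> Forall2 R (repeat x n) (repeat y n).
Proof. intros H. induction n; simpl; auto. Qed.

Lemma Forall2_lift base base' gap gap' k d : Forall2 R base base' -> R gap gap' ->
  Forall2 R (lift base gap k d) (lift base' gap' k d).
Proof.
  intros Hb Hg. induction d as [|d IH]; simpl; auto.
  apply Forall2_concat_map. intros i. apply Forall2_app; auto using Forall2_repeat.
Qed.

Lemma Forall2_nth l l' x y i : Forall2 R l l' -> (i < length l)%nat -> R (nth i l x) (nth i l' y).
Proof.
  intros H. revert i. induction H; intros i Hi; simpl in Hi; [lia|].
  destruct i; simpl; auto. apply IHForall2. lia.
Qed.
End Forall2Lift.

Section Chain.
Context {A : Type} (x0 : A) (R : A -> A -> Prop) (H T : A -> Prop).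
Hypothesis HTR : forall x y, T x -> H y -> R x y.

(** The conditions on the first and last element are what lets adjacency survive concatenation,
    through [HTR]. *)
Definition chained (l : list A) : Prop :=
  l <> [] /\ (forall i, (S i < length l)%nat -> R (nth i l x0) (nth (S i) l x0)) /\
  H (nth 0 l x0) /\ T (nth (length l - 1) l x0).

Lemma chained_app l1 l2 : chained l1 -> chained l2 -> chained (l1 ++ l2).
Proof.
  intros (N1 & C1 & H1 & T1) (N2 & C2 & H2 & T2).
  assert (L1 : (1 <= length l1)%nat) by (destruct l1; simpl; [tauto|lia]).
  assert (L2 : (1 <= length l2)%nat) by (destruct l2; simpl; [tauto|lia]).
  repeat split.
  - destruct l1; simpl; [tauto|discriminate].
  - intros i Hi. rewrite length_app in Hi.
    destruct (lt_eq_lt_dec (S i) (length l1)) as [[E|E]|E].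
    + rewrite !app_nth1 by lia. auto.
    + rewrite app_nth1, app_nth2 by lia. apply HTR.
      * replace i with (length l1 - 1)%nat by lia. auto.
      * replace (S i - length l1)%nat with 0%nat by lia. auto.
    + rewrite !app_nth2 by lia. replace (S i - length l1)%nat with (S (i - length l1)) by lia.
      apply C2. lia.
  - rewrite app_nth1 by lia. auto.
  - rewrite app_nth2; rewrite length_app; [|lia].
    replace (length l1 + length l2 - 1 - length l1)%nat with (length l2 - 1)%nat by lia. auto.
Qed.

Lemma chained_concat (ls : list (list A)) : ls <> [] -> (forall l, In l ls -> chained l) -> chained (concat ls).
Proof.
  intros Hne HC. induction ls as [|l ls IH]; [tauto|]. simpl.
  destruct ls as [|l' ls].
  - simpl. rewrite app_nil_r. apply HC. left; auto.
  - apply chained_app; [apply HC; left; auto|]. apply IH; [discriminate|].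
    intros; apply HC; right; auto.
Qed.

Lemma chained_snoc l g : chained l -> (forall x, T x -> R x g) -> T g -> chained (l ++ [g]).
Proof.
  intros (N1 & C1 & H1 & T1) Hg Tg.
  assert (L1 : (1 <= length l)%nat) by (destruct l; simpl; [tauto|lia]).
  repeat split.
  - destruct l; simpl; discriminate.
  - intros i Hi. rewrite length_app in Hi. simpl in Hi.
    destruct (Nat.eq_dec (S i) (length l)) as [E|E].
    + rewrite app_nth1, app_nth2 by lia. rewrite E, Nat.sub_diag. simpl. apply Hg.
      replace i with (length l - 1)%nat by lia. auto.
    + rewrite !app_nth1 by lia. apply C1. lia.
  - rewrite app_nth1 by lia. auto.
  - rewrite length_app. simpl. rewrite app_nth2 by lia.
    replace (length l + 1 - 1 - length l)%nat with 0%nat by lia. auto.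
Qed.

Lemma chained_repeat l g n : chained l -> (forall x, T x -> R x g) -> T g -> chained (l ++ repeat g n).
Proof.
  intros Hl Hg Tg. induction n as [|n IH]; simpl; [rewrite app_nil_r; auto|].
  rewrite repeat_cons, app_assoc.
  apply chained_snoc; auto.
Qed.

Lemma chained_lift base gap k d : (1 <= k)%nat -> chained base -> (forall x, T x -> R x gap) -> T gap ->
  chained (lift base gap k d).
Proof.
  intros Hk Hb Hg Tg. induction d as [|d IH]; simpl; auto.
  apply chained_concat.
  - specialize (Hp (k + d) ltac:(lia)). destruct (p (k + d)); [lia|]. simpl. discriminate.
  - intros l Hl. apply in_map_iff in Hl. destruct Hl as (i & <- & _). apply chained_repeat; auto.
Qed.
End Chain.

Lemma chained_blk h : (1 <= h)%nat -> chained Gap (step h) lstart (lend h) (map Blk (seq 0 h)).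
Proof.
  intros Hh.
  assert (E : forall i, (i < h)%nat -> nth i (map Blk (seq 0 h)) Gap = Blk i).
  { intros i Hi. rewrite (nth_indep _ Gap (Blk 0)) by (rewrite length_map, length_seq; auto).
    rewrite map_nth, seq_nth by auto. reflexivity. }
  repeat split.
  - destruct h; simpl; [lia|discriminate].
  - rewrite length_map, length_seq. intros i Hi. rewrite !E by lia. simpl. left. lia.
  - apply E; lia.
  - rewrite length_map, length_seq, E by lia. simpl. lia.
Qed.

Lemma chained_blk_sp h v : (1 <= h)%nat ->
  chained Gap (step h) lstart (lend h) (map Blk (seq 0 h) ++ map Sp (seq 0 v)).
Proof.
  intros Hh. destruct v as [|v]; [simpl; rewrite app_nil_r; apply chained_blk; auto|].
  assert (E : forall i, (i < h)%nat -> nth i (map Blk (seq 0 h)) Gap = Blk i).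
  { intros i Hi. rewrite (nth_indep _ Gap (Blk 0)) by (rewrite length_map, length_seq; auto).
    rewrite map_nth, seq_nth by auto. reflexivity. }
  assert (E' : forall i, (i < S v)%nat -> nth i (map Sp (seq 0 (S v))) Gap = Sp i).
  { intros i Hi. rewrite (nth_indep _ Gap (Sp 0)) by (rewrite length_map, length_seq; auto).
    rewrite map_nth, seq_nth by auto. reflexivity. }
  assert (Lb : length (map Blk (seq 0 h)) = h) by (rewrite length_map, length_seq; auto).
  assert (Ls : length (map Sp (seq 0 (S v))) = S v) by (rewrite length_map, length_seq; auto).
  assert (F : forall i, (i < h + S v)%nat -> nth i (map Blk (seq 0 h) ++ map Sp (seq 0 (S v))) Gap =
     if le_lt_dec h i then Sp (i - h) else Blk i).
  { intros i Hi. destruct (le_lt_dec h i).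
    - rewrite app_nth2, Lb, E' by lia. reflexivity.
    - rewrite app_nth1, E by lia. reflexivity. }
  repeat split.
  - destruct h; simpl; [lia|discriminate].
  - rewrite length_app, Lb, Ls. intros i Hi. rewrite !F by lia.
    destruct (le_lt_dec h i), (le_lt_dec h (S i)); cbn [step]; lia.
  - rewrite F by lia. destruct (le_lt_dec h 0); [lia|reflexivity].
  - rewrite length_app, Lb, Ls, F by lia. destruct (le_lt_dec h (h + S v - 1)); simpl; lia.
Qed.

Variable k : nat.
Hypothesis Hk : (1 <= k)%nat.
Let h := hgt p s k.
Let h' := hgt p s (S k).

(** [base1] and [base2] label the same word B_{k+1}: by copies of B_k with their spacers, and as one
    block. Lifting both through the same recursion keeps letters aligned and gaps in the same
    places. *)
Definition base1 : list lab :=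
  concat (map (fun i => map Blk (seq 0 h) ++ map Sp (seq 0 (s k i))) (seq 0 (p k))).
Definition base2 : list lab := map Blk (seq 0 h').

Lemma chained_base1 : chained Gap (step h) lstart (lend h) base1.
Proof.
  assert (Hh : (1 <= h)%nat) by (apply hgt_ge; auto).
  apply chained_concat.
  - intros x y; apply lend_start; auto.
  - specialize (Hp k Hk). destruct (p k); [lia|]. simpl; discriminate.
  - intros l Hl. apply in_map_iff in Hl. destruct Hl as (i & <- & _). apply chained_blk_sp; auto.
Qed.

Definition rel_val (b : bool) (l : lab) : Prop :=
  match l with Blk t => (t < h)%nat /\ nth t (Bw p s k) true = b | Sp v => b = true /\ (v < tmax p s k)%nat | Gap => b = true end.

Lemma tmax_ge i : (i < p k)%nat -> (s k i <= tmax p s k)%nat.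
Proof.
  intros Hi. unfold tmax. assert (Hin : In i (seq 0 (p k))) by (apply in_seq; lia).
  induction (seq 0 (p k)) as [|j l IH]; [destruct Hin|]. simpl.
  destruct Hin as [->|Hin]; [lia|]. specialize (IH Hin). lia.
Qed.

Lemma Forall2_of_nth {A B} (R : A -> B -> Prop) l l' x y :
  length l = length l' -> (forall i, (i < length l)%nat -> R (nth i l x) (nth i l' y)) -> Forall2 R l l'.
Proof.
  revert l'. induction l as [|a l IH]; intros [|b l'] HL H; try discriminate; constructor.
  - apply (H 0%nat). simpl; lia.
  - apply IH; [simpl in HL; lia|]. intros i Hi. apply (H (S i)). simpl; lia.
Qed.

Lemma base1_val : Forall2 rel_val (Bw p s (S k)) base1.
Proof.
  rewrite Bw_succ by auto. unfold base1.
  assert (G : forall l, (forall i, In i l -> (i < p k)%nat) ->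
    Forall2 rel_val (concat (map (fun i => Bw p s k ++ repeat true (s k i)) l))
      (concat (map (fun i => map Blk (seq 0 h) ++ map Sp (seq 0 (s k i))) l))).
  { induction l as [|i l IH]; intros Hl; simpl; [constructor|].
    apply Forall2_app; [|apply IH; intros; apply Hl; right; auto].
    apply Forall2_app.
    - apply (Forall2_of_nth _ _ _ true (Blk 0)).
      + rewrite length_Bw, length_map, length_seq by auto. reflexivity.
      + intros j Hj. rewrite length_Bw in Hj by auto. rewrite map_nth, seq_nth by auto. split; auto.
    - apply (Forall2_of_nth _ _ _ true (Sp 0)).
      + rewrite repeat_length, length_map, length_seq by auto. reflexivity.
      + intros j Hj. rewrite repeat_length in Hj. rewrite map_nth, seq_nth by auto.
        split; [|].
        * clear Hl. revert j Hj. induction (s k i); intros j Hj; [lia|]. destruct j; simpl; auto. apply IHn. lia.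
        * pose proof (tmax_ge i (Hl i (or_introl eq_refl))). lia. }
  apply G. intros i Hi. apply in_seq in Hi. lia.
Qed.

Definition rel_gap (l l' : lab) : Prop := l = Gap <-> l' = Gap.

Lemma base_gap : Forall2 rel_gap base1 base2.
Proof.
  assert (N1 : forall x, In x base1 -> x <> Gap).
  { intros x Hx. unfold base1 in Hx. apply in_concat in Hx. destruct Hx as (l & Hl & Hx).
    apply in_map_iff in Hl. destruct Hl as (i & <- & _). apply in_app_iff in Hx.
    destruct Hx as [Hx|Hx]; apply in_map_iff in Hx; destruct Hx as (t & <- & _); discriminate. }
  assert (N2 : forall x, In x base2 -> x <> Gap).
  { intros x Hx. apply in_map_iff in Hx. destruct Hx as (t & <- & _). discriminate. }
  apply (Forall2_of_nth _ _ _ Gap Gap).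
  - rewrite <- (Forall2_length base1_val), length_Bw by lia.
    unfold base2. rewrite length_map, length_seq. reflexivity.
  - intros i Hi. assert (Hi2 : (i < length base2)%nat).
    { unfold base2. rewrite length_map, length_seq. unfold h'. rewrite <- length_Bw by lia.
      rewrite (Forall2_length base1_val). auto. }
    pose proof (N1 _ (nth_In _ Gap Hi)). pose proof (N2 _ (nth_In _ Gap Hi2)). split; tauto.
Qed.

Lemma nth_infix (l1 w l2 : list bool) j : (j < length w)%nat -> nth (length l1 + j) (l1 ++ w ++ l2) true = nth j w true.
Proof.
  intros Hj. rewrite app_nth2 by lia. rewrite app_nth1 by lia. f_equal. lia.
Qed.

(* The labels of a point of Omega: [l1] locates each coordinate with respect to the blocks B_k
   and [l2] with respect to the blocks B_{k+1}. *)
Lemma labelling w X : inOmega p s w -> exists l1 l2 : nat -> lab,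
  (forall j, (j < X)%nat -> rel_val (w (Z.of_nat j)) (l1 j)) /\
  (forall j, (S j < X)%nat -> step h (l1 j) (l1 (S j))) /\
  (forall j, (j < X)%nat -> match l2 j with Blk t => (t < h')%nat | Sp _ => False | Gap => True end) /\
  (forall j, (S j < X)%nat -> step h' (l2 j) (l2 (S j))) /\
  (forall j, (j < X)%nat -> l1 j = Gap <-> l2 j = Gap).
Proof.
  intros Hw. destruct (Hw 0%Z X) as (m & Hm & Hinf).
  (* The word provided by Omega may be shorter than B_{k+1}; a longer one contains it and is a lift
     of B_{k+1}. *)
  assert (Hinf2 : infix (window w 0 X) (Bw p s (S k + m))).
  { eapply infix_trans; [exact Hinf|]. apply Bw_infix. lia. }
  clear Hinf. destruct Hinf2 as (u & v & E). set (o := length u).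
  rewrite Bw_lift in E by lia.
  set (B := lift (Bw p s (S k)) true (S k) m) in *.
  set (L1 := lift base1 Gap (S k) m). set (L2 := lift base2 Gap (S k) m).
  assert (Hh : (1 <= h)%nat) by (apply hgt_ge; auto).
  assert (Hh' : (1 <= h')%nat) by (apply hgt_ge; lia).
  assert (R1 : Forall2 rel_val B L1) by (apply Forall2_lift; [apply base1_val|reflexivity]).
  assert (R2 : Forall2 rel_gap L1 L2) by (apply Forall2_lift; [apply base_gap|split; auto]).
  assert (C1 : chained Gap (step h) lstart (lend h) L1).
  { apply chained_lift; try lia; [intros x y; apply lend_start; auto|apply chained_base1|apply lend_gap|exact I]. }
  assert (C2 : chained Gap (step h') lstart (lend h') L2).
  { apply chained_lift; try lia; [intros x y; apply lend_start; auto|apply chained_blk; auto|apply lend_gap|exact I]. }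
  assert (R3 : Forall2 (fun (x y : lab) => match x with Blk t => (t < h')%nat | Sp _ => False | Gap => True end) L2 L2).
  { apply Forall2_lift; [|exact I]. apply (Forall2_of_nth _ _ _ (Blk 0) Gap); auto.
    unfold base2. rewrite length_map, length_seq. intros i Hi. rewrite map_nth, seq_nth by auto. auto. }
  assert (LX : length (window w 0 X) = X) by (unfold window; rewrite length_map, length_seq; auto).
  assert (LB : (o + X <= length B)%nat) by (rewrite E, !length_app, LX; unfold o; lia).
  pose proof (Forall2_length R1) as LL1. pose proof (Forall2_length R2) as LL2.
  exists (fun j => nth (o + j) L1 Gap), (fun j => nth (o + j) L2 Gap).
  repeat split; intros.
  - pose proof (Forall2_nth rel_val B L1 true Gap (o + j) R1 ltac:(lia)) as Q.
    rewrite E in Q. unfold o in Q at 1. rewrite nth_infix in Q by lia.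
    unfold window in Q. rewrite (nth_indep _ true (w (0 + Z.of_nat 0)%Z)) in Q by (rewrite length_map, length_seq; auto).
    rewrite (map_nth (fun j => w (0 + Z.of_nat j)%Z)), seq_nth in Q by auto. exact Q.
  - rewrite Nat.add_succ_r. apply C1. lia.
  - exact (Forall2_nth _ L2 L2 Gap Gap (o + j) R3 ltac:(lia)).
  - rewrite Nat.add_succ_r. apply C2. lia.
  - apply (Forall2_nth rel_gap L1 L2 Gap Gap (o + j) R2 ltac:(lia)); auto.
  - apply (Forall2_nth rel_gap L1 L2 Gap Gap (o + j) R2 ltac:(lia)); auto.
Qed.

End Words.

(** * Counting occurrences of a word along the labelled orbit *)

Lemma length_filter_sm (P : nat -> bool) n :
  INR (length (filter P (seq 0 n))) = sm (fun i => iv (P (pred i))) n.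
Proof.
  induction n as [|n IH]; [reflexivity|].
  rewrite seq_S, filter_app, length_app, plus_INR, IH, sm_S. f_equal. simpl.
  destruct (P n); reflexivity.
Qed.

Lemma firstn_skipn_map (l : list bool) t n : (t + n <= length l)%nat ->
  firstn n (skipn t l) = map (fun i => nth (t + i) l true) (seq 0 n).
Proof.
  intros H. apply (nth_ext _ _ true true).
  - rewrite length_firstn, length_skipn, length_map, length_seq. lia.
  - intros i Hi. rewrite length_firstn, length_skipn in Hi.
    rewrite nth_firstn. destruct (Nat.ltb_spec i n); [|lia].
    rewrite nth_skipn. rewrite (nth_indep (map _ _) true (nth (t + 0) l true)) by (rewrite length_map, length_seq; lia).
    rewrite (map_nth (fun i => nth (t + i) l true)), seq_nth by lia. reflexivity.
Qed.

Lemma count_overlap h L : sm (fun i => iv (Nat.ltb h (pred i + L))) h <= INR L.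
Proof.
  destruct (le_lt_dec L h) as [HL|HL].
  - destruct L as [|L].
    + rewrite sm_0; [simpl; lra|]. intros i Hi. destruct (Nat.ltb_spec h (pred i + 0)); [lia|reflexivity].
    + rewrite (sm_ext _ (fun i => iv (Nat.leb (h - L + 1) i))).
      * rewrite sm_tail by lia. rewrite <- minus_INR by lia. apply le_INR. lia.
      * intros i Hi. destruct (Nat.ltb_spec h (pred i + S L)), (Nat.leb_spec (h - L + 1) i); auto; lia.
  - apply Rle_trans with (sm (fun _ => 1) h).
    + apply sm_le. intros; apply iv_bounds.
    + rewrite sm_const, Rmult_1_r. apply le_INR. lia.
Qed.

Section CountWord.
Variables (p : nat -> nat) (s : nat -> nat -> nat).
Hypothesis Hp : forall n, (1 <= n)%nat -> (2 <= p n)%nat.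
Variable k : nat.
Hypothesis Hk : (1 <= k)%nat.
Let h := hgt p s k.
Variables (w : seqZ) (l1 : nat -> lab) (N X : nat) (W : list bool).
Let L := length W.
Hypothesis HX : (N + L + 2 <= X)%nat.
Hypothesis Hval : forall j, (j < X)%nat -> rel_val p s k (w (Z.of_nat j)) (l1 j).
Hypothesis Hstep : forall j, (S j < X)%nat -> step h (l1 j) (l1 (S j)).

Definition weq (u : list bool) : bool := if list_eq_dec bool_dec u W then true else false.

Let occb (i : nat) : bool := weq (firstn L (skipn i (Bw p s k))).
(** A start at position t of a block is charged if W occurs there inside B_k or would overhang the
    end. So [D] bounds the cost of one block with the spacers after it: the occurrences, at most L
    overhangs, and at most t_k starts on spacers. *)
Let g (t : nat) : R := iv ((Nat.leb (t + L) h && occb t) || Nat.ltb h (t + L)).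
Let G (n : nat) : R := sm (fun i => g (pred i)) n.
Let D : R := INR (occ W (Bw p s k)) + INR L + INR (tmax p s k).

Lemma occ_sm : INR (occ W (Bw p s k)) = sm (fun i => iv (occb (pred i))) (h - L + 1).
Proof.
  unfold occ. rewrite length_Bw by auto. apply length_filter_sm.
Qed.

Lemma G_total : G h <= D - INR (tmax p s k).
Proof.
  unfold D. rewrite occ_sm.
  apply Rle_trans with (sm (fun i => iv (Nat.leb i (Nat.min h (h - L + 1))) * iv (occb (pred i)) + iv (Nat.ltb h (pred i + L))) h).
  - apply sm_le. intros i Hi. unfold g.
    destruct (Nat.leb_spec (pred i + L) h), (Nat.ltb_spec h (pred i + L)), (Nat.leb_spec i (Nat.min h (h - L + 1)));
      try lia; destruct (occb (pred i)); simpl; lra.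
  - rewrite sm_plus, sm_trunc by lia. pose proof (count_overlap h L).
    assert (sm (fun i => iv (occb (pred i))) (Nat.min h (h - L + 1)) <= sm (fun i => iv (occb (pred i))) (h - L + 1)).
    { apply sm_mono; [lia|]. intros; apply iv_bounds. }
    lra.
Qed.

Lemma run_of_block j t i : (j + i < X)%nat -> l1 j = Blk t -> (t + i < h)%nat -> l1 (j + i) = Blk (t + i).
Proof.
  intros Hj Ht. induction i as [|i IH]; intros Hi; [rewrite !Nat.add_0_r; auto|].
  specialize (IH ltac:(lia) ltac:(lia)). pose proof (Hstep (j + i) ltac:(lia)) as S1.
  rewrite IH in S1. rewrite !Nat.add_succ_r. destruct (l1 (S (j + i))); simpl in S1; try lia.
  f_equal. lia.
Qed.

Lemma cyl_le_g j t : (j <= N)%nat -> l1 j = Blk t -> cyl W (shiftn j w) <= g t.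
Proof.
  intros Hj Ht. unfold cyl. destruct list_eq_dec as [E|E]; [|apply iv_bounds].
  unfold g. destruct (Nat.ltb_spec h (t + L)) as [H|H]; [rewrite orb_true_r; simpl; lra|].
  destruct (Nat.leb_spec (t + L) h); [|lia]. cbn [andb]. rewrite orb_false_r.
  unfold occb, weq. destruct list_eq_dec as [|E']; [simpl; lra|]. exfalso. apply E'.
  rewrite firstn_skipn_map by (rewrite length_Bw by auto; exact H).
  etransitivity; [|exact E]. unfold window. fold L. apply map_ext_in. intros i Hi. apply in_seq in Hi.
  pose proof (run_of_block j t i ltac:(lia) Ht ltac:(lia)) as R1.
  pose proof (Hval (j + i) ltac:(lia)) as V. rewrite R1 in V. destruct V as [_ V]. rewrite V.
  unfold shiftn. f_equal. lia.
Qed.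

(** Potential for the induction: what the unfinished block has already cost. It is negative on
    spacers because the end of the block has been charged the full [D], including spacer starts
    still to come. *)
Let part (x : lab) : R := match x with Blk t => G t | Sp v => INR v - INR (tmax p s k) | Gap => 0 end.

Lemma cyl_bounds V x : 0 <= cyl V x <= 1.
Proof. unfold cyl. destruct list_eq_dec; lra. Qed.

(** One [D] is charged per block end. The 3 accounts for the block under way at time 0 in
    [count_ends], the initial charge, and the final value of the potential. *)
Lemma count_word :
  sm (fun j => iv (isblk (l1 j)) * cyl W (shiftn j w)) N <= D * (INR N / INR h + 3).
Proof.
  assert (Hh : (1 <= h)%nat) by (apply hgt_ge; auto).
  assert (HD : 0 <= D) by (unfold D; pose proof (pos_INR (occ W (Bw p s k))); pose proof (pos_INR L); pose proof (pos_INR (tmax p s k)); lra).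
  assert (HtD : INR (tmax p s k) <= D) by (unfold D; pose proof (pos_INR (occ W (Bw p s k))); pose proof (pos_INR L); lra).
  pose proof G_total as HG.
  assert (Hgn : forall t, 0 <= g t) by (intros; apply iv_bounds).
  assert (HGn : forall t, 0 <= G t) by (intros; apply sm_nonneg; intros; apply Hgn).
  assert (Hpart : forall x, rel_val p s k true x \/ rel_val p s k false x -> - INR (tmax p s k) <= part x <= D).
  { intros x Hx. pose proof (pos_INR (tmax p s k)).
    destruct x as [t|v|]; unfold part.
    - assert (t < h)%nat by (unfold h; destruct Hx as [[H1 _]|[H1 _]]; exact H1).
      assert (G t <= G h) by (apply sm_mono; [lia|intros; apply Hgn]).
      pose proof (HGn t). lra.
    - pose proof (pos_INR v).
      assert (INR v <= INR (tmax p s k)) by (apply le_INR; destruct Hx as [[_ H1]|[_ H1]]; lia). lra.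
    - lra. }
  assert (Hpart' : forall j, (j < X)%nat -> - INR (tmax p s k) <= part (l1 j) <= D).
  { intros j Hj. apply Hpart. pose proof (Hval j Hj). destruct (w (Z.of_nat j)); auto. }
  assert (P : forall n, (n <= N)%nat ->
    sm (fun j => iv (isblk (l1 j)) * cyl W (shiftn j w)) n <=
    D * (sm (fun j => iv (isend h (l1 j))) n + 1) + part (l1 (S n))).
  { induction n as [|n IH]; intros Hn.
    - simpl sm. pose proof (Hpart' 1%nat ltac:(lia)). lra.
    - specialize (IH ltac:(lia)). rewrite !sm_S.
      pose proof (Hstep (S n) ltac:(lia)) as S1. pose proof (Hval (S n) ltac:(lia)) as V1.
      pose proof (Hpart' (S (S n)) ltac:(lia)) as P2.
      pose proof (cyl_bounds W (shiftn (S n) w)) as CB.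
      pose proof (cyl_le_g (S n)) as CG.
      destruct (l1 (S n)) as [t|v|] eqn:E1.
      + specialize (CG t ltac:(lia) eq_refl). simpl isblk. change (iv true) with 1.
        assert (EG : G (S t) = G t + g t) by reflexivity. unfold part in IH at 1.
        unfold isend at 2. destruct (Nat.eqb_spec (S t) h) as [e|e].
        * change (iv true) with 1. rewrite e in EG.
          pose proof (pos_INR (tmax p s k)). lra.
        * change (iv false) with 0.
          assert (E2 : part (l1 (S (S n))) = G (S t)).
          { destruct (l1 (S (S n))); simpl in S1; try lia. unfold part.
            replace t0 with (S t) by lia. reflexivity. }
          rewrite E2, EG. lra.
      + simpl isblk. simpl isend. change (iv true) with 1. change (iv false) with 0.
        unfold part in IH at 1. destruct V1 as [_ V1].
        assert (Hv : INR v + 1 <= INR (tmax p s k)) by (rewrite <- S_INR; apply le_INR; exact V1).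
        assert (E2 : INR v + 1 - INR (tmax p s k) <= part (l1 (S (S n)))).
        { destruct (l1 (S (S n))) as [t'|v'|]; simpl in S1; unfold part.
          - pose proof (HGn t'). lra.
          - subst v'. rewrite S_INR. lra.
          - lra. }
        lra.
      + simpl isblk. simpl isend. change (iv false) with 0. unfold part in IH at 1.
        assert (E2 : 0 <= part (l1 (S (S n)))).
        { destruct (l1 (S (S n))) as [t'|v'|]; simpl in S1; unfold part; [apply HGn|contradiction|lra]. }
        lra. }
  specialize (P N ltac:(lia)). pose proof (Hpart' (S N) ltac:(lia)) as P3.
  assert (C : INR h * sm (fun j => iv (isend h (l1 j))) N <= INR N + INR h).
  { apply count_ends.
    - intros j Hj. pose proof (Hval j ltac:(lia)) as V. destruct (l1 j); auto. destruct V as [V _]. exact V.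
    - intros j Hj. apply Hstep. lia. }
  set (c := sm (fun j => iv (isend h (l1 j))) N) in *.
  pose proof (INR_ge1 h Hh) as Hh1.
  assert (Cc : c <= INR N / INR h + 1).
  { apply (Rmult_le_reg_l (INR h)); [lra|].
    replace (INR h * (INR N / INR h + 1)) with (INR N + INR h) by (field; lra). exact C. }
  eapply Rle_trans; [exact P|]. apply Rle_trans with (D * (c + 2)); [lra|].
  apply Rmult_le_compat_l; lra.
Qed.
End CountWord.

(** * Choice of the blocks up to time N *)

Section Blocks.
Variables (p : nat -> nat) (s : nat -> nat -> nat) (mu : (seqZ -> R) -> R).
Hypothesis Hp : forall n, (1 <= n)%nat -> (2 <= p n)%nat.

Definition variation (e : nat -> bool) (N : nat) : R :=
  sm (fun n => Rabs (iv (e n) - iv (e (S n)))) N.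

(** The indicator is read from the B_{k+1} labels, which makes switches rare, while the words are
    counted with the B_k labels; both labellings have the same gaps. Of the 4, two come from the
    partial block at the start, one from a first entry, one from the cutoff at N. *)
Lemma block_indicator w : inOmega p s w -> forall k N X0, (1 <= k)%nat -> exists e : nat -> bool,
  (forall n, e n = true -> (n <= N)%nat) /\
  (forall n, (n <= N)%nat -> e n = false -> w (Z.of_nat n) = true) /\
  variation e N <= 2 * (INR N / INR (hgt p s (S k))) + 4 /\
  (forall W, (length W <= X0)%nat -> sm (fun n => iv (e n) * cyl W (shiftn n w)) N <=
    (INR (occ W (Bw p s k)) + INR (length W) + INR (tmax p s k)) * (INR N / INR (hgt p s k) + 3)).
Proof.
  intros Hw k N X0 Hk.
  destruct (labelling p s Hp k Hk w (N + X0 + 2) Hw) as (l1 & l2 & H1 & H2 & H3 & H4 & H5).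
  exists (fun n => Nat.leb n N && isblk (l2 n)). repeat split.
  - intros n Hn. apply andb_true_iff in Hn. destruct Hn as [Hn _]. apply Nat.leb_le; auto.
  - intros n Hn Hf. rewrite (proj2 (Nat.leb_le _ _)) in Hf by auto. simpl in Hf.
    assert (l2 n = Gap) by (destruct (l2 n); simpl in Hf; congruence).
    apply H5 in H; [|lia]. specialize (H1 n ltac:(lia)). rewrite H in H1. exact H1.
  - unfold variation.
    assert (V : sm (fun n => Rabs (iv (Nat.leb n N && isblk (l2 n)) - iv (Nat.leb (S n) N && isblk (l2 (S n))))) N <=
      sm (fun n => Rabs (iv (isblk (l2 n)) - iv (isblk (l2 (S n)))) + iv (Nat.eqb N n) * 1) N).
    { apply sm_le. intros n Hn. destruct (Nat.leb_spec n N); [|lia]. cbn [andb].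
      destruct (Nat.leb_spec (S n) N).
      - cbn [andb]. pose proof (iv_bounds (Nat.eqb N n)). lra.
      - replace n with N by lia. rewrite Nat.eqb_refl. cbn [andb].
        destruct (isblk (l2 N)), (isblk (l2 (S N))); unfold iv; rewrite ?Rminus_0_r, ?Rminus_diag, ?Rminus_0_l, ?Rabs_Ropp, ?Rabs_R0, ?Rabs_R1; lra. }
    rewrite sm_plus in V.
    assert (V1 : sm (fun i => iv (Nat.eqb N i) * 1) N <= 1).
    { destruct N as [|N']; [simpl; lra|]. rewrite (sm_pick (fun _ => 1)) by lia. lra. }
    pose proof (variation_bound (hgt p s (S k)) l2 N) as V2.
    pose proof (count_ends (hgt p s (S k)) l2 N) as V3.
    pose proof (INR_ge1 _ (hgt_ge p s Hp (S k) ltac:(lia))) as Hh.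
    set (h' := INR (hgt p s (S k))) in *.
    assert (V4 : sm (fun j => iv (isend (hgt p s (S k)) (l2 j))) N <= INR N / h' + 1).
    { apply (Rmult_le_reg_l h'); [lra|].
      replace (h' * (INR N / h' + 1)) with (INR N + h') by (field; lra). apply V3.
      - intros j Hj. specialize (H3 j ltac:(lia)). destruct (l2 j); auto.
      - intros j Hj. apply H4. lia. }
    assert (V5 : sm (fun j => Rabs (iv (isblk (l2 j)) - iv (isblk (l2 (S j))))) N <=
       2 * sm (fun j => iv (isend (hgt p s (S k)) (l2 j))) N + 1).
    { apply V2.
      - intros j Hj. apply H4. lia.
      - intros j Hj. specialize (H3 j ltac:(lia)). destruct (l2 j); auto. }
    lra.
  - intros W HW.
    rewrite (sm_ext _ (fun j => iv (isblk (l1 j)) * cyl W (shiftn j w))).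
    + apply (count_word p s Hp k Hk w l1 N (N + X0 + 2) W); auto. lia.
    + intros i Hi. destruct (Nat.leb_spec i N); [|lia]. cbn [andb]. f_equal. f_equal.
      specialize (H5 i ltac:(lia)). destruct (l1 i), (l2 i); simpl; auto.
      all: try (destruct H5 as [H5 H5']; specialize (H5 eq_refl); discriminate).
      all: destruct H5 as [H5 H5']; specialize (H5' eq_refl); discriminate.
Qed.

Lemma hgt_mono m n : (1 <= m <= n)%nat -> (hgt p s m <= hgt p s n)%nat.
Proof.
  intros [Hm Hmn]. induction Hmn as [|n Hmn IH]; [lia|].
  pose proof (hgt_double p s Hp n ltac:(lia)). lia.
Qed.

Lemma hgt_bracket X : 1 <= X -> exists k, (1 <= k)%nat /\ INR (hgt p s k) <= X < INR (hgt p s (S k)).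
Proof.
  intros HX.
  assert (P : forall n, X < INR (hgt p s (S n)) -> exists k, (1 <= k)%nat /\ INR (hgt p s k) <= X < INR (hgt p s (S k))).
  { induction n as [|n IH]; intros H; [simpl in H; lra|].
    destruct (Rlt_le_dec X (INR (hgt p s (S n)))); [auto|]. exists (S n). split; [lia|lra]. }
  destruct (nat_above (X + 1)) as (n & Hn & HnX). apply (P n).
  pose proof (hgt_ge_id p s Hp (S n) ltac:(lia)) as H. apply le_INR in H. rewrite S_INR in H. lra.
Qed.

Hypothesis Hreas : reasonable p s.
Hypothesis Hmu : is_mu p s mu.

(** The point where the construction being reasonable enters: spacer starts in one B_k are
    negligible against h_k, as are overhangs, so only genuine occurrences remain. *)
Lemma occ_density W : forall eps, 0 < eps -> exists K, forall k, (K <= k)%nat -> (1 <= k)%nat ->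
  INR (occ W (Bw p s k)) + INR (length W) + INR (tmax p s k) <= (mu (cyl W) + eps) * INR (hgt p s k).
Proof.
  intros eps Heps. destruct Hmu as [_ Hocc].
  destruct (Hocc W (eps / 3) ltac:(lra)) as [K1 HK1].
  destruct (Hreas (eps / 3) ltac:(lra)) as [K2 HK2].
  destruct (nat_above (INR (length W) / (eps / 3))) as (K3 & _ & HK3).
  exists (S (K1 + K2 + K3)). intros k HkK Hk.
  destruct k as [|k]; [lia|].
  specialize (HK1 k ltac:(lia)). specialize (HK2 k ltac:(lia)). unfold R_dist in *.
  pose proof (INR_ge1 _ (hgt_ge p s Hp (S k) ltac:(lia))) as Hh.
  pose proof (hgt_ge_id p s Hp (S k) ltac:(lia)) as Hid. apply le_INR in Hid.
  assert (INR K3 <= INR (S k)) by (apply le_INR; lia).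
  set (h := INR (hgt p s (S k))) in *.
  apply Rabs_def2 in HK1. apply Rabs_def2 in HK2.
  assert (E1 : INR (occ W (Bw p s (S k))) <= (mu (cyl W) + eps / 3) * h).
  { replace (INR (occ W (Bw p s (S k)))) with (INR (occ W (Bw p s (S k))) / h * h) by (field; lra).
    apply Rmult_le_compat_r; lra. }
  assert (E2 : INR (tmax p s (S k)) <= eps / 3 * h).
  { replace (INR (tmax p s (S k))) with (INR (tmax p s (S k)) / h * h) by (field; lra).
    apply Rmult_le_compat_r; lra. }
  assert (E3 : INR (length W) <= eps / 3 * h).
  { replace (INR (length W)) with (eps / 3 * (INR (length W) / (eps / 3))) by (field; lra).
    apply Rmult_le_compat_l; lra. }
  lra.
Qed.

Lemma mu_cyl_nonneg W : 0 <= mu (cyl W).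
Proof.
  destruct Hmu as [_ Hocc]. apply Rnot_lt_le. intros Hlt.
  destruct (Hocc W (- mu (cyl W)) ltac:(lra)) as [K HK]. specialize (HK K ltac:(lia)).
  unfold R_dist in HK. apply Rabs_def2 in HK.
  assert (0 <= INR (occ W (Bw p s (S K))) / INR (hgt p s (S K))).
  { apply Rmult_le_pos; [apply pos_INR|]. left. apply Rinv_0_lt_compat, lt_0_INR.
    pose proof (hgt_ge p s Hp (S K) ltac:(lia)). lia. }
  lra.
Qed.

(* The scale k of the blocks used up to time N is chosen with
   h_k <= sqrt (N (1 + max_{n <= N} |M(n)|)) < h_{k+1}: the blocks B_k are short compared to N,
   while the number of gaps of level > k times max |M| is still o(N). *)
Lemma block_indicators w : inOmega p s w -> exists e : nat -> nat -> bool,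
  (forall N n, e N n = true -> (n <= N)%nat) /\
  (forall N n, (n <= N)%nat -> e N n = false -> w (Z.of_nat n) = true) /\
  (forall eps, 0 < eps -> exists N0, forall N, (N0 <= N)%nat -> variation (e N) N * (1 + MertMax N) <= eps * INR N) /\
  (forall W eps, 0 < eps -> exists N0, forall N, (N0 <= N)%nat ->
     sm (fun n => iv (e N n) * cyl W (shiftn n w)) N <= (mu (cyl W) + eps) * INR N).
Proof.
  intros Hw.
  set (X := fun N => sqrt (INR N * (1 + MertMax N))).
  assert (Hk : forall N, exists k, (1 <= k)%nat /\ ((1 <= N)%nat -> INR (hgt p s k) <= X N < INR (hgt p s (S k)))).
  { intros N. destruct N as [|N']; [exists 1%nat; split; lia|].
    destruct (hgt_bracket (X (S N'))) as (k & Hk1 & Hk2); [|eauto].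
    unfold X. apply Rle_trans with (sqrt 1); [rewrite sqrt_1; lra|]. apply sqrt_le_1; try lra.
    - pose proof (pos_INR (S N')). pose proof (MertMax_nonneg (S N')). apply Rmult_le_pos; lra.
    - pose proof (INR_ge1 (S N') ltac:(lia)). pose proof (MertMax_nonneg (S N')).
      apply Rle_trans with (1 * 1); [lra|apply Rmult_le_compat; lra]. }
  apply choice in Hk. destruct Hk as [k Hk].
  assert (He : forall N, exists e : nat -> bool,
    (forall n, e n = true -> (n <= N)%nat) /\
    (forall n, (n <= N)%nat -> e n = false -> w (Z.of_nat n) = true) /\
    variation e N <= 2 * (INR N / INR (hgt p s (S (k N)))) + 4 /\
    (forall W, (length W <= N)%nat -> sm (fun n => iv (e n) * cyl W (shiftn n w)) N <=
      (INR (occ W (Bw p s (k N))) + INR (length W) + INR (tmax p s (k N))) * (INR N / INR (hgt p s (k N)) + 3))).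
  { intros N. apply block_indicator; auto. apply Hk. }
  apply choice in He. destruct He as [e He]. exists e.
  assert (HXsq : forall N, X N * X N = INR N * (1 + MertMax N)).
  { intros N. apply sqrt_sqrt. pose proof (pos_INR N). pose proof (MertMax_nonneg N). apply Rmult_le_pos; lra. }
  (* [X N] is the geometric mean of N and 1 + max |M|. Since max |M| = o(N), it is negligible
     against N and yet dominates 1 + max |M|. *)
  assert (HXs : forall eps, 0 < eps -> exists N0, forall N, (N0 <= N)%nat -> X N <= eps * INR N /\ 1 + MertMax N <= eps * X N).
  { intros eps Heps.
    set (d := eps * eps / 2). assert (Hd : 0 < d) by (unfold d; nra).
    destruct (MertMax_little_o d Hd) as [N1 HN1].
    destruct (nat_above (1 / d)) as (N2 & HN2 & HN2').
    exists (N1 + N2)%nat. intros N HN. specialize (HN1 N ltac:(lia)).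
    assert (HN2N : INR N2 <= INR N) by (apply le_INR; lia).
    assert (H1 : 1 <= d * INR N).
    { replace 1 with (d * (1 / d)) by (field; lra). apply Rmult_le_compat_l; lra. }
    assert (H2 : 1 + MertMax N <= eps * eps * INR N) by (unfold d in *; lra).
    pose proof (INR_ge1 N ltac:(lia)) as HN1'. pose proof (MertMax_nonneg N) as HM.
    specialize (HXsq N). assert (HX0 : 0 <= X N) by apply sqrt_pos.
    split.
    - apply Rnot_lt_le. intros Hlt. assert (0 <= eps * INR N) by (apply Rmult_le_pos; lra).
      assert (eps * INR N * (eps * INR N) < X N * X N) by (apply Rmult_le_0_lt_compat; lra).
      assert (INR N * (1 + MertMax N) <= INR N * (eps * eps * INR N)) by (apply Rmult_le_compat_l; lra). lra.
    - apply Rnot_lt_le. intros Hlt.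
      assert ((1 + MertMax N) * (1 + MertMax N) <= eps * eps * INR N * (1 + MertMax N)) by (apply Rmult_le_compat_r; lra).
      assert (0 <= eps * X N) by (apply Rmult_le_pos; lra).
      assert (eps * X N * (eps * X N) < (1 + MertMax N) * (1 + MertMax N)) by (apply Rmult_le_0_lt_compat; lra).
      replace (eps * X N * (eps * X N)) with (eps * eps * (X N * X N)) in * by ring. rewrite HXsq in *. lra. }
  split; [|split; [|split]].
  - intros N. apply He.
  - intros N. apply He.
  - intros eps Heps. destruct (HXs (eps / 8)) as [N0 HN0]; [lra|].
    destruct (HXs (Rmin 1 (eps / 8))) as [N1 HN1]; [apply Rmin_pos; lra|].
    exists (S (N0 + N1)). intros N HN. specialize (HN0 N ltac:(lia)). specialize (HN1 N ltac:(lia)).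
    destruct (He N) as (_ & _ & HV & _). destruct (Hk N) as [_ Hk2]. specialize (Hk2 ltac:(lia)).
    pose proof (INR_ge1 N ltac:(lia)) as HN1'. pose proof (MertMax_nonneg N) as HM.
    assert (HX0 : 0 < X N) by (apply sqrt_lt_R0, Rmult_lt_0_compat; lra).
    pose proof (Rmin_l 1 (eps / 8)). pose proof (Rmin_r 1 (eps / 8)).
    assert (Q1 : INR N / INR (hgt p s (S (k N))) <= INR N / X N).
    { apply Rmult_le_compat_l; [lra|]. apply Rinv_le_contravar; lra. }
    assert (Q2 : INR N / X N * (1 + MertMax N) = X N).
    { apply (Rmult_eq_reg_r (X N)); [|lra]. rewrite HXsq. field. lra. }
    assert (Q3 : X N <= INR N * 1).
    { destruct HN1 as [HN1 _]. assert (Rmin 1 (eps / 8) * INR N <= 1 * INR N) by (apply Rmult_le_compat_r; lra). lra. }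
    apply Rle_trans with ((2 * (INR N / X N) + 4) * (1 + MertMax N)); [apply Rmult_le_compat_r; lra|].
    assert (Q4 : eps / 8 * X N <= eps / 8 * INR N) by (apply Rmult_le_compat_l; lra). lra.
  - intros W eps Heps. destruct (occ_density W (eps / 2) ltac:(lra)) as [K HK].
    pose proof (mu_cyl_nonneg W) as Hm.
    set (A := mu (cyl W) + eps / 2) in *. assert (HA : 0 < A) by (unfold A; lra).
    destruct (HXs (eps / (6 * A))) as [N0 HN0]; [apply Rdiv_lt_0_compat; lra|].
    destruct (nat_above (INR (hgt p s (S K)) * INR (hgt p s (S K)))) as (N1 & _ & HN1).
    exists (S (N0 + N1 + length W)). intros N HN. destruct (HN0 N ltac:(lia)) as [HX _].
    destruct (He N) as (_ & _ & _ & HC). specialize (HC W ltac:(lia)).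
    destruct (Hk N) as [Hk1 Hk2]. specialize (Hk2 ltac:(lia)).
    pose proof (INR_ge1 N ltac:(lia)) as HN1'. pose proof (MertMax_nonneg N) as HM.
    assert (INR N1 <= INR N) by (apply le_INR; lia).
    pose proof (INR_ge1 _ (hgt_ge p s Hp (S K) ltac:(lia))) as HhK.
    assert (HX0 : 0 <= X N) by apply sqrt_pos.
    (* The chosen level tends to infinity because h_{k+1} > [X N] >= sqrt N. *)
    assert (HKk : (K <= k N)%nat).
    { apply Nat.nlt_ge. intros Hlt.
      assert (Hm1 : (hgt p s (S (k N)) <= hgt p s (S K))%nat) by (apply hgt_mono; lia).
      apply le_INR in Hm1. specialize (HXsq N). nra. }
    specialize (HK (k N) HKk Hk1).
    pose proof (INR_ge1 _ (hgt_ge p s Hp (k N) Hk1)) as Hh.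
    set (h := INR (hgt p s (k N))) in *.
    eapply Rle_trans; [exact HC|].
    assert (Hq : 0 <= INR N / h + 3).
    { assert (0 <= INR N / h); [|lra]. apply Rmult_le_pos; [lra|]. left; apply Rinv_0_lt_compat; lra. }
    apply Rle_trans with (A * h * (INR N / h + 3)); [apply Rmult_le_compat_r; auto|].
    replace (A * h * (INR N / h + 3)) with (A * INR N + 3 * A * h) by (field; lra).
    assert (3 * A * h <= 3 * A * (eps / (6 * A) * INR N)) by (apply Rmult_le_compat_l; lra).
    replace (3 * A * (eps / (6 * A) * INR N)) with (eps / 2 * INR N) in * by (field; lra).
    unfold A in *. lra.
Qed.
End Blocks.

(** * Limits along ultrafilters *)

Record ultra (U : (nat -> Prop) -> Prop) : Prop := {
  u_up : forall P Q : nat -> Prop, (forall n, P n -> Q n) -> U P -> U Q;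
  u_and : forall P Q, U P -> U Q -> U (fun n => P n /\ Q n);
  u_ne : forall P, U P -> exists n, P n;
  u_or : forall P, U P \/ U (fun n => ~ P n);
  u_tail : forall k, U (fun n => (k <= n)%nat) }.

(** The ultrafilter can be made to live on the times N at which the desired estimate fails, and
    along it the averages of all continuous functions converge simultaneously, with no extraction of
    subsequences. *)
Lemma ultra_exists (S : nat -> Prop) : (forall n, exists m, (n <= m)%nat /\ S m) ->
  exists U, ultra U /\ U S.
Proof.
  intros HS.
  set (F := fun P : nat -> Prop => exists k, forall n, (k <= n)%nat -> S n -> P n).
  assert (HF : filter.ProperFilter F).
  { constructor.
    - intros [k Hk]. destruct (HS k) as (m & Hm & Sm). exact (Hk m Hm Sm).
    - constructor.
      + exists 0%nat. intros; exact I.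
      + intros P Q [k Hk] [l Hl]. exists (max k l). intros n Hn Sn. split; [apply Hk|apply Hl]; auto; lia.
      + intros P Q HPQ [k Hk]. exists k. intros n Hn Sn. apply HPQ. apply Hk; auto. }
  destruct (@filter.ultraFilterLemma nat F HF) as (U & HU & HFU).
  pose proof (@filter.ultra_proper _ _ HU) as HP.
  pose proof (@filter.filter_filter _ _ HP) as HFil.
  exists U. split.
  - constructor.
    + intros P Q H HPu. exact (@filter.filterS _ _ HFil P Q H HPu).
    + intros P Q H1 H2. exact (@filter.filterI _ _ HFil P Q H1 H2).
    + intros P HPu. apply NNPP. intros Hno. apply (@filter.filter_not_empty _ _ HP).
      refine (@filter.filterS _ _ HFil P _ _ HPu). intros n Pn. exfalso; apply Hno; exists n; exact Pn.
    + intros P. exact (@filter.in_ultra_setVsetC nat U P HU).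
    + intros k. apply HFU. exists k. auto.
  - apply HFU. exists 0%nat. auto.
Qed.

Section Ulim.
Variable U : (nat -> Prop) -> Prop.
Hypothesis HU : ultra U.

Lemma u_all (P : nat -> Prop) : (forall n, P n) -> U P.
Proof. intros H. apply (u_up U HU (fun n => (0 <= n)%nat)); auto. apply u_tail; auto. Qed.

Lemma u_and_up (P Q R : nat -> Prop) : (forall n, P n -> Q n -> R n) -> U P -> U Q -> U R.
Proof.
  intros H HP HQ. apply (u_up U HU (fun n => P n /\ Q n)); [intros n []; auto|apply u_and; auto].
Qed.

Lemma u_bounded_forall (P : nat -> nat -> Prop) K :
  (forall k, (k < K)%nat -> U (P k)) -> U (fun n => forall k, (k < K)%nat -> P k n).
Proof.
  induction K as [|K IH]; intros H.
  - apply u_all. intros n k Hk; lia.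
  - apply (u_and_up (fun n => forall k, (k < K)%nat -> P k n) (P K)); auto.
    intros n H1 H2 k Hk. destruct (Nat.eq_dec k K) as [->|]; auto. apply H1; lia.
Qed.

Definition is_ulim (u : nat -> R) (l : R) : Prop :=
  forall eps, 0 < eps -> U (fun n => Rabs (u n - l) < eps).

(** Total, because a joining is a functional on all functions; the value is meaningful once a limit
    exists, for which boundedness suffices. *)
Definition ulim (u : nat -> R) : R := epsilon (inhabits 0) (is_ulim u).

Lemma is_ulim_le u v l m : is_ulim u l -> is_ulim v m -> U (fun n => u n <= v n) -> l <= m.
Proof.
  intros Hu Hv H. apply Rnot_lt_le. intros Hlt.
  specialize (Hu ((l - m) / 2) ltac:(lra)). specialize (Hv ((l - m) / 2) ltac:(lra)).
  destruct (u_ne U HU _ (u_and U HU _ _ H (u_and U HU _ _ Hu Hv))) as (n & H1 & H2 & H3).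
  apply Rabs_def2 in H2. apply Rabs_def2 in H3. lra.
Qed.

Lemma is_ulim_unique u l m : is_ulim u l -> is_ulim u m -> l = m.
Proof.
  intros H1 H2. apply Rle_antisym; eapply is_ulim_le; eauto; apply u_all; intros; lra.
Qed.

Lemma is_ulim_ulim u l : is_ulim u l -> ulim u = l.
Proof.
  intros H. apply (is_ulim_unique u); auto. apply (epsilon_spec (inhabits 0) (is_ulim u)). eauto.
Qed.

Lemma is_ulim_ext u v l : U (fun n => u n = v n) -> is_ulim u l -> is_ulim v l.
Proof.
  intros H Hu eps Heps. apply (u_and_up _ _ _ (fun n (H1 : u n = v n) H2 => eq_ind _ (fun t => Rabs (t - l) < eps) H2 _ H1) H).
  apply Hu; auto.
Qed.

Lemma is_ulim_exists u B : (forall n, Rabs (u n) <= B) -> exists l, is_ulim u l.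
Proof.
  intros HB.
  assert (HB0 : 0 <= B) by (eapply Rle_trans; [apply Rabs_pos|apply (HB 0%nat)]).
  destruct (completeness (fun r => U (fun n => r <= u n))) as (l & Hl1 & Hl2).
  - exists B. intros r Hr. destruct (u_ne U HU _ Hr) as [n Hn].
    specialize (HB n). apply Rabs_le_inv in HB. lra.
  - exists (- B). apply u_all. intros n. specialize (HB n). apply Rabs_le_inv in HB. lra.
  - exists l. intros eps Heps.
    assert (H1 : U (fun n => l - eps < u n)).
    { apply NNPP. intros Hno. assert (l <= l - eps); [|lra].
      apply Hl2. intros r Hr. apply Rnot_lt_le. intros Hlt. apply Hno.
      apply (u_up U HU _ _ (fun n (H : r <= u n) => Rlt_le_trans _ _ _ Hlt H) Hr). }
    assert (H2 : U (fun n => u n < l + eps)).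
    { destruct (u_or U HU (fun n => l + eps <= u n)) as [H|H].
      - apply Hl1 in H. lra.
      - revert H. apply u_up; auto. intros n H. apply Rnot_le_lt; auto. }
    revert H1 H2. apply u_and_up. intros n Ha Hb. apply Rabs_def1; lra.
Qed.

Lemma ulim_spec u B : (forall n, Rabs (u n) <= B) -> is_ulim u (ulim u).
Proof.
  intros HB. apply (epsilon_spec (inhabits 0) (is_ulim u)). eapply is_ulim_exists; eauto.
Qed.

Lemma is_ulim_const c : is_ulim (fun _ => c) c.
Proof. intros eps Heps. apply u_all. intros _. rewrite Rminus_diag, Rabs_R0. auto. Qed.

Lemma is_ulim_lin a b u v l m : is_ulim u l -> is_ulim v m ->
  is_ulim (fun n => a * u n + b * v n) (a * l + b * m).
Proof.
  intros Hu Hv eps Heps. set (d := eps / (2 * (Rabs a + Rabs b + 1))).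
  pose proof (Rabs_pos a). pose proof (Rabs_pos b).
  assert (Hd : 0 < d) by (apply Rdiv_lt_0_compat; lra).
  assert (Hde : d * (2 * (Rabs a + Rabs b + 1)) = eps) by (unfold d; field; lra).
  generalize (Hu d Hd) (Hv d Hd). apply u_and_up. intros n H1 H2.
  replace (a * u n + b * v n - (a * l + b * m)) with (a * (u n - l) + b * (v n - m)) by ring.
  eapply Rle_lt_trans; [apply Rabs_triang|]. rewrite !Rabs_mult. nra.
Qed.

Lemma is_ulim_cv u l : Un_cv u l -> is_ulim u l.
Proof.
  intros H eps Heps. destruct (H eps Heps) as [k Hk].
  apply (u_up U HU (fun n => (k <= n)%nat)); [|apply u_tail; auto]. intros n Hn. apply Hk; auto.
Qed.

Lemma is_ulim_squeeze0 u v : is_ulim v 0 -> U (fun n => Rabs (u n) <= v n) -> is_ulim u 0.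
Proof.
  intros Hv H eps Heps. generalize H (Hv eps Heps). apply u_and_up. intros n H1 H2.
  rewrite Rminus_0_r in *. apply Rabs_def2 in H2. lra.
Qed.

(** The coordinatewise limit of points along U; on any finite window it agrees with U-almost all of
    them. This is the form in which compactness of Omega is used. *)
Definition seqlim (x : nat -> seqZ) : seqZ :=
  fun j => if excluded_middle_informative (U (fun n => x n j = true)) then true else false.

Lemma seqlim_coord x j : U (fun n => x n j = seqlim x j).
Proof.
  unfold seqlim. destruct excluded_middle_informative as [H|H]; auto.
  destruct (u_or U HU (fun n => x n j = true)) as [H'|H']; [contradiction|].
  revert H'. apply u_up; auto. intros n. destruct (x n j); auto. intros Hn; exfalso; apply Hn; auto.
Qed.

Lemma seqlim_range x a len : U (fun n => forall j, (a <= j < a + Z.of_nat len)%Z -> x n j = seqlim x j).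
Proof.
  pose proof (u_bounded_forall (fun k n => x n (a + Z.of_nat k)%Z = seqlim x (a + Z.of_nat k)%Z) len
    (fun k _ => seqlim_coord x _)) as H.
  revert H. apply u_up; auto. intros n H j Hj.
  specialize (H (Z.to_nat (j - a)) ltac:(lia)). rewrite Z2Nat.id in H by lia.
  replace (a + (j - a))%Z with j in H by lia. exact H.
Qed.

Lemma window_ext x y a len : (forall j, (a <= j < a + Z.of_nat len)%Z -> x j = y j) ->
  window x a len = window y a len.
Proof.
  intros H. apply map_ext_in. intros k Hk. apply in_seq in Hk. apply H. lia.
Qed.

Lemma seqlim_agree x k : U (fun n => agree k (x n) (seqlim x)).
Proof.
  pose proof (seqlim_range x (- Z.of_nat k) (2 * k + 1)) as H. revert H.
  apply u_up; auto. intros n H j Hj. apply H. lia.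
Qed.

Variables (p : nat -> nat) (s : nat -> nat -> nat).

Lemma seqlim_inOmega x : (forall n, inOmega p s (x n)) -> inOmega p s (seqlim x).
Proof.
  intros H a len. destruct (u_ne U HU _ (seqlim_range x a len)) as [n Hn].
  rewrite <- (window_ext (x n)) by auto. apply H.
Qed.
End Ulim.

Lemma ultra_nat : exists U, ultra U.
Proof.
  destruct (ultra_exists (fun _ => True)) as (U & HU & _); [|eauto].
  intros n; exists n; auto.
Qed.

(** * Compactness of Omega and continuous functions *)

Lemma agree_sym k x y : agree k x y -> agree k y x.
Proof. intros H j Hj. symmetry; auto. Qed.

Lemma agree_trans k x y z : agree k x y -> agree k y z -> agree k x z.
Proof. intros H1 H2 j Hj. rewrite H1; auto. Qed.

Lemma agree_le k l x y : (k <= l)%nat -> agree l x y -> agree k x y.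
Proof. intros H1 H2 j Hj. apply H2. lia. Qed.

Section Compact.
Variables (p : nat -> nat) (s : nat -> nat -> nat).

Lemma contO_uniform f : contO p s f -> forall eps, 0 < eps -> exists k, forall x y,
  inOmega p s x -> inOmega p s y -> agree k x y -> Rabs (f x - f y) < eps.
Proof.
  intros Hf eps Heps. apply NNPP. intros Hno.
  assert (H : forall k, exists xy : seqZ * seqZ, inOmega p s (fst xy) /\ inOmega p s (snd xy) /\
     agree k (fst xy) (snd xy) /\ eps <= Rabs (f (fst xy) - f (snd xy))).
  { intros k. apply NNPP. intros H. apply Hno. exists k. intros x y Hx Hy Hxy.
    apply Rnot_le_lt. intros Hle. apply H. exists (x, y). auto. }
  apply choice in H. destruct H as [xy H].
  destruct ultra_nat as [U HU]. set (x := fun k => fst (xy k)).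
  assert (Hl : inOmega p s (seqlim U x)) by (apply seqlim_inOmega; auto; intros; apply H).
  destruct (Hf _ Hl (eps / 2) ltac:(lra)) as [k Hk].
  destruct (u_ne U HU _ (u_and U HU _ _ (seqlim_agree U HU x k) (u_tail U HU k))) as (n & H1 & H2).
  destruct (H n) as (P1 & P2 & P3 & P4).
  assert (Q1 : Rabs (f (fst (xy n)) - f (seqlim U x)) < eps / 2).
  { apply Hk; auto. apply agree_sym; auto. }
  assert (Q2 : Rabs (f (snd (xy n)) - f (seqlim U x)) < eps / 2).
  { apply Hk; auto. apply agree_trans with (fst (xy n)); [apply agree_sym; auto|].
    apply (agree_le k n); auto. }
  apply Rabs_def2 in Q1. apply Rabs_def2 in Q2.
  assert (Rabs (f (fst (xy n)) - f (snd (xy n))) < eps) by (apply Rabs_def1; lra). lra.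
Qed.

Lemma contO2_bounded F : contO2 p s F -> exists B, 0 <= B /\ forall z,
  inOmega p s (fst z) -> inOmega p s (snd z) -> Rabs (F z) <= B.
Proof.
  intros HF. apply NNPP. intros Hno.
  assert (H : forall k : nat, exists z : seqZ * seqZ, inOmega p s (fst z) /\ inOmega p s (snd z) /\ INR k < Rabs (F z)).
  { intros k. apply NNPP. intros H. apply Hno. exists (INR k). split; [apply pos_INR|]. intros z H1 H2.
    apply Rnot_lt_le. intros Hlt. apply H. eauto. }
  apply choice in H. destruct H as [z H].
  destruct ultra_nat as [U HU].
  set (l := (seqlim U (fun k => fst (z k)), seqlim U (fun k => snd (z k)))).
  destruct (HF l) with (eps := 1) as [k Hk]; [| |lra|].
  1,2: apply seqlim_inOmega; auto; intros n; apply H.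
  destruct (nat_above (Rabs (F l) + 1)) as (m & _ & Hm).
  destruct (u_ne U HU _ (u_and U HU _ _ (seqlim_agree U HU (fun k => fst (z k)) k)
    (u_and U HU _ _ (seqlim_agree U HU (fun k => snd (z k)) k) (u_tail U HU m)))) as (n & H1 & H2 & H3).
  destruct (H n) as (P1 & P2 & P3).
  assert (Q : Rabs (F (z n) - F l) < 1) by (apply Hk; auto; apply agree_sym; auto).
  apply le_INR in H3. pose proof (Rabs_triang (F (z n) - F l) (F l)) as T.
  replace (F (z n) - F l + F l) with (F (z n)) in T by ring. lra.
Qed.

Lemma contO2_fst f : contO p s f -> contO2 p s (fun z => f (fst z)).
Proof.
  intros Hf z H1 H2 eps Heps. destruct (Hf _ H1 eps Heps) as [k Hk]. exists k. intros; auto.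
Qed.

Lemma contO2_snd f : contO p s f -> contO2 p s (fun z => f (snd z)).
Proof.
  intros Hf z H1 H2 eps Heps. destruct (Hf _ H2 eps Heps) as [k Hk]. exists k. intros; auto.
Qed.

Lemma contO2_diag F : contO2 p s F -> contO p s (fun x => F (x, x)).
Proof.
  intros HF x Hx eps Heps. destruct (HF (x, x) Hx Hx eps Heps) as [k Hk]. exists k.
  intros y Hy Hxy. apply Hk; auto.
Qed.

Lemma contO2_lin F G a b : contO2 p s F -> contO2 p s G -> contO2 p s (fun z => a * F z + b * G z).
Proof.
  intros HF HG z H1 H2 eps Heps. set (d := eps / (2 * (Rabs a + Rabs b + 1))).
  pose proof (Rabs_pos a). pose proof (Rabs_pos b).
  assert (Hd : 0 < d) by (apply Rdiv_lt_0_compat; lra).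
  assert (Hde : d * (2 * (Rabs a + Rabs b + 1)) = eps) by (unfold d; field; lra).
  destruct (HF z H1 H2 d Hd) as [k Hk]. destruct (HG z H1 H2 d Hd) as [l Hl].
  exists (max k l). intros z' H1' H2' A1 A2.
  specialize (Hk z' H1' H2' (agree_le _ _ _ _ (Nat.le_max_l k l) A1) (agree_le _ _ _ _ (Nat.le_max_l k l) A2)).
  specialize (Hl z' H1' H2' (agree_le _ _ _ _ (Nat.le_max_r k l) A1) (agree_le _ _ _ _ (Nat.le_max_r k l) A2)).
  replace (a * F z' + b * G z' - (a * F z + b * G z)) with (a * (F z' - F z) + b * (G z' - G z)) by ring.
  eapply Rle_lt_trans; [apply Rabs_triang|]. rewrite !Rabs_mult. nra.
Qed.

Lemma contO2_mult F G : contO2 p s F -> contO2 p s G -> contO2 p s (fun z => F z * G z).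
Proof.
  intros HF HG z H1 H2 eps Heps.
  set (A := Rabs (F z) + Rabs (G z) + 1). pose proof (Rabs_pos (F z)). pose proof (Rabs_pos (G z)).
  set (d := Rmin 1 (eps / (2 * A))).
  assert (Hd : 0 < d).
  { unfold d. apply Rmin_pos; [lra|]. apply Rdiv_lt_0_compat; unfold A; lra. }
  assert (Hd1 : d <= 1) by apply Rmin_l.
  assert (HdA : d * (2 * A) <= eps).
  { apply Rle_trans with (eps / (2 * A) * (2 * A)); [apply Rmult_le_compat_r; [unfold A; lra|apply Rmin_r]|].
    right; field. unfold A; lra. }
  destruct (HF z H1 H2 d Hd) as [k Hk]. destruct (HG z H1 H2 d Hd) as [l Hl].
  exists (max k l). intros z' H1' H2' A1 A2.
  specialize (Hk z' H1' H2' (agree_le _ _ _ _ (Nat.le_max_l k l) A1) (agree_le _ _ _ _ (Nat.le_max_l k l) A2)).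
  specialize (Hl z' H1' H2' (agree_le _ _ _ _ (Nat.le_max_r k l) A1) (agree_le _ _ _ _ (Nat.le_max_r k l) A2)).
  replace (F z' * G z' - F z * G z) with
    ((F z' - F z) * (G z' - G z) + F z * (G z' - G z) + (F z' - F z) * G z) by ring.
  eapply Rle_lt_trans; [apply Rabs_triang|]. eapply Rle_lt_trans; [apply Rplus_le_compat_r, Rabs_triang|].
  rewrite !Rabs_mult. pose proof (Rabs_pos (F z' - F z)). pose proof (Rabs_pos (G z' - G z)).
  unfold A in *. nra.
Qed.

Lemma contO_lin f g a b : contO p s f -> contO p s g -> contO p s (fun x => a * f x + b * g x).
Proof.
  intros Hf Hg. exact (contO2_diag _ (contO2_lin _ _ a b (contO2_fst f Hf) (contO2_fst g Hg))).
Qed.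

Lemma contO_mult f g : contO p s f -> contO p s g -> contO p s (fun x => f x * g x).
Proof.
  intros Hf Hg. exact (contO2_diag _ (contO2_mult _ _ (contO2_fst f Hf) (contO2_fst g Hg))).
Qed.

Lemma contO_const c : contO p s (fun _ => c).
Proof.
  intros x Hx eps Heps. exists 0%nat. intros. rewrite Rminus_diag, Rabs_R0; auto.
Qed.

Lemma contO_abs f : contO p s f -> contO p s (fun x => Rabs (f x)).
Proof.
  intros Hf x Hx eps Heps. destruct (Hf x Hx eps Heps) as [k Hk]. exists k. intros y Hy Hxy.
  eapply Rle_lt_trans; [apply Rabs_triang_inv2|]. auto.
Qed.

Lemma contO_bounded f : contO p s f -> exists B, 0 <= B /\ forall x, inOmega p s x -> Rabs (f x) <= B.
Proof.
  intros Hf. destruct (contO2_bounded _ (contO2_fst f Hf)) as (B & HB & H). exists B. split; auto.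
  intros x Hx. apply (H (x, x)); auto.
Qed.

Lemma window_shiftn n x a len : window (shiftn n x) a len = window x (a + Z.of_nat n) len.
Proof. apply map_ext. intros j. unfold shiftn. f_equal. lia. Qed.

Lemma inOmega_shiftn n x : inOmega p s x -> inOmega p s (shiftn n x).
Proof. intros H a len. rewrite window_shiftn. apply H. Qed.

Lemma agree_shiftn n k x y : agree (k + n) x y -> agree k (shiftn n x) (shiftn n y).
Proof. intros H j Hj. apply H. lia. Qed.

Lemma contO_shiftn n f : contO p s f -> contO p s (fun x => f (shiftn n x)).
Proof.
  intros Hf x Hx eps Heps. destruct (Hf _ (inOmega_shiftn n x Hx) eps Heps) as [k Hk].
  exists (k + n)%nat. intros y Hy Hxy. apply Hk; [apply inOmega_shiftn; auto|]. apply agree_shiftn; auto.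
Qed.

Lemma contO_sm (f : nat -> seqZ -> R) n : (forall i, contO p s (f i)) -> contO p s (fun x => sm (fun i => f i x) n).
Proof.
  intros H. induction n as [|n IH].
  - exact (contO_const 0).
  - replace (fun x => sm (fun i => f i x) (S n)) with (fun x => 1 * sm (fun i => f i x) n + 1 * f (S n) x).
    + apply contO_lin; auto.
    + apply functional_extensionality. intros x. rewrite sm_S. ring.
Qed.
End Compact.

(** * Functions of finitely many coordinates *)

(** Imposed on all sequences, not only on Omega, so that f may be evaluated at a padded word and at
    the constant sequence 1 seen inside gaps. *)
Definition one_sided (len : nat) (f : seqZ -> R) : Prop :=
  forall x y, (forall j, (0 <= j < Z.of_nat len)%Z -> x j = y j) -> f x = f y.

Definition local (k : nat) (f : seqZ -> R) : Prop := forall x y, agree k x y -> f x = f y.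

Definition lsum {A} (f : A -> R) (l : list A) : R := fold_right (fun a t => f a + t) 0 l.

Lemma lsum_app {A} (f : A -> R) l l' : lsum f (l ++ l') = lsum f l + lsum f l'.
Proof. induction l as [|a l IH]; simpl; [ring|]. rewrite IH; ring. Qed.

Lemma lsum_map {A B} (g : B -> A) (f : A -> R) l : lsum f (map g l) = lsum (fun b => f (g b)) l.
Proof. induction l as [|a l IH]; simpl; [ring|]. rewrite IH; ring. Qed.

Lemma lsum_ext {A} (f g : A -> R) l : (forall a, In a l -> f a = g a) -> lsum f l = lsum g l.
Proof.
  induction l as [|a l IH]; intros H; simpl; auto.
  rewrite H, IH; auto; [intros; apply H; right; auto|left; auto].
Qed.

Lemma lsum_0 {A} (f : A -> R) l : (forall a, In a l -> f a = 0) -> lsum f l = 0.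
Proof. intros H. rewrite (lsum_ext _ (fun _ => 0)) by auto. clear H. induction l; simpl; lra. Qed.

Fixpoint words (n : nat) : list (list bool) :=
  match n with
  | O => [[]]
  | S m => map (cons true) (words m) ++ map (cons false) (words m)
  end.

Lemma words_length n W : In W (words n) -> length W = n.
Proof.
  revert W. induction n as [|n IH]; simpl; intros W H.
  - destruct H as [<-|[]]; auto.
  - apply in_app_iff in H. destruct H as [H|H]; apply in_map_iff in H; destruct H as (V & <- & HV);
      simpl; rewrite (IH V HV); auto.
Qed.

Lemma lsum_words_pick (phi : list bool -> R) n V : length V = n ->
  lsum (fun W => phi W * (if list_eq_dec bool_dec V W then 1 else 0)) (words n) = phi V.
Proof.
  revert phi V. induction n as [|n IH]; intros phi V HV.
  - destruct V; [|discriminate]. simpl. ring.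
  - destruct V as [|b V]; [discriminate|]. simpl words. rewrite lsum_app, !lsum_map.
    assert (E : forall c, lsum (fun W => phi (c :: W) * (if list_eq_dec bool_dec (b :: V) (c :: W) then 1 else 0)) (words n)
       = if bool_dec b c then phi (b :: V) else 0).
    { intros c. destruct (bool_dec b c) as [<-|Hne].
      - rewrite <- (IH (fun W => phi (b :: W)) V) by (simpl in HV; lia). apply lsum_ext. intros W _.
        destruct (list_eq_dec bool_dec (b :: V) (b :: W)), (list_eq_dec bool_dec V W); congruence || (subst; auto).
      - apply lsum_0. intros W _. destruct list_eq_dec; [congruence|ring]. }
    rewrite !E. destruct b; simpl; ring.
Qed.

Definition unwin (W : list bool) : seqZ := fun j => nth (Z.to_nat j) W false.

Lemma unwin_window x len j : (0 <= j < Z.of_nat len)%Z -> unwin (window x 0 len) j = x j.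
Proof.
  intros Hj. unfold unwin, window.
  rewrite (nth_indep _ false (x (0 + Z.of_nat 0)%Z)) by (rewrite length_map, length_seq; lia).
  rewrite (map_nth (fun j => x (0 + Z.of_nat j)%Z)), seq_nth by lia. f_equal. lia.
Qed.

Lemma one_sided_expand len f : one_sided len f -> forall x,
  f x = lsum (fun W => f (unwin W) * cyl W x) (words len).
Proof.
  intros Hf x.
  rewrite (lsum_ext _ (fun W => f (unwin W) * (if list_eq_dec bool_dec (window x 0 len) W then 1 else 0))).
  - rewrite (lsum_words_pick (fun W => f (unwin W))).
    + apply Hf. intros j Hj. symmetry; apply unwin_window; auto.
    + unfold window. rewrite length_map, length_seq. reflexivity.
  - intros W HW. unfold cyl. rewrite (words_length _ _ HW). reflexivity.
Qed.

Lemma window_agree k x y : window x (- Z.of_nat k) (2 * k + 1) = window y (- Z.of_nat k) (2 * k + 1) -> agree k x y.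
Proof.
  intros E j Hj.
  assert (G : forall z, nth (Z.to_nat (j + Z.of_nat k)) (window z (- Z.of_nat k) (2 * k + 1)) false = z j).
  { intros z. unfold window. rewrite (nth_indep _ false (z (- Z.of_nat k + Z.of_nat 0)%Z)) by (rewrite length_map, length_seq; lia).
    rewrite (map_nth (fun j => z (- Z.of_nat k + Z.of_nat j)%Z)), seq_nth by lia. f_equal. lia. }
  rewrite <- (G x), <- (G y), E. reflexivity.
Qed.

Lemma one_sided_mono m n f : (m <= n)%nat -> one_sided m f -> one_sided n f.
Proof. intros H Hf x y Hxy. apply Hf. intros j Hj. apply Hxy. lia. Qed.

Lemma one_sided_shiftn n len f : one_sided len f -> one_sided (n + len) (fun x => f (shiftn n x)).
Proof. intros Hf x y Hxy. apply Hf. intros j Hj. unfold shiftn. apply Hxy. lia. Qed.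

Lemma local_shiftn k n f : (k <= n)%nat -> local k f -> one_sided (n + k + 1) (fun x => f (shiftn n x)).
Proof. intros H Hf x y Hxy. apply Hf. intros j Hj. unfold shiftn. apply Hxy. lia. Qed.

Lemma one_sided_sm len (f : nat -> seqZ -> R) n : (forall i, (1 <= i <= n)%nat -> one_sided len (f i)) ->
  one_sided len (fun x => sm (fun i => f i x) n).
Proof. intros H x y Hxy. apply sm_ext. intros i Hi. apply H; auto. Qed.

(** * Positive functionals on continuous functions *)

Section Measures.
Variables (p : nat -> nat) (s : nat -> nat -> nat).

Lemma contO_local k f : local k f -> contO p s f.
Proof.
  intros Hf x Hx eps Heps. exists k. intros y Hy Hxy. rewrite (Hf x y Hxy), Rminus_diag, Rabs_R0. auto.
Qed.

Lemma contO_one_sided len f : one_sided len f -> contO p s f.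
Proof.
  intros Hf. apply (contO_local len). intros x y Hxy. apply Hf. intros j Hj. apply Hxy. lia.
Qed.

Lemma contO_approx f eps : contO p s f -> 0 < eps -> exists k h, local k h /\
  forall x, inOmega p s x -> Rabs (f x - h x) <= eps.
Proof.
  intros Hf Heps. destruct (contO_uniform p s f Hf eps Heps) as [k Hk].
  (* The approximant reads the central window and evaluates f at a chosen point of Omega with that
     window. It is thus local on all sequences, whatever its values off Omega. *)
  set (P := fun (W : list bool) (y : seqZ) => inOmega p s y /\ window y (- Z.of_nat k) (2 * k + 1) = W).
  exists k, (fun x => f (epsilon (inhabits (fun _ => true)) (P (window x (- Z.of_nat k) (2 * k + 1))))).
  split.
  - intros x y Hxy. rewrite (window_ext x y); auto. intros j Hj. apply Hxy. lia.
  - intros x Hx. left.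
    destruct (epsilon_spec (inhabits (fun _ : Z => true)) (P (window x (- Z.of_nat k) (2 * k + 1)))) as [H1 H2].
    { exists x. split; auto. }
    apply Hk; auto. apply window_agree. symmetry. exact H2.
Qed.

Record posfun (nu : (seqZ -> R) -> R) : Prop := {
  pf_ext : forall f g, (forall x, inOmega p s x -> f x = g x) -> nu f = nu g;
  pf_lin : forall f g a b, contO p s f -> contO p s g -> nu (fun x => a * f x + b * g x) = a * nu f + b * nu g;
  pf_pos : forall f, contO p s f -> (forall x, inOmega p s x -> 0 <= f x) -> 0 <= nu f }.

Section Posfun.
Variable nu : (seqZ -> R) -> R.
Hypothesis Hnu : posfun nu.

Lemma pf_scal c f : contO p s f -> nu (fun x => c * f x) = c * nu f.
Proof.
  intros Hf. transitivity (nu (fun x => c * f x + 0 * f x)).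
  - apply (pf_ext nu Hnu). intros; ring.
  - rewrite (pf_lin nu Hnu) by auto. ring.
Qed.

Lemma pf_const c : nu (fun _ => c) = c * nu (fun _ => 1).
Proof.
  rewrite <- (pf_scal c (fun _ => 1)) by apply contO_const. apply (pf_ext nu Hnu). intros; ring.
Qed.

Lemma pf_minus f g : contO p s f -> contO p s g -> nu (fun x => f x - g x) = nu f - nu g.
Proof.
  intros Hf Hg. transitivity (nu (fun x => 1 * f x + (-1) * g x)).
  - apply (pf_ext nu Hnu). intros; ring.
  - rewrite (pf_lin nu Hnu) by auto. ring.
Qed.

Lemma contO_minus f g : contO p s f -> contO p s g -> contO p s (fun x => f x - g x).
Proof.
  intros Hf Hg. replace (fun x => f x - g x) with (fun x => 1 * f x + (-1) * g x).
  - apply contO_lin; auto.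
  - apply functional_extensionality; intros; ring.
Qed.

Lemma pf_mono f g : contO p s f -> contO p s g -> (forall x, inOmega p s x -> f x <= g x) -> nu f <= nu g.
Proof.
  intros Hf Hg H. assert (0 <= nu g - nu f); [|lra]. rewrite <- pf_minus by auto.
  apply (pf_pos nu Hnu); [apply contO_minus; auto|]. intros x Hx. specialize (H x Hx). lra.
Qed.

Lemma pf_close f g eps : contO p s f -> contO p s g -> (forall x, inOmega p s x -> Rabs (f x - g x) <= eps) ->
  Rabs (nu f - nu g) <= eps * nu (fun _ => 1).
Proof.
  intros Hf Hg H. rewrite <- pf_minus, <- pf_const by auto. apply Rabs_le. split.
  - replace (- nu (fun _ => eps)) with (nu (fun _ => - eps)) by (rewrite (pf_const (- eps)), (pf_const eps); ring).
    apply pf_mono; [apply contO_const|apply contO_minus; auto|]. intros x Hx. pose proof (Rabs_le_inv _ _ (H x Hx)). lra.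
  - apply pf_mono; [apply contO_minus; auto|apply contO_const|]. intros x Hx. pose proof (Rabs_le_inv _ _ (H x Hx)). lra.
Qed.

Lemma pf_abs f : contO p s f -> Rabs (nu f) <= nu (fun x => Rabs (f x)).
Proof.
  intros Hf. apply Rabs_le. split.
  - assert (- nu (fun x => Rabs (f x)) = nu (fun x => -1 * Rabs (f x))) as ->.
    { rewrite pf_scal by (apply contO_abs; auto). ring. }
    apply pf_mono; auto.
    + apply (contO_lin p s _ _ (-1) 0 (contO_abs p s f Hf)) in Hf as Hc.
      replace (fun x => -1 * Rabs (f x)) with (fun x => -1 * Rabs (f x) + 0 * f x); auto.
      apply functional_extensionality; intros; ring.
    + intros x Hx. pose proof (Rle_abs (- f x)). rewrite Rabs_Ropp in *. lra.
  - apply pf_mono; auto; [apply contO_abs; auto|]. intros; apply Rle_abs.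
Qed.

Lemma pf_sm (f : nat -> seqZ -> R) n : (forall i, contO p s (f i)) ->
  nu (fun x => sm (fun i => f i x) n) = sm (fun i => nu (f i)) n.
Proof.
  intros H. induction n as [|n IH].
  - change (nu (fun _ => 0) = 0). rewrite pf_const. ring.
  - rewrite sm_S, <- IH. transitivity (nu (fun x => 1 * sm (fun i => f i x) n + 1 * f (S n) x)).
    + apply (pf_ext nu Hnu). intros. rewrite sm_S. ring.
    + rewrite (pf_lin nu Hnu); auto; [ring|]. apply contO_sm; auto.
Qed.

Lemma pf_lsum {A} (c : A -> R) (f : A -> seqZ -> R) l : (forall i, contO p s (f i)) ->
  contO p s (fun x => lsum (fun i => c i * f i x) l) /\
  nu (fun x => lsum (fun i => c i * f i x) l) = lsum (fun i => c i * nu (f i)) l.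
Proof.
  intros H. induction l as [|a l [IH1 IH2]].
  - split; [exact (contO_const p s 0)|]. change (nu (fun _ => 0) = 0). rewrite pf_const. ring.
  - assert (E : (fun x => lsum (fun i => c i * f i x) (a :: l)) =
      (fun x => c a * f a x + 1 * lsum (fun i => c i * f i x) l)).
    { apply functional_extensionality. intros x. simpl. ring. }
    rewrite E. split; [apply contO_lin; auto|].
    rewrite (pf_lin nu Hnu) by auto. rewrite IH2. simpl. ring.
Qed.

Lemma shiftn_add m n x : shiftn m (shiftn n x) = shiftn (m + n) x.
Proof. apply functional_extensionality. intros j. unfold shiftn. f_equal. lia. Qed.

Lemma shiftn_0 x : shiftn 0 x = x.
Proof. apply functional_extensionality. intros j. unfold shiftn. f_equal. lia. Qed.

Lemma pf_shift_iter a : (forall f, contO p s f -> nu (fun x => f (shiftn a x)) = nu f) ->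
  forall j f, contO p s f -> nu (fun x => f (shiftn (a * j) x)) = nu f.
Proof.
  intros H j. induction j as [|j IH]; intros f Hf.
  - apply (pf_ext nu Hnu). intros x Hx. rewrite Nat.mul_0_r, shiftn_0. reflexivity.
  - rewrite <- (IH f Hf). rewrite <- (H (fun x => f (shiftn (a * j) x))) by (apply contO_shiftn; auto).
    apply (pf_ext nu Hnu). intros x Hx. rewrite shiftn_add. do 2 f_equal. lia.
Qed.
End Posfun.

Variable mu : (seqZ -> R) -> R.
Hypothesis Hmu : inv_prob p s mu.

Lemma mu_posfun : posfun mu.
Proof. destruct Hmu as [(H1 & H2 & H3 & _) _]. constructor; auto. Qed.

Lemma mu_1 : mu (fun _ => 1) = 1.
Proof. apply Hmu. Qed.

Lemma mu_shiftn n f : contO p s f -> mu (fun x => f (shiftn n x)) = mu f.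
Proof.
  intros Hf. pose proof (pf_shift_iter mu mu_posfun 1 (proj2 Hmu) n f Hf) as H.
  rewrite Nat.mul_1_l in H. exact H.
Qed.

Lemma contO_cyl W : contO p s (cyl W).
Proof.
  apply (contO_one_sided (length W)). intros x y Hxy. unfold cyl. rewrite (window_ext x y); auto.
Qed.

Lemma mu_one_sided len f : one_sided len f -> mu f = lsum (fun W => f (unwin W) * mu (cyl W)) (words len).
Proof.
  intros Hf. rewrite <- (proj2 (pf_lsum mu mu_posfun (fun W => f (unwin W)) cyl (words len) contO_cyl)).
  apply (pf_ext mu mu_posfun). intros x _. apply one_sided_expand; auto.
Qed.

(** * Ergodicity of powers from weak mixing *)

(** i - j + (j - i) is |i - j| in truncated subtraction; in row i a given lag occurs for at most the
    two indices i + d and i - d. The [pred] makes lag 0 appear in sums starting at 1. *)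
Lemma sm_toeplitz (D : nat -> R) K i : (1 <= i <= K)%nat -> (forall n, 0 <= D n) ->
  sm (fun j => D (i - j + (j - i))%nat) K <= 2 * sm (fun d => D (pred d)) K.
Proof.
  intros Hi HD.
  apply Rle_trans with (sm (fun j => sm (fun d => iv (Nat.eqb (i - j + (j - i)) (pred d)) * D (pred d)) K) K).
  - apply sm_le. intros j Hj.
    rewrite (sm_ext _ (fun d => iv (Nat.eqb (S (i - j + (j - i))) d) * D (pred d))).
    + rewrite (sm_pick (fun d => D (pred d))) by lia. simpl pred. lra.
    + intros d Hd. destruct (Nat.eqb_spec (i - j + (j - i)) (pred d)), (Nat.eqb_spec (S (i - j + (j - i))) d); auto; lia.
  - rewrite sm_swap, <- sm_scal. apply sm_le. intros d Hd. rewrite sm_scal_r.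
    apply Rmult_le_compat_r; auto.
    apply Rle_trans with (sm (fun j => iv (Nat.eqb (i + pred d) j) * 1 + iv (Nat.eqb (i - pred d) j) * 1) K).
    + apply sm_le. intros j Hj.
      destruct (Nat.eqb_spec (i - j + (j - i)) (pred d)), (Nat.eqb_spec (i + pred d) j), (Nat.eqb_spec (i - pred d) j);
        unfold iv; try lra; lia.
    + rewrite sm_plus.
      assert (Q : forall c, sm (fun j => iv (Nat.eqb c j) * 1) K <= 1).
      { intros c. destruct (le_lt_dec 1 c), (le_lt_dec c K).
        - rewrite (sm_pick (fun _ => 1)) by lia. lra.
        - rewrite (sm_pick_out (fun _ => 1)) by lia. lra.
        - rewrite (sm_pick_out (fun _ => 1)) by lia. lra.
        - rewrite (sm_pick_out (fun _ => 1)) by lia. lra. }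
      pose proof (Q (i + pred d)%nat). pose proof (Q (i - pred d)%nat). lra.
Qed.

Lemma sum_f_R0_sm f n : sum_f_R0 f n = sm (fun i => f (pred i)) (S n).
Proof. induction n as [|n IH]; [simpl; ring|]. rewrite sm_S, <- IH. reflexivity. Qed.

(** Passing from all lags to multiples of a only drops nonnegative terms. Cesaro decay along T
    therefore gives decay along T^a at the cost of a factor a, which is how weak mixing yields
    ergodicity of T^a. *)
Lemma sm_stride (D : nat -> R) a K : (1 <= a)%nat -> (forall n, 0 <= D n) ->
  sm (fun d => D (a * pred d)%nat) K <= sm (fun i => D (pred i)) (S (a * K)).
Proof.
  intros Ha HD.
  assert (P : forall n, sm (fun d => D (a * pred d)%nat) (S n) <= sm (fun i => D (pred i)) (S (a * n))).
  { induction n as [|n IH].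
    - rewrite Nat.mul_0_r. simpl. rewrite Nat.mul_0_r. lra.
    - rewrite sm_S, (sm_S (fun i => D (pred i)) (a * S n)). rewrite !Nat.pred_succ.
      apply Rplus_le_compat_r. eapply Rle_trans; [exact IH|]. apply sm_mono; [nia|auto]. }
  destruct K as [|K]; [apply sm_nonneg; auto|].
  eapply Rle_trans; [apply P|]. apply sm_mono; [nia|auto].
Qed.

Hypothesis Hwm : weakly_mixing p s mu.

Section Ergodic.
Variables (nu : (seqZ -> R) -> R) (a : nat).
Hypothesis Ha : (1 <= a)%nat.
Hypothesis Hnu : posfun nu.
Hypothesis Hinv : forall f, contO p s f -> nu (fun x => f (shiftn a x)) = nu f.
Hypothesis Hdom : forall len f, one_sided len f -> (forall x, 0 <= f x) -> nu f <= mu f.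

Lemma mu_corr f i j : contO p s f ->
  mu (fun x => f (shiftn (a * i) x) * f (shiftn (a * j) x)) =
  mu (fun x => f (shiftn (a * (i - j + (j - i))) x) * f x).
Proof.
  intros Hf.
  assert (G : forall m n, (m <= n)%nat -> mu (fun x => f (shiftn (a * n) x) * f (shiftn (a * m) x)) =
    mu (fun x => f (shiftn (a * (n - m)) x) * f x)).
  { intros m n Hmn. rewrite <- (mu_shiftn (a * m) (fun x => f (shiftn (a * (n - m)) x) * f x)).
    - apply (pf_ext mu mu_posfun). intros x Hx. rewrite shiftn_add. do 3 f_equal. nia.
    - apply contO_mult; auto. apply contO_shiftn; auto. }
  destruct (le_lt_dec i j) as [H|H].
  - replace (i - j + (j - i))%nat with (j - i)%nat by lia. rewrite <- (G i j H).
    apply (pf_ext mu mu_posfun). intros; ring.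
  - replace (i - j + (j - i))%nat with (i - j)%nat by lia. apply (G j i). lia.
Qed.

(* Von Neumann averaging: nu f = nu of the average of f along T^a, whose L^2(mu)-norm tends to 0. *)
Lemma nu_zero_mean len f : one_sided len f -> mu f = 0 -> nu f = 0.
Proof.
  intros Hf H0. pose proof (contO_one_sided len f Hf) as Hc.
  set (D := fun n => Rabs (mu (fun x => f (shiftn n x) * f x))).
  assert (HDn : forall n, 0 <= D n) by (intros; apply Rabs_pos).
  assert (Hcv : Un_cv (fun N => / INR (S N) * sum_f_R0 D N) 0).
  { pose proof (Hwm f f Hc Hc) as W. rewrite H0 in W.
    replace (fun N => / INR (S N) * sum_f_R0 D N) with
      (fun N => / INR (S N) * sum_f_R0 (fun n => Rabs (mu (fun x => f (shiftn n x) * f x) - 0 * 0)) N); auto.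
    apply functional_extensionality. intros N. f_equal. f_equal.
    apply functional_extensionality. intros n. unfold D. f_equal. ring. }
  assert (Hsmall : forall eps, 0 < eps -> Rabs (nu f) <= eps).
  { intros eps Heps. pose proof (INR_ge1 a Ha) as Ha1.
    (* Chosen so that the bound for mu(g^2), namely K times 2 eta times 2 a K, equals (eps K)^2. *)
    set (eta := eps * eps / (4 * INR a)).
    assert (Heta : 0 < eta) by (apply Rdiv_lt_0_compat; nra).
    destruct (Hcv eta Heta) as [K0 HK0]. set (K := S K0).
    pose proof (INR_ge1 K ltac:(unfold K; lia)) as HK1.
    specialize (HK0 (a * K)%nat ltac:(unfold K; nia)). unfold R_dist in HK0. rewrite Rminus_0_r in HK0.
    apply Rabs_def2 in HK0. destruct HK0 as [HK0 _].
    assert (HS : sum_f_R0 D (a * K) <= eta * INR (S (a * K))).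
    { assert (0 < INR (S (a * K))) by (apply lt_0_INR; lia).
      apply (Rmult_le_reg_l (/ INR (S (a * K)))); [apply Rinv_0_lt_compat; auto|].
      replace (/ INR (S (a * K)) * (eta * INR (S (a * K)))) with eta by (field; lra). lra. }
    set (g := fun x => sm (fun j => f (shiftn (a * j) x)) K).
    assert (Hgo : one_sided (a * K + len) g).
    { apply one_sided_sm. intros i Hi. apply (one_sided_mono (a * i + len)); [nia|].
      apply one_sided_shiftn; auto. }
    pose proof (contO_one_sided _ g Hgo) as Hgc.
    assert (Hg1 : nu g = INR K * nu f).
    { unfold g. rewrite (pf_sm nu Hnu (fun j x => f (shiftn (a * j) x))) by (intros; apply contO_shiftn; auto).
      rewrite (sm_ext _ (fun _ => nu f)), sm_const; auto.
      intros i Hi. apply pf_shift_iter; auto. }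
    assert (Hg2 : mu (fun x => g x * g x) <= INR K * (2 * sum_f_R0 D (a * K))).
    { assert (E : mu (fun x => g x * g x) = sm (fun i => sm (fun j => mu (fun x => f (shiftn (a * i) x) * f (shiftn (a * j) x))) K) K).
      { transitivity (mu (fun x => sm (fun i => sm (fun j => f (shiftn (a * i) x) * f (shiftn (a * j) x)) K) K)).
        - apply (pf_ext mu mu_posfun). intros x _. unfold g at 1. rewrite <- sm_scal_r.
          apply sm_ext. intros i Hi. unfold g. rewrite <- sm_scal. reflexivity.
        - rewrite (pf_sm mu mu_posfun (fun i x => sm (fun j => f (shiftn (a * i) x) * f (shiftn (a * j) x)) K)).
          + apply sm_ext. intros i Hi.
            apply (pf_sm mu mu_posfun (fun j x => f (shiftn (a * i) x) * f (shiftn (a * j) x))).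
            intros j. apply contO_mult; apply contO_shiftn; auto.
          + intros i. apply contO_sm. intros j. apply contO_mult; apply contO_shiftn; auto. }
      rewrite E, <- (sm_const (2 * sum_f_R0 D (a * K)) K). apply sm_le. intros i Hi.
      apply Rle_trans with (sm (fun j => D (a * (i - j + (j - i)))%nat) K).
      - apply sm_le. intros j Hj. rewrite mu_corr by auto. apply Rle_abs.
      - eapply Rle_trans; [apply (sm_toeplitz (fun n => D (a * n)%nat) K i Hi); auto|].
        apply Rmult_le_compat_l; [lra|]. rewrite sum_f_R0_sm. apply sm_stride; auto. }
    (* |g| <= g^2/(2d) + d/2 replaces Cauchy-Schwarz; this d balances the two halves. *)
    set (d := eps * INR K). assert (Hd : 0 < d) by (unfold d; nra).
    assert (Hg3 : mu (fun x => Rabs (g x)) <= / (2 * d) * mu (fun x => g x * g x) + d / 2).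
    { apply Rle_trans with (mu (fun x => / (2 * d) * (g x * g x) + (d / 2) * 1)).
      - apply (pf_mono mu mu_posfun); [apply contO_abs; auto|apply contO_lin; [apply contO_mult; auto|apply contO_const]|].
        intros x _. rewrite Rmult_1_r.
        assert (E : g x * g x = Rabs (g x) * Rabs (g x)) by (rewrite <- Rabs_mult, Rabs_right; [ring|nra]).
        rewrite E. set (u := Rabs (g x)).
        apply (Rmult_le_reg_l (2 * d)); [lra|].
        replace (2 * d * (/ (2 * d) * (u * u) + d / 2)) with (u * u + d * d) by (field; lra).
        pose proof (pow2_ge_0 (u - d)). lra.
      - rewrite (pf_lin mu mu_posfun); [|apply contO_mult; auto|apply contO_const]. rewrite mu_1. lra. }
    assert (Hg4 : INR K * Rabs (nu f) <= INR K * eps).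
    { replace (INR K * Rabs (nu f)) with (Rabs (nu g)) by (rewrite Hg1, Rabs_mult, (Rabs_right (INR K)); lra).
      eapply Rle_trans; [apply (pf_abs nu Hnu); auto|].
      eapply Rle_trans; [apply (Hdom (a * K + len)); [|intros; apply Rabs_pos]|].
      { intros x y Hxy. f_equal. apply Hgo; auto. }
      eapply Rle_trans; [exact Hg3|].
      assert (E1 : INR (S (a * K)) <= 2 * INR a * INR K) by (rewrite S_INR, mult_INR; nra).
      assert (E2 : mu (fun x => g x * g x) <= INR K * (2 * (eta * (2 * INR a * INR K)))).
      { eapply Rle_trans; [exact Hg2|]. apply Rmult_le_compat_l; [lra|]. apply Rmult_le_compat_l; [lra|].
        eapply Rle_trans; [exact HS|]. apply Rmult_le_compat_l; lra. }
      assert (E3 : INR K * (2 * (eta * (2 * INR a * INR K))) = d * d) by (unfold eta, d; field; lra).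
      rewrite E3 in E2.
      assert (E4 : / (2 * d) * mu (fun x => g x * g x) <= / (2 * d) * (d * d)).
      { apply Rmult_le_compat_l; auto. left; apply Rinv_0_lt_compat; lra. }
      replace (/ (2 * d) * (d * d)) with (d / 2) in E4 by (field; lra). unfold d in *. lra. }
    apply (Rmult_le_reg_l (INR K)); lra. }
  destruct (Req_dec (nu f) 0) as [E|E]; auto. exfalso. apply Rabs_pos_lt in E.
  specialize (Hsmall (Rabs (nu f) / 2) ltac:(lra)). lra.
Qed.

(** On one-sided functions apply [nu_zero_mean] to g - mu g. A continuous f is approximated by a
    local h, and composing h with a power of T^a makes it one-sided without changing nu h or mu
    h. *)
Lemma nu_proportional f : contO p s f -> nu f = nu (fun _ => 1) * mu f.
Proof.
  assert (H1 : forall len f, one_sided len f -> nu f = nu (fun _ => 1) * mu f).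
  { intros len g Hg. pose proof (contO_one_sided len g Hg) as Hgc.
    assert (E : nu (fun x => g x - mu g) = 0).
    { apply (nu_zero_mean len).
      - intros x y Hxy. f_equal. apply Hg; auto.
      - rewrite (pf_minus mu mu_posfun), (pf_const mu mu_posfun (mu g)), mu_1; [ring|auto|apply contO_const]. }
    rewrite (pf_minus nu Hnu), (pf_const nu Hnu (mu g)) in E; [lra|auto|apply contO_const]. }
  intros Hf.
  set (c := nu (fun _ => 1)).
  assert (Hc : 0 <= c) by (apply (pf_pos nu Hnu); [apply contO_const|intros; lra]).
  assert (H : forall eps, 0 < eps -> Rabs (nu f - c * mu f) <= eps * (2 * c)).
  { intros eps Heps. destruct (contO_approx f eps Hf Heps) as (k & h & Hl & Hfh).
    pose proof (contO_local k h Hl) as Hhc.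
    assert (E : nu h = c * mu h).
    { rewrite <- (pf_shift_iter nu Hnu a Hinv k h Hhc).
      rewrite (H1 (a * k + k + 1)%nat) by (apply local_shiftn; auto; nia).
      rewrite mu_shiftn by auto. reflexivity. }
    pose proof (pf_close nu Hnu f h eps Hf Hhc Hfh) as C1. fold c in C1.
    pose proof (pf_close mu mu_posfun f h eps Hf Hhc Hfh) as C2. rewrite mu_1, Rmult_1_r in C2.
    replace (nu f - c * mu f) with ((nu f - nu h) - c * (mu f - mu h)) by (rewrite E; ring).
    apply Rabs_le_inv in C1. apply Rabs_le_inv in C2. apply Rabs_le. nra. }
  destruct (Req_dec (nu f - c * mu f) 0) as [E|E]; [lra|]. exfalso.
  apply Rabs_pos_lt in E. set (r := Rabs (nu f - c * mu f)) in *.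
  specialize (H (r / (2 * (2 * c + 1))) ltac:(apply Rdiv_lt_0_compat; lra)).
  assert (r / (2 * (2 * c + 1)) * (2 * c) <= r / 2).
  { apply (Rmult_le_reg_r (2 * (2 * c + 1))); [lra|].
    replace (r / (2 * (2 * c + 1)) * (2 * c) * (2 * (2 * c + 1))) with (r * (2 * c)) by (field; lra). nra. }
  lra.
Qed.
End Ergodic.
End Measures.

(** * Correlations along powers *)

Lemma variation_extend (e : nat -> bool) N M : (forall n, e n = true -> (n <= N)%nat) ->
  variation e M <= variation e N.
Proof.
  intros He. unfold variation. destruct (le_lt_dec M N) as [H|H].
  - apply sm_mono; auto. intros; apply Rabs_pos.
  - rewrite (sm_extend _ N M); [lra|lia|]. intros i Hi.
    assert (e i = false) as -> by (destruct (e i) eqn:E; auto; apply He in E; lia).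
    assert (e (S i) = false) as -> by (destruct (e (S i)) eqn:E; auto; apply He in E; lia).
    rewrite Rminus_diag, Rabs_R0. reflexivity.
Qed.

Lemma variation_nonneg e N : 0 <= variation e N.
Proof. apply sm_nonneg. intros; apply Rabs_pos. Qed.

Lemma sm_abs_increments (u : nat -> R) n m :
  sm (fun i => Rabs (u i - u (S i))) n + Rabs (u (S n) - u (S n + m)%nat) <= sm (fun i => Rabs (u i - u (S i))) (n + m).
Proof.
  induction m as [|m IH].
  - rewrite !Nat.add_0_r, Rminus_diag, Rabs_R0. lra.
  - rewrite !Nat.add_succ_r, sm_S.
    pose proof (Rabs_triang (u (S n) - u (S n + m)%nat) (u (S n + m)%nat - u (S (S n + m)))) as T.
    replace (u (S n) - u (S n + m)%nat + (u (S n + m)%nat - u (S (S n + m)))) with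
      (u (S n) - u (S (S n + m))) in T by ring.
    simpl plus in *. lra.
Qed.

(** Sampling along multiples of a cannot increase total variation, by the triangle inequality on
    each stretch. *)
Lemma variation_stride (u : nat -> R) a K : (1 <= a)%nat ->
  sm (fun m => Rabs (u (a * m)%nat - u (a * S m)%nat)) K <= sm (fun i => Rabs (u i - u (S i))) (a * S K).
Proof.
  intros Ha.
  assert (P : sm (fun m => Rabs (u (a * m)%nat - u (a * S m)%nat)) K <= sm (fun i => Rabs (u i - u (S i))) (a * S K - 1)).
  { induction K as [|K IH].
    - apply sm_nonneg. intros; apply Rabs_pos.
    - rewrite sm_S. eapply Rle_trans; [apply Rplus_le_compat_r, IH|].
      pose proof (sm_abs_increments u (a * S K - 1) a) as Q.
      replace (S (a * S K - 1)) with (a * S K)%nat in Q by nia.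
      replace (a * S K + a)%nat with (a * S (S K))%nat in Q by nia.
      replace (a * S K - 1 + a)%nat with (a * S (S K) - 1)%nat in Q by nia. exact Q. }
  eapply Rle_trans; [exact P|]. apply sm_mono; [lia|]. intros; apply Rabs_pos.
Qed.

Lemma Un_cv_inv_INR : Un_cv (fun n => / INR n) 0.
Proof.
  intros eps Heps. destruct (nat_above (2 / eps)) as (n0 & Hn0 & H). exists n0. intros n Hn.
  unfold R_dist. rewrite Rminus_0_r, Rabs_right by (apply Rle_ge, inv_INR_nonneg).
  apply le_INR in Hn. assert (0 < 2 / eps) by (apply Rdiv_lt_0_compat; lra).
  apply Rle_lt_trans with (/ (2 / eps)); [apply Rinv_le_contravar; lra|].
  replace (/ (2 / eps)) with (eps / 2) by (field; lra). lra.
Qed.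

Section Joining.
Variables (p : nat -> nat) (s : nat -> nat -> nat) (mu : (seqZ -> R) -> R).
Hypothesis Hmu : inv_prob p s mu.
Hypothesis Hwm : weakly_mixing p s mu.
Variables (w : seqZ) (e : nat -> nat -> bool).
Hypothesis Hw : inOmega p s w.
Hypothesis He1 : forall N n, e N n = true -> (n <= N)%nat.
Hypothesis He3 : forall eps, 0 < eps -> exists N0, forall N, (N0 <= N)%nat ->
  variation (e N) N * (1 + MertMax N) <= eps * INR N.
Hypothesis He4 : forall W eps, 0 < eps -> exists N0, forall N, (N0 <= N)%nat ->
  sm (fun n => iv (e N n) * cyl W (shiftn n w)) N <= (mu (cyl W) + eps) * INR N.

Lemma block_average_lsum (c : list bool -> R) l : (forall W, 0 <= c W) ->
  forall eps, 0 < eps -> exists N0, forall N, (N0 <= N)%nat ->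
   sm (fun n => iv (e N n) * lsum (fun W => c W * cyl W (shiftn n w)) l) N <=
   (lsum (fun W => c W * mu (cyl W)) l + eps) * INR N.
Proof.
  intros Hc. induction l as [|W l IH]; intros eps Heps.
  - exists 0%nat. intros N _. rewrite sm_0 by (intros; simpl; ring). simpl.
    pose proof (pos_INR N). nra.
  - destruct (IH (eps / 2) ltac:(lra)) as [N0 HN0].
    pose proof (Hc W) as HcW.
    destruct (He4 W (eps / (2 * (c W + 1))) ltac:(apply Rdiv_lt_0_compat; lra)) as [N1 HN1].
    exists (N0 + N1)%nat. intros N HN. specialize (HN0 N ltac:(lia)). specialize (HN1 N ltac:(lia)).
    pose proof (pos_INR N) as HN'.
    rewrite (sm_ext _ (fun n => c W * (iv (e N n) * cyl W (shiftn n w)) +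
       iv (e N n) * lsum (fun W => c W * cyl W (shiftn n w)) l)) by (intros; simpl; ring).
    rewrite sm_plus, sm_scal. simpl lsum.
    apply (Rmult_le_compat_l (c W)) in HN1; auto.
    assert (c W * (eps / (2 * (c W + 1))) <= eps / 2).
    { apply (Rmult_le_reg_r (2 * (c W + 1))); [lra|].
      replace (c W * (eps / (2 * (c W + 1))) * (2 * (c W + 1))) with (c W * eps) by (field; lra). nra. }
    assert (c W * (eps / (2 * (c W + 1))) * INR N <= eps / 2 * INR N) by (apply Rmult_le_compat_r; lra).
    lra.
Qed.

(** A nonnegative one-sided function is a combination of cylinders with nonnegative coefficients, so
    the upper bounds for words add up. *)
Lemma block_average len f : one_sided len f -> (forall x, 0 <= f x) ->
  forall eps, 0 < eps -> exists N0, forall N, (N0 <= N)%nat ->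
   sm (fun n => iv (e N n) * f (shiftn n w)) N <= (mu f + eps) * INR N.
Proof.
  intros Hf Hpos eps Heps.
  destruct (block_average_lsum (fun W => f (unwin W)) (words len) (fun W => Hpos _) eps Heps) as [N0 HN0].
  exists N0. intros N HN. rewrite (mu_one_sided p s mu Hmu len f Hf).
  rewrite (sm_ext _ (fun n => iv (e N n) * lsum (fun W => f (unwin W) * cyl W (shiftn n w)) (words len))); auto.
  intros n Hn. rewrite <- one_sided_expand; auto.
Qed.

Variable U : (nat -> Prop) -> Prop.
Hypothesis HU : ultra U.
Variables a b : nat.
Hypothesis (Ha : (1 <= a)%nat) (Hb : (1 <= b)%nat).

(** Both times must lie in blocks. As the indicators vanish beyond N, this also truncates the pair
    sum at am, bm <= N. *)
Definition wt (N m : nat) : R := iv (e N (a * m)) * iv (e N (b * m)).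
Definition orb (m : nat) : seqZ * seqZ := (shiftn (a * m) w, shiftn (b * m) w).
Definition avg (F : seqZ * seqZ -> R) (N : nat) : R := / INR N * sm (fun m => wt N m * F (orb m)) N.
Definition J0 (F : seqZ * seqZ -> R) : R := ulim U (avg F).

Lemma wt_bounds N m : 0 <= wt N m <= 1.
Proof. unfold wt. destruct (e N (a * m)), (e N (b * m)); simpl; lra. Qed.

Lemma orb_Omega m : inOmega p s (fst (orb m)) /\ inOmega p s (snd (orb m)).
Proof. split; apply inOmega_shiftn; auto. Qed.

Lemma avg_bounded F B : 0 <= B -> (forall z, inOmega p s (fst z) -> inOmega p s (snd z) -> Rabs (F z) <= B) ->
  forall N, Rabs (avg F N) <= B.
Proof.
  intros HB HF N. unfold avg. destruct N as [|N]; [simpl; rewrite Rmult_0_r, Rabs_R0; auto|].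
  set (n := S N). assert (Hn : 0 < INR n) by (apply lt_0_INR; unfold n; lia).
  rewrite Rabs_mult, Rabs_inv, (Rabs_right (INR n)) by lra.
  apply (Rmult_le_reg_l (INR n)); auto. rewrite <- Rmult_assoc, Rinv_r, Rmult_1_l, <- (sm_const B n) by lra.
  apply sm_abs_le. intros m Hm. rewrite Rabs_mult. pose proof (wt_bounds n m).
  destruct (orb_Omega m). pose proof (HF (orb m) ltac:(auto) ltac:(auto)). pose proof (Rabs_pos (F (orb m))).
  rewrite (Rabs_right (wt n m)) by lra. nra.
Qed.

Lemma J0_spec F : contO2 p s F -> is_ulim U (avg F) (J0 F).
Proof.
  intros HF. destruct (contO2_bounded p s F HF) as (B & HB & H).
  apply (ulim_spec U HU _ B). apply avg_bounded; auto.
Qed.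

Lemma J0_ext F G : (forall z, inOmega p s (fst z) -> inOmega p s (snd z) -> F z = G z) -> J0 F = J0 G.
Proof.
  intros H. unfold J0. f_equal. apply functional_extensionality. intros N. unfold avg. f_equal.
  apply sm_ext. intros m Hm. destruct (orb_Omega m). rewrite H; auto.
Qed.

Lemma J0_lin F G c d : contO2 p s F -> contO2 p s G -> J0 (fun z => c * F z + d * G z) = c * J0 F + d * J0 G.
Proof.
  intros HF HG. apply (is_ulim_ulim U HU).
  replace (avg (fun z => c * F z + d * G z)) with (fun N => c * avg F N + d * avg G N).
  - apply is_ulim_lin; auto using J0_spec.
  - apply functional_extensionality. intros N. unfold avg.
    rewrite (sm_ext (fun m => wt N m * (c * F (orb m) + d * G (orb m))) (fun m => c * (wt N m * F (orb m)) + d * (wt N m * G (orb m)))) by (intros; ring).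
    rewrite sm_plus, !sm_scal. ring.
Qed.

Lemma J0_pos F : contO2 p s F -> (forall z, inOmega p s (fst z) -> inOmega p s (snd z) -> 0 <= F z) -> 0 <= J0 F.
Proof.
  intros HF H. apply (is_ulim_le U HU (fun _ => 0) (avg F)); [apply is_ulim_const; auto|apply J0_spec; auto|].
  apply u_all; auto. intros N. apply Rmult_le_pos; [apply inv_INR_nonneg|].
  apply sm_nonneg. intros m Hm. destruct (orb_Omega m). apply Rmult_le_pos; [apply wt_bounds|auto].
Qed.

Lemma wt_variation N K : sm (fun m => Rabs (wt N m - wt N (S m))) K <= 2 * variation (e N) N.
Proof.
  apply Rle_trans with (sm (fun m => Rabs (iv (e N (a * m)) - iv (e N (a * S m))) + Rabs (iv (e N (b * m)) - iv (e N (b * S m)))) K).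
  - apply sm_le. intros m Hm. unfold wt.
    destruct (e N (a * m)), (e N (a * S m)), (e N (b * m)), (e N (b * S m)); unfold iv;
    rewrite ?Rmult_0_l, ?Rmult_0_r, ?Rmult_1_l, ?Rminus_diag, ?Rminus_0_l, ?Rminus_0_r, ?Rabs_Ropp, ?Rabs_R0, ?Rabs_R1; lra.
  - rewrite sm_plus.
    pose proof (variation_stride (fun n => iv (e N n)) a K Ha) as Q1.
    pose proof (variation_stride (fun n => iv (e N n)) b K Hb) as Q2.
    pose proof (variation_extend (e N) N (a * S K) (He1 N)). pose proof (variation_extend (e N) N (b * S K) (He1 N)).
    unfold variation in *. lra.
Qed.

Lemma contO2_shift F : contO2 p s F -> contO2 p s (fun z => F (shiftn a (fst z), shiftn b (snd z))).
Proof.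
  intros HF z H1 H2 eps Heps.
  destruct (HF (shiftn a (fst z), shiftn b (snd z)) (inOmega_shiftn p s a _ H1) (inOmega_shiftn p s b _ H2) eps Heps) as [k Hk].
  exists (k + a + b)%nat. intros z' H1' H2' A1 A2.
  apply Hk; simpl; auto using inOmega_shiftn; apply agree_shiftn;
    eapply agree_le; try eassumption; lia.
Qed.

Lemma variation_little_o : is_ulim U (fun N => / INR N * variation (e N) N) 0.
Proof.
  apply is_ulim_cv; auto. intros eps Heps. destruct (He3 (eps / 2) ltac:(lra)) as [N0 HN0].
  exists (S N0). intros N HN. specialize (HN0 N ltac:(lia)). unfold R_dist. rewrite Rminus_0_r.
  pose proof (variation_nonneg (e N) N) as HV. pose proof (MertMax_nonneg N).
  assert (Hn : 0 < INR N) by (apply lt_0_INR; lia).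
  assert (0 < / INR N) by (apply Rinv_0_lt_compat; auto).
  rewrite Rabs_right by (apply Rle_ge, Rmult_le_pos; lra).
  apply (Rmult_lt_reg_l (INR N)); auto. rewrite <- Rmult_assoc, Rinv_r, Rmult_1_l by lra. nra.
Qed.

(** Applying (T^a, T^b) replaces m by m + 1. Summation by parts leaves two boundary terms and the
    variation of the weights, which is at most twice the number of switches and hence o(N). *)
Lemma J0_inv F : contO2 p s F -> J0 (fun z => F (shiftn a (fst z), shiftn b (snd z))) = J0 F.
Proof.
  intros HF. destruct (contO2_bounded p s F HF) as (B & HB & HFB).
  set (F' := fun z => F (shiftn a (fst z), shiftn b (snd z))).
  assert (HF' : contO2 p s F') by (apply contO2_shift; auto).
  assert (E : forall m, F' (orb m) = F (orb (S m))).
  { intros m. unfold F', orb. simpl fst. simpl snd. rewrite !shiftn_add.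
    replace (a + a * m)%nat with (a * S m)%nat by nia. replace (b + b * m)%nat with (b * S m)%nat by nia. reflexivity. }
  assert (HFo : forall m, Rabs (F (orb m)) <= B) by (intros m; destruct (orb_Omega m); auto).
  apply (is_ulim_unique U HU (avg F')); [apply J0_spec; auto|].
  intros eps Heps.
  assert (D : is_ulim U (fun N => avg F' N - avg F N) 0).
  { apply (is_ulim_squeeze0 U HU _ (fun N => (2 * B) * / INR N + (2 * B) * (/ INR N * variation (e N) N))).
    - replace 0 with ((2 * B) * 0 + (2 * B) * 0) by ring.
      apply is_ulim_lin; auto; [|apply variation_little_o].
      apply is_ulim_cv; auto. exact Un_cv_inv_INR.
    - apply u_all; auto. intros N. unfold avg. rewrite <- Rmult_minus_distr_l, <- sm_minus.
      rewrite Rabs_mult, (Rabs_right (/ INR N)) by (apply Rle_ge, inv_INR_nonneg).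
      replace (2 * B * / INR N + 2 * B * (/ INR N * variation (e N) N)) with
        (/ INR N * (2 * B + B * (2 * variation (e N) N))) by ring.
      apply Rmult_le_compat_l; [apply inv_INR_nonneg|].
      rewrite (sm_ext _ (fun m => - (wt N m * F (orb m) - wt N (S m) * F (orb (S m))) + (wt N m - wt N (S m)) * F (orb (S m))))
        by (intros; rewrite E; ring).
      rewrite sm_plus, sm_opp, (sm_telescope (fun m => wt N m * F (orb m))).
      assert (T1 : forall m, Rabs (wt N m * F (orb m)) <= B).
      { intros m. rewrite Rabs_mult. pose proof (wt_bounds N m). pose proof (HFo m). pose proof (Rabs_pos (F (orb m))).
        rewrite (Rabs_right (wt N m)) by lra. nra. }
      assert (T2 : Rabs (sm (fun m => (wt N m - wt N (S m)) * F (orb (S m))) N) <= B * (2 * variation (e N) N)).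
      { eapply Rle_trans; [|apply Rmult_le_compat_l; [auto|apply (wt_variation N N)]].
        rewrite <- sm_scal. apply sm_abs_le. intros m Hm. rewrite Rabs_mult, Rmult_comm.
        apply Rmult_le_compat_r; [apply Rabs_pos|auto]. }
      pose proof (T1 1%nat) as T3. pose proof (T1 (S N)) as T4.
      apply Rabs_le_inv in T2. apply Rabs_le_inv in T3. apply Rabs_le_inv in T4. apply Rabs_le. lra. }
  generalize (D (eps / 2) ltac:(lra)) (J0_spec F HF (eps / 2) ltac:(lra)). apply u_and_up; auto.
  intros N H1 H2. apply Rabs_def2 in H1. apply Rabs_def2 in H2. apply Rabs_def1; lra.
Qed.

Lemma stride_sum c f N : (1 <= c)%nat -> (forall n, 0 <= f n) ->
  sm (fun m => iv (e N (c * m)) * f (c * m)%nat) N <= sm (fun n => iv (e N n) * f n) N.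
Proof.
  intros Hc Hf.
  apply Rle_trans with (sm (fun i => iv (dvdb c i) * (iv (e N i) * f i)) N).
  - rewrite (sm_multiples c (fun i => iv (e N i) * f i)) by auto. apply sm_le. intros m Hm.
    destruct (e N (c * m)) eqn:E; [|unfold iv; lra].
    apply He1 in E. rewrite (proj2 (Nat.leb_le _ _)) by auto. unfold iv; lra.
  - apply sm_le. intros n Hn. pose proof (iv_bounds (dvdb c n)).
    assert (0 <= iv (e N n) * f n) by (apply Rmult_le_pos; [apply iv_bounds|auto]). nra.
Qed.

(** Drop the indicator of the other coordinate and enlarge the sum over multiples of c to all n:
    positivity makes both steps upper bounds. [G] stands for composition with either projection. *)
Lemma marginal_dom c (G : (seqZ -> R) -> seqZ * seqZ -> R) len f : (1 <= c)%nat ->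
  one_sided len f -> (forall x, 0 <= f x) -> contO2 p s (G f) ->
  (forall m, G f (orb m) = f (shiftn (c * m) w)) -> (forall N m, wt N m <= iv (e N (c * m))) ->
  J0 (G f) <= mu f.
Proof.
  intros Hc Hf Hpos HG Ho Hwt. apply le_epsilon. intros eps Heps.
  destruct (block_average len f Hf Hpos eps Heps) as [N0 HN0].
  apply (is_ulim_le U HU (avg (G f)) (fun _ => mu f + eps)); [apply J0_spec; auto|apply is_ulim_const; auto|].
  apply (u_up U HU (fun N => (S N0 <= N)%nat)); [|apply u_tail; auto]. intros N HN.
  assert (Hn : 0 < INR N) by (apply lt_0_INR; lia).
  unfold avg. apply (Rmult_le_reg_l (INR N)); auto. rewrite <- Rmult_assoc, Rinv_r, Rmult_1_l by lra.
  eapply Rle_trans; [|rewrite Rmult_comm; apply (HN0 N); lia].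
  eapply Rle_trans; [|apply (stride_sum c (fun n => f (shiftn n w)) N Hc); auto].
  apply sm_le. intros m Hm. rewrite Ho. apply Rmult_le_compat_r; auto.
Qed.

Lemma J0_fst f : contO p s f -> J0 (fun z => f (fst z)) = J0 (fun _ => 1) * mu f.
Proof.
  intros Hf. apply (nu_proportional p s mu Hmu Hwm (fun f => J0 (fun z => f (fst z))) a Ha); auto.
  - constructor.
    + intros g h H. apply J0_ext. auto.
    + intros g h c d Hg Hh. apply (J0_lin (fun z => g (fst z)) (fun z => h (fst z))); apply contO2_fst; auto.
    + intros g Hg H. apply J0_pos; [apply contO2_fst; auto|auto].
  - intros g Hg. apply (J0_inv (fun z => g (fst z))). apply contO2_fst; auto.
  - intros len g Hg Hpos. apply (marginal_dom a (fun g z => g (fst z)) len); auto.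
    + apply contO2_fst, (contO_one_sided p s len); auto.
    + intros N m. unfold wt. destruct (e N (a * m)), (e N (b * m)); simpl; lra.
Qed.

Lemma J0_snd f : contO p s f -> J0 (fun z => f (snd z)) = J0 (fun _ => 1) * mu f.
Proof.
  intros Hf. apply (nu_proportional p s mu Hmu Hwm (fun f => J0 (fun z => f (snd z))) b Hb); auto.
  - constructor.
    + intros g h H. apply J0_ext. auto.
    + intros g h c d Hg Hh. apply (J0_lin (fun z => g (snd z)) (fun z => h (snd z))); apply contO2_snd; auto.
    + intros g Hg H. apply J0_pos; [apply contO2_snd; auto|auto].
  - intros g Hg. apply (J0_inv (fun z => g (snd z))). apply contO2_snd; auto.
  - intros len g Hg Hpos. apply (marginal_dom b (fun g z => g (snd z)) len); auto.
    + apply contO2_snd, (contO_one_sided p s len); auto.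
    + intros N m. unfold wt. destruct (e N (a * m)), (e N (b * m)); simpl; lra.
Qed.

Hypothesis Hdisj : disjoint_powers p s mu a b.

Lemma contO2_one : contO2 p s (fun _ => 1).
Proof. exact (contO2_fst p s _ (contO_const p s 1)). Qed.

(* Either J0 vanishes or, once normalized, it is a joining of T^a and T^b. *)
Lemma J0_product f g : contO p s f -> contO p s g ->
  J0 (fun z => f (fst z) * g (snd z)) = J0 (fun _ => 1) * (mu f * mu g).
Proof.
  intros Hf Hg. set (c := J0 (fun _ => 1)).
  set (F := fun z : seqZ * seqZ => f (fst z) * g (snd z)).
  assert (HF : contO2 p s F) by (apply (contO2_mult p s (fun z => f (fst z)) (fun z => g (snd z))); [apply contO2_fst|apply contO2_snd]; auto).
  assert (Hc : 0 <= c) by (apply J0_pos; [apply contO2_one|intros; lra]).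
  destruct (Req_dec c 0) as [E|E].
  (* With total mass 0 no normalization is possible, but positivity of B + F and B - F squeezes
     [J0 F] to 0. *)
  - destruct (contO2_bounded p s F HF) as (B & HB & HFB).
    assert (P1 : 0 <= B * c + 1 * J0 F).
    { rewrite <- (J0_lin (fun _ => 1) F) by (auto using contO2_one). apply J0_pos.
      - apply contO2_lin; auto using contO2_one.
      - intros z H1 H2. pose proof (Rabs_le_inv _ _ (HFB z H1 H2)). lra. }
    assert (P2 : 0 <= B * c + (-1) * J0 F).
    { rewrite <- (J0_lin (fun _ => 1) F) by (auto using contO2_one). apply J0_pos.
      - apply contO2_lin; auto using contO2_one.
      - intros z H1 H2. pose proof (Rabs_le_inv _ _ (HFB z H1 H2)). lra. }
    fold F. rewrite E in *. lra.
  - assert (HJ : joining p s mu a b (fun G => / c * J0 G)).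
    { repeat split.
      - intros G H HGH. rewrite (J0_ext G H HGH). reflexivity.
      - intros G H x y HG HH. rewrite J0_lin by auto. ring.
      - intros G HG Hpos. apply Rmult_le_pos; [left; apply Rinv_0_lt_compat; lra|apply J0_pos; auto].
      - fold c. field. auto.
      - intros G HG. rewrite J0_inv by auto. reflexivity.
      - intros h Hh. rewrite J0_fst by auto. fold c. field. auto.
      - intros h Hh. rewrite J0_snd by auto. fold c. field. auto. }
    pose proof (Hdisj _ HJ f g Hf Hg) as Q. cbv beta in Q. fold F in Q. fold F.
    rewrite <- Q. field. auto.
Qed.

(** For mean-zero g the product formula has value 0 whatever mass the limit retains. The truncations
    in [corr] agree with those already made by the indicators. *)
Lemma corr_zero g : contO p s g -> mu g = 0 ->
  is_ulim U (fun N => / INR N * corr (fun n => iv (e N n) * g (shiftn n w)) a b N) 0.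
Proof.
  intros Hg H0.
  set (F := fun z : seqZ * seqZ => g (fst z) * g (snd z)).
  assert (HF : contO2 p s F) by (apply (contO2_mult p s (fun z => g (fst z)) (fun z => g (snd z))); [apply contO2_fst|apply contO2_snd]; auto).
  pose proof (J0_spec F HF) as Q. unfold F in Q at 2. rewrite J0_product in Q by auto.
  rewrite H0, !Rmult_0_r in Q.
  apply (is_ulim_ext U HU (avg F)); auto. apply u_all; auto. intros N. unfold avg, corr. f_equal.
  apply sm_ext. intros m Hm. unfold F, wt, orb. simpl fst. simpl snd.
  destruct (e N (a * m)) eqn:E1; [|unfold iv; ring].
  destruct (e N (b * m)) eqn:E2; [|unfold iv; ring].
  apply He1 in E1. apply He1 in E2. rewrite !(proj2 (Nat.leb_le _ _)) by auto. unfold iv. ring.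
Qed.
End Joining.

(** * Moebius orthogonality *)

Definition little_o (u : nat -> R) : Prop :=
  forall eps, 0 < eps -> exists N0, forall N, (N0 <= N)%nat -> Rabs (u N) <= eps * INR N.

Lemma little_o_lin u v a b : little_o u -> little_o v -> little_o (fun N => a * u N + b * v N).
Proof.
  intros Hu Hv eps Heps. set (d := eps / (Rabs a + Rabs b + 1)).
  pose proof (Rabs_pos a). pose proof (Rabs_pos b).
  assert (Hd : 0 < d) by (apply Rdiv_lt_0_compat; lra).
  assert (Hde : d * (Rabs a + Rabs b + 1) = eps) by (unfold d; field; lra).
  destruct (Hu d Hd) as [N0 B0]. destruct (Hv d Hd) as [N1 B1].
  exists (N0 + N1)%nat. intros N HN. specialize (B0 N ltac:(lia)). specialize (B1 N ltac:(lia)).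
  pose proof (pos_INR N) as HN'.
  eapply Rle_trans; [apply Rabs_triang|]. rewrite !Rabs_mult.
  assert (Rabs a * Rabs (u N) <= Rabs a * (d * INR N)) by (apply Rmult_le_compat_l; auto).
  assert (Rabs b * Rabs (v N) <= Rabs b * (d * INR N)) by (apply Rmult_le_compat_l; auto).
  assert (0 <= d * INR N) by (apply Rmult_le_pos; lra).
  rewrite <- Hde. lra.
Qed.

Lemma little_o_ext u v : (forall N, u N = v N) -> little_o u -> little_o v.
Proof. intros H Hu eps Heps. destruct (Hu eps Heps) as [N0 H0]. exists N0. intros N HN. rewrite <- H. auto. Qed.

Lemma little_o_le u v : (forall N, Rabs (u N) <= v N) -> little_o v -> little_o u.
Proof.
  intros H Hv eps Heps. destruct (Hv eps Heps) as [N0 H0]. exists N0. intros N HN.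
  eapply Rle_trans; [apply H|]. eapply Rle_trans; [apply Rle_abs|auto].
Qed.

Lemma little_o_const c : little_o (fun _ => c).
Proof.
  intros eps Heps. destruct (nat_above (Rabs c / eps)) as (N0 & _ & H). exists N0. intros N HN.
  apply le_INR in HN. replace (Rabs c) with (eps * (Rabs c / eps)) by (field; lra).
  apply Rmult_le_compat_l; lra.
Qed.

Lemma little_o_MertMax : little_o MertMax.
Proof.
  intros eps Heps. destruct (MertMax_little_o eps Heps) as [N0 H]. exists N0. intros N HN.
  rewrite Rabs_right by (apply Rle_ge, MertMax_nonneg). auto.
Qed.

(** Summation by parts: each switch of the indicator costs at most max |M|, which is why the product
    of the two quantities must be o(N). *)
Lemma sm_moebius_variation (e : nat -> bool) N :
  Rabs (sm (fun n => moebius n * iv (e n)) N) <= MertMax N * (1 + variation e N).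
Proof.
  destruct N as [|N]; [simpl; rewrite Rabs_R0; lra|].
  rewrite sm_abel. eapply Rle_trans; [apply Rabs_triang|].
  pose proof (MertMax_nonneg (S N)) as HM.
  assert (T1 : Rabs (sm moebius (S N) * iv (e (S N))) <= MertMax (S N)).
  { rewrite Rabs_mult. pose proof (MertMax_ge (S N) (S N) (Nat.le_refl _)) as Q. unfold Mert in Q.
    pose proof (iv_bounds (e (S N))). rewrite (Rabs_right (iv _)) by lra.
    pose proof (Rabs_pos (sm moebius (S N))). nra. }
  assert (T2 : Rabs (sm (fun i => sm moebius i * (iv (e i) - iv (e (S i)))) N) <= MertMax (S N) * variation e N).
  { unfold variation. rewrite <- sm_scal. apply sm_abs_le. intros i Hi. rewrite Rabs_mult.
    apply Rmult_le_compat_r; [apply Rabs_pos|]. apply MertMax_ge. lia. }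
  assert (variation e N <= variation e (S N)) by (apply sm_mono; [lia|intros; apply Rabs_pos]).
  assert (MertMax (S N) * variation e N <= MertMax (S N) * variation e (S N)) by (apply Rmult_le_compat_l; auto).
  lra.
Qed.

Lemma sm_shift_le (f : nat -> R) i N : (forall n, 0 <= f n) -> sm (fun n => f (n + i)%nat) N <= sm f (N + i).
Proof.
  intros Hf. induction N as [|N IH]; [apply sm_nonneg; auto|].
  rewrite Nat.add_succ_l, !sm_S, Nat.add_succ_l. lra.
Qed.

Section Main.
Variables (p : nat -> nat) (s : nat -> nat -> nat) (mu : (seqZ -> R) -> R).
Hypothesis Hp : forall n, (1 <= n)%nat -> (2 <= p n)%nat.
Hypothesis Hreas : reasonable p s.
Hypothesis Hmu : is_mu p s mu.
Hypothesis Hwm : weakly_mixing p s mu.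
Hypothesis Hdisj : forall a b : nat, prime (Z.of_nat a) -> prime (Z.of_nat b) -> a <> b ->
  disjoint_powers p s mu a b.

Section Gaps.
Variables (w : seqZ) (e : nat -> nat -> bool).
Hypothesis Hw : inOmega p s w.
Hypothesis He1 : forall N n, e N n = true -> (n <= N)%nat.
Hypothesis He2 : forall N n, (n <= N)%nat -> e N n = false -> w (Z.of_nat n) = true.
Hypothesis He3 : forall eps, 0 < eps -> exists N0, forall N, (N0 <= N)%nat ->
  variation (e N) N * (1 + MertMax N) <= eps * INR N.

Lemma little_o_variation_Mert : little_o (fun N => variation (e N) N * (1 + MertMax N)).
Proof.
  intros eps Heps. destruct (He3 eps Heps) as [N0 H]. exists N0. intros N HN.
  rewrite Rabs_right; auto. apply Rle_ge, Rmult_le_pos; [apply variation_nonneg|].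
  pose proof (MertMax_nonneg N). lra.
Qed.

(* Deep inside a gap the point looks like the constant sequence 1. *)
Lemma gap_deviation len g B N n : one_sided len g -> (forall x, inOmega p s x -> Rabs (g x) <= B) -> (n <= N)%nat ->
  (1 - iv (e N n)) * Rabs (g (shiftn n w) - g (fun _ => true)) <=
  (B + Rabs (g (fun _ => true))) * (sm (fun i => Rabs (iv (e N (n + pred i)) - iv (e N (S (n + pred i))))) len + iv (Nat.ltb N (n + len))).
Proof.
  intros Hg HB Hn. set (c := g (fun _ => true)).
  pose proof (HB (shiftn n w) (inOmega_shiftn p s n w Hw)) as HBn.
  pose proof (Rabs_pos (g (shiftn n w))) as HB0. pose proof (Rabs_pos c) as Hc.
  assert (HD : Rabs (g (shiftn n w) - c) <= B + Rabs c).
  { unfold Rminus. eapply Rle_trans; [apply Rabs_triang|]. rewrite Rabs_Ropp. lra. }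
  assert (HV : 0 <= sm (fun i => Rabs (iv (e N (n + pred i)) - iv (e N (S (n + pred i))))) len)
    by (apply sm_nonneg; intros; apply Rabs_pos).
  set (V := sm _ len) in *. pose proof (iv_bounds (Nat.ltb N (n + len))) as Hi.
  destruct (e N n) eqn:En.
  { unfold iv at 1. rewrite Rminus_diag, Rmult_0_l. apply Rmult_le_pos; lra. }
  unfold iv at 1. rewrite Rminus_0_r, Rmult_1_l.
  destruct (Nat.ltb_spec N (n + len)) as [Hlen|Hlen].
  { unfold iv. pose proof (Rabs_pos (g (shiftn n w) - c)). nra. }
  unfold iv. rewrite Rplus_0_r.
  (* If a block meets the window [n, n + len) although n lies in a gap, the indicator switches there
     and the variation term is at least 1; otherwise the window consists of ones. *)
  destruct (classic (exists i, (i < len)%nat /\ e N (n + i)%nat = true)) as [(i & Hil & Hei)|Hno].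
  - assert (H1 : 1 <= V).
    { apply Rle_trans with (Rabs (iv (e N n) - iv (e N (n + i)%nat))).
      - rewrite En, Hei. unfold iv. rewrite Rminus_0_l, Rabs_Ropp, Rabs_R1. lra.
      - unfold V. apply Rle_trans with (sm (fun i => Rabs (iv (e N (n + pred i)) - iv (e N (S (n + pred i))))) i).
        + clear Hil Hei. induction i as [|i IH].
          * rewrite Nat.add_0_r, Rminus_diag, Rabs_R0. simpl; lra.
          * rewrite sm_S, Nat.pred_succ, Nat.add_succ_r.
            pose proof (Rabs_triang (iv (e N n) - iv (e N (n + i)%nat)) (iv (e N (n + i)%nat) - iv (e N (S (n + i))))) as T.
            replace (iv (e N n) - iv (e N (n + i)%nat) + (iv (e N (n + i)%nat) - iv (e N (S (n + i))))) with
              (iv (e N n) - iv (e N (S (n + i)))) in T by ring. lra.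
        + apply sm_mono; [lia|intros; apply Rabs_pos]. }
    pose proof (Rabs_pos (g (shiftn n w) - c)). nra.
  - replace (g (shiftn n w)) with c.
    + rewrite Rminus_diag, Rabs_R0. apply Rmult_le_pos; lra.
    + apply Hg. intros j Hj. unfold shiftn. symmetry.
      replace (j + Z.of_nat n)%Z with (Z.of_nat (n + Z.to_nat j)) by lia.
      apply (He2 N); [lia|]. destruct (e N (n + Z.to_nat j)%nat) eqn:E; auto.
      exfalso. apply Hno. exists (Z.to_nat j). split; [lia|auto].
Qed.

(** Each switch spoils at most len starting times; at the others g equals its value c at the
    constant sequence 1. What remains is c times the sum of mu over the gaps, controlled by M and
    the number of switches. *)
Lemma gap_sum len g : one_sided len g ->
  little_o (fun N => sm (fun n => (1 - iv (e N n)) * g (shiftn n w) * moebius n) N).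
Proof.
  intros Hg. destruct (contO_bounded p s g (contO_one_sided p s len g Hg)) as (B & HB & HgB).
  set (c := g (fun _ => true)). set (A := B + Rabs c).
  assert (HA : 0 <= A) by (unfold A; pose proof (Rabs_pos c); lra).
  apply (little_o_le _ (fun N => A * (INR len * (variation (e N) N * (1 + MertMax N)) + INR (S len)) +
     Rabs c * (MertMax N * 2 + variation (e N) N * (1 + MertMax N)))).
  - intros N.
    pose proof (variation_nonneg (e N) N) as HV. pose proof (MertMax_nonneg N) as HM.
    rewrite (sm_ext _ (fun n => (1 - iv (e N n)) * (g (shiftn n w) - c) * moebius n +
        (c * moebius n - c * (moebius n * iv (e N n))))) by (intros; ring).
    rewrite sm_plus, sm_minus, !sm_scal.
    assert (T1 : Rabs (sm (fun n => (1 - iv (e N n)) * (g (shiftn n w) - c) * moebius n) N) <=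
       A * (INR len * variation (e N) N + INR (S len))).
    { apply Rle_trans with (sm (fun n => A * (sm (fun i => Rabs (iv (e N (n + pred i)) - iv (e N (S (n + pred i))))) len + iv (Nat.ltb N (n + len)))) N).
      - apply sm_abs_le. intros n Hn. rewrite !Rabs_mult.
        pose proof (iv_bounds (e N n)). rewrite (Rabs_right (1 - _)) by lra.
        eapply Rle_trans; [|apply (gap_deviation len g B N n Hg HgB ltac:(lia))]. fold c.
        pose proof (moebius_abs n).
        assert (0 <= (1 - iv (e N n)) * Rabs (g (shiftn n w) - c)) by (apply Rmult_le_pos; [lra|apply Rabs_pos]). nra.
      - rewrite sm_scal. apply Rmult_le_compat_l; auto. rewrite sm_plus. apply Rplus_le_compat.
        + rewrite sm_swap, <- (sm_const (variation (e N) N) len). apply sm_le. intros i Hi.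
          eapply Rle_trans; [apply (sm_shift_le (fun n => Rabs (iv (e N n) - iv (e N (S n))))); intros; apply Rabs_pos|].
          apply variation_extend. apply He1.
        + eapply Rle_trans; [|apply (count_overlap N (S len))].
          apply sm_le. intros i Hi. replace (pred i + S len)%nat with (i + len)%nat by lia. lra. }
    assert (T2 : Rabs (sm moebius N) <= MertMax N) by (apply (MertMax_ge N N); auto).
    pose proof (sm_moebius_variation (e N) N) as T3.
    assert (T4 : variation (e N) N <= variation (e N) N * (1 + MertMax N)) by nra.
    assert (T5 : INR len * variation (e N) N <= INR len * (variation (e N) N * (1 + MertMax N)))
      by (apply Rmult_le_compat_l; [apply pos_INR|auto]).
    apply (Rmult_le_compat_l A) in T5; auto.
    rewrite <- Rmult_minus_distr_l.
    eapply Rle_trans; [apply Rabs_triang|]. apply Rplus_le_compat.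
    + eapply Rle_trans; [exact T1|]. lra.
    + rewrite Rabs_mult. apply Rmult_le_compat_l; [apply Rabs_pos|].
      apply Rabs_le_inv in T2. apply Rabs_le_inv in T3. apply Rabs_le. nra.
  - replace (fun N => A * (INR len * (variation (e N) N * (1 + MertMax N)) + INR (S len)) +
     Rabs c * (MertMax N * 2 + variation (e N) N * (1 + MertMax N))) with
     (fun N => 1 * ((A * INR len + Rabs c) * (variation (e N) N * (1 + MertMax N)) + (2 * Rabs c) * MertMax N) + 1 * (A * INR (S len)))
     by (apply functional_extensionality; intros; ring).
    apply little_o_lin; [|apply little_o_const].
    apply little_o_lin; [apply little_o_variation_Mert|apply little_o_MertMax].
Qed.
End Gaps.

(* Splits the sum into the part in the blocks, handled by Katai's criterion,
   and the part in the gaps, where f(T^n w) is essentially constant. *)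
Lemma orthogonal_normalized len g w : inOmega p s w -> one_sided len g -> mu g = 0 ->
  (forall x, inOmega p s x -> Rabs (g x) <= 1) ->
  little_o (fun N => sm (fun n => g (shiftn n w) * moebius n) N).
Proof.
  intros Hw Hg Hg0 Hg1 eps Heps.
  pose proof (contO_one_sided p s len g Hg) as Hgc.
  destruct (block_indicators p s mu Hp Hreas Hmu w Hw) as (e & He1 & He2 & He3 & He4).
  apply NNPP. intros Hno.
  set (Bad := fun N => eps * INR N < Rabs (sm (fun n => g (shiftn n w) * moebius n) N)).
  (* Limits are taken along times violating the claim. Only finitely many pairs of primes up to [Y]
     matter, so one such time satisfies all correlation bounds at once and gives the
     contradiction. *)
  destruct (ultra_exists Bad) as (U & HU & HUS).
  { intros N0. apply NNPP. intros H. apply Hno. exists N0. intros N HN. apply Rnot_lt_le. intros Hlt.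
    apply H. exists N. split; auto. }
  destruct (katai (eps / 2) ltac:(lra)) as (Y & delta & N0 & Hdelta & HK).
  destruct (gap_sum w e Hw He1 He2 He3 len g Hg (eps / 2) ltac:(lra)) as [N1 HN1].
  set (a := fun N n => iv (e N n) * g (shiftn n w)).
  assert (HC : U (fun N => forall q, (q < S Y)%nat -> forall r, (r < S Y)%nat ->
     nprime q -> nprime r -> q <> r -> Rabs (corr (a N) q r N) <= delta * INR N)).
  { apply (u_bounded_forall U HU (fun q N => forall r, (r < S Y)%nat ->
       nprime q -> nprime r -> q <> r -> Rabs (corr (a N) q r N) <= delta * INR N)). intros q Hq.
    apply (u_bounded_forall U HU (fun r N =>
       nprime q -> nprime r -> q <> r -> Rabs (corr (a N) q r N) <= delta * INR N)). intros r Hr.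
    destruct (classic (nprime q /\ nprime r /\ q <> r)) as [(P1 & P2 & P3)|Hn].
    2:{ apply u_all; auto. intros N P1 P2 P3. exfalso; auto. }
    pose proof (nprime_ge2 _ P1). pose proof (nprime_ge2 _ P2).
    pose proof (corr_zero p s mu (proj1 Hmu) Hwm w e Hw He1 He3 He4 U HU q r ltac:(lia) ltac:(lia)
      (Hdisj q r P1 P2 P3) g Hgc Hg0 delta Hdelta) as Q.
    generalize Q (u_tail U HU 1). clear Q. apply u_and_up; auto. intros N Q HN _ _ _. fold (a N) in Q.
    assert (HN0 : 0 < INR N) by (apply lt_0_INR; lia).
    rewrite Rminus_0_r, Rabs_mult, (Rabs_right (/ INR N)) in Q by (apply Rle_ge, inv_INR_nonneg).
    left. apply (Rmult_lt_reg_l (/ INR N)); [apply Rinv_0_lt_compat; auto|].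
    replace (/ INR N * (delta * INR N)) with delta by (field; lra). exact Q. }
  destruct (u_ne U HU _ (u_and U HU _ _ HUS (u_and U HU _ _ HC (u_tail U HU (N0 + N1))))) as (N & Q1 & Q2 & Q3).
  assert (K : Rabs (sm (fun n => a N n * moebius n) N) <= eps / 2 * INR N).
  { apply HK; [lia| |].
    - intros n. unfold a. rewrite Rabs_mult. pose proof (iv_bounds (e N n)).
      rewrite (Rabs_right (iv _)) by lra. pose proof (Hg1 _ (inOmega_shiftn p s n w Hw)).
      pose proof (Rabs_pos (g (shiftn n w))). nra.
    - intros q r Hq Hr P1 P2 P3. apply Q2; auto; lia. }
  specialize (HN1 N ltac:(lia)). unfold Bad in Q1.
  rewrite (sm_ext _ (fun n => a N n * moebius n + (1 - iv (e N n)) * g (shiftn n w) * moebius n)) in Q1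
    by (intros; unfold a; ring).
  rewrite sm_plus in Q1.
  pose proof (Rabs_triang (sm (fun n => a N n * moebius n) N) (sm (fun n => (1 - iv (e N n)) * g (shiftn n w) * moebius n) N)).
  lra.
Qed.

(** Split off the mean m = mu g, which contributes m M(N) = o(N), and rescale the rest to absolute
    value at most 1 as Katai's criterion requires. *)
Lemma orthogonal_one_sided len g w : inOmega p s w -> one_sided len g ->
  little_o (fun N => sm (fun n => g (shiftn n w) * moebius n) N).
Proof.
  intros Hw Hg. pose proof (contO_one_sided p s len g Hg) as Hgc.
  destruct (contO_bounded p s g Hgc) as (B & HB & HgB).
  pose proof (proj1 Hmu) as Hinv. pose proof (mu_posfun p s mu Hinv) as Hpf.
  set (m := mu g). set (c := B + Rabs m + 1). pose proof (Rabs_pos m) as Hm.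
  assert (Hc : 0 < c) by (unfold c; lra).
  apply (little_o_ext (fun N => c * sm (fun n => / c * (g (shiftn n w) - m) * moebius n) N + m * Mert N)).
  { intros N. unfold Mert. rewrite <- !sm_scal, <- sm_plus. apply sm_ext. intros n Hn. field. lra. }
  apply little_o_lin.
  - apply (orthogonal_normalized len (fun x => / c * (g x - m))); auto.
    + intros x y Hxy. rewrite (Hg x y Hxy). reflexivity.
    + rewrite (pf_scal p s mu Hpf (/ c) (fun x => g x - m)).
      * rewrite (pf_minus p s mu Hpf), (pf_const p s mu Hpf m), (mu_1 p s mu Hinv); auto using contO_const.
        fold m. ring.
      * apply contO_minus; auto using contO_const.
    + intros x Hx. rewrite Rabs_mult, (Rabs_right (/ c)) by (apply Rle_ge; left; apply Rinv_0_lt_compat; auto).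
      apply (Rmult_le_reg_l c); auto. rewrite <- Rmult_assoc, Rinv_r, Rmult_1_l, Rmult_1_r by lra.
      unfold Rminus. eapply Rle_trans; [apply Rabs_triang|]. rewrite Rabs_Ropp. specialize (HgB x Hx). unfold c. lra.
  - apply (little_o_le _ MertMax); [|apply little_o_MertMax]. intros N. apply MertMax_ge. auto.
Qed.

Lemma orthogonal f w : inOmega p s w -> contO p s f ->
  little_o (fun N => sm (fun n => f (shiftn n w) * moebius n) N).
Proof.
  intros Hw Hf eps Heps.
  destruct (contO_approx p s f (eps / 2) Hf ltac:(lra)) as (k & h & Hh & Hfh).
  (* Moving the point back by k lets h composed with T^k, which is one-sided, take along w' the
     values of h along w; Omega is invariant under the inverse shift too. *)
  set (w' := fun j => w (j - Z.of_nat k)%Z).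
  assert (Hw' : inOmega p s w').
  { intros a len. replace (window w' a len) with (window w (a - Z.of_nat k) len); [apply Hw|].
    apply map_ext. intros j. unfold w'. f_equal. lia. }
  destruct (orthogonal_one_sided (k + k + 1) (fun x => h (shiftn k x)) w' Hw' (local_shiftn k k h (Nat.le_refl k) Hh)
    (eps / 2) ltac:(lra)) as [N0 HN0].
  exists N0. intros N HN. specialize (HN0 N HN).
  rewrite (sm_ext _ (fun n => h (shiftn n w) * moebius n)) in HN0.
  2:{ intros n Hn. f_equal. f_equal. apply functional_extensionality. intros j. unfold shiftn, w'. f_equal. lia. }
  assert (HD : Rabs (sm (fun n => (f (shiftn n w) - h (shiftn n w)) * moebius n) N) <= eps / 2 * INR N).
  { rewrite Rmult_comm, <- sm_const. apply sm_abs_le. intros n Hn. rewrite Rabs_mult.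
    pose proof (Hfh _ (inOmega_shiftn p s n w Hw)). pose proof (moebius_abs n).
    pose proof (Rabs_pos (moebius n)). pose proof (Rabs_pos (f (shiftn n w) - h (shiftn n w))). nra. }
  rewrite (sm_ext _ (fun n => (f (shiftn n w) - h (shiftn n w)) * moebius n + h (shiftn n w) * moebius n)) by (intros; ring).
  rewrite sm_plus. eapply Rle_trans; [apply Rabs_triang|]. lra.
Qed.

Lemma moeb_avg_cv f w : inOmega p s w -> contO p s f -> Un_cv (moeb_avg f w) 0.
Proof.
  intros Hw Hf eps Heps. destruct (orthogonal f w Hw Hf (eps / 2) ltac:(lra)) as [N0 HN0].
  exists N0. intros N HN. specialize (HN0 (S N) ltac:(lia)). unfold R_dist, moeb_avg. rewrite Rminus_0_r.
  rewrite sum_f_R0_sm.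
  rewrite (sm_ext _ (fun n => f (shiftn n w) * moebius n)).
  2:{ intros n Hn. replace (S (pred n)) with n by lia. reflexivity. }
  assert (Hn : 0 < INR (S N)) by (apply lt_0_INR; lia).
  rewrite Rabs_mult, (Rabs_right (/ _)) by (apply Rle_ge, inv_INR_nonneg).
  apply (Rmult_lt_reg_l (INR (S N))); auto. rewrite <- Rmult_assoc, Rinv_r, Rmult_1_l by lra. nra.
Qed.
End Main.

(* f : Omega -> C is represented by its real and imaginary parts fr, fi. *)
Theorem mainTheorem4 (p : nat -> nat) (s : nat -> nat -> nat) (mu : (seqZ -> R) -> R) :
  (forall n : nat, (1 <= n)%nat -> (2 <= p n)%nat) ->
  summable_cond p s ->
  reasonable p s ->
  is_mu p s mu ->
  weakly_mixing p s mu ->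
  (forall a b : nat, prime (Z.of_nat a) -> prime (Z.of_nat b) -> a <> b ->
     disjoint_powers p s mu a b) ->
  forall fr fi : seqZ -> R, contO p s fr -> contO p s fi ->
  forall w : seqZ, inOmega p s w ->
    Un_cv (moeb_avg fr w) 0 /\ Un_cv (moeb_avg fi w) 0.
Proof.
  intros Hp _ Hreas Hmu Hwm Hdisj fr fi Hfr Hfi w Hw.
  split; apply (moeb_avg_cv p s mu); auto.
Qed.
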